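(* Let $\varphi=\{\varphi_m\}_{m=1}^{\infty}$ be a family of convex functions $\varphi_m:\mathbb{R}\to\mathbb{R}$ such that (1) $\lim_{x\to\infty}\dfrac{\varphi_m(x)}{|x|}=+\infty$ for each $m\in\mathbb{N}$; (2) $\varphi_m(x)-\varphi_{m+1}(x)\ge\ln(1+|x|)$ for all $x\in\mathbb{R}$ and $m\in\mathbb{N}$. Then the map $\mathcal{A}: F\in\mathcal{E}^*(\varphi)\mapsto\hat F$, where $\hat F(\lambda)=F(e^{-i\lambda x})$ for $\lambda\in\mathbb{C}$, establishes a topological isomorphism of the spaces $\mathcal{E}^*(\varphi)$ and $Q(\tilde\varphi)$.
   Context: All functions in the spaces below are complex-valued; $x\to\infty$ means $|x|\to\infty$, and $\mathbb{N}=\{1,2,\dots\}$. For each $m\in\mathbb{N}$, $$\mathcal{E}(\varphi_m)=\Big\{f\in C^m(\mathbb{R}):\ q_m(f)=\sup_{x\in\mathbb{R},\ 0\le\alpha\le m}\frac{|f^{(\alpha)}(x)|}{\exp(\varphi_m(x))}<\infty\Big\},$$ normed by $q_m$. Set $\mathcal{E}(\varphi)=\bigcap_{m=1}^\infty\mathcal{E}(\varphi_m)$ with the projective limit topology (the locally convex topology defined by the norms $q_m$, $m\in\mathbb{N}$). $\mathcal{E}^*(\varphi)$ denotes the strong dual of $\mathcal{E}(\varphi)$: the space of continuous linear functionals on $\mathcal{E}(\varphi)$ with the topology of uniform convergence on bounded sets. In $F(e^{-i\lambda x})$ the functional $F$ is applied to the function $x\mapsto e^{-i\lambda x}$, which belongs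 to $\mathcal{E}(\varphi)$. For $m\in\mathbb{N}$ let $\tilde\varphi_m(x)=\sup_{y\in\mathbb{R}}(xy-\varphi_m(y))$, $x\in\mathbb{R}$. Let $H(\mathbb{C})$ be the space of entire functions and $$Q(\tilde\varphi_m)=\Big\{f\in H(\mathbb{C}):\ N_m(f)=\sup_{z\in\mathbb{C}}\frac{|f(z)|}{(1+|z|)^m\exp(\tilde\varphi_m(\operatorname{Im} z))}<\infty\Big\},$$ normed by $N_m$. Set $Q(\tilde\varphi)=\bigcup_{m\in\mathbb{N}}Q(\tilde\varphi_m)$ with the (locally convex) inductive limit topology of the normed spaces $Q(\tilde\varphi_m)$. *)

(* Defs.v *)
From HB Require Import structures.
From mathcomp Require Import all_boot all_order all_algebra.
From mathcomp Require Import all_classical all_reals all_analysis.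
From mathcomp Require Import interval_inference.
From mathcomp Require Import complex ring lra.

Set Implicit Arguments.
Unset Strict Implicit.
Unset Printing Implicit Defensive.

Import Order.TTheory GRing.Theory Num.Theory.
Import numFieldNormedType.Exports.
Import Normc.

Local Open Scope ring_scope.
Local Open Scope classical_set_scope.

Definition absolutely_convex (K : numFieldType) (V : lmodType K) (A : set V) :=
  forall (s t : K) (x y : V),
    `|s| + `|t| <= 1 -> A x -> A y -> A (s *: x + t *: y).

(* The locally convex topology having a given family of absolutely convex,
   absorbing sets as a base of neighbourhoods of the origin. *)
HB.factory Record Lmodule_hasZeroBase (K : numFieldType) V
    & GRing.Lmodule K V := {
  zero_base : set_system V ;
  zero_base_ex : zero_base !=set0 ;
  zero_baseI : forall A B, zero_base A -> zero_base B ->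
    exists2 C, zero_base C & C `<=` A `&` B ;
  zero_baseZ : forall (r : K) A, zero_base A ->
    exists2 C, zero_base C & forall x, C x -> A (r *: x) ;
  zero_base_absconvex : forall A, zero_base A -> absolutely_convex A ;
  zero_base_absorbing : forall A (x : V), zero_base A ->
    exists2 r : K, 0 < r & A (r *: x)
}.

HB.builders Context K V & Lmodule_hasZeroBase K V.

Definition zb_nbhs (x : V) : set_system V :=
  [set U | exists2 A, zero_base A & forall y, A (y - x) -> U y].

HB.instance Definition _ := hasNbhs.Build V zb_nbhs.

Let zb0 A : zero_base A -> A 0.
Proof.
move=> BA; have [r r0 Ar] := zero_base_absorbing 0 BA.
have := @zero_base_absconvex _ BA 0 0 _ _ _ Ar Ar.
by rewrite !scale0r addr0 normr0 addr0; apply; exact: ler01.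
Qed.

Let zbal A (t : K) x : zero_base A -> `|t| <= 1 -> A x -> A (t *: x).
Proof.
move=> BA t1 Ax; have := @zero_base_absconvex _ BA t 0 _ _ _ Ax Ax.
by rewrite scale0r addr0 normr0 addr0; apply.
Qed.

Let zhalf A : zero_base A ->
  exists2 C, zero_base C & forall x y, C x -> C y -> A (x + y).
Proof.
move=> BA; have [C BC CA] := zero_baseZ 2 BA.
exists C => // x y /CA Ax /CA Ay.
have := @zero_base_absconvex _ BA 2^-1 2^-1 _ _ _ Ax Ay.
rewrite !scalerA mulVf ?pnatr_eq0// !scale1r; apply.
by rewrite ger0_norm ?invr_ge0 ?ler0n// -[2^-1]mul1r -splitr.
Qed.

Let zb_filter (x : V) : ProperFilter (nbhs x).
Proof.
split.
  by move=> [A BA] /(_ x); rewrite subrr => /(_ (zb0 BA)).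
split.
- by have [A BA] := zero_base_ex; exists A.
- move=> P Q [A BA AP] [B BB BQ]; have [C BC CAB] := zero_baseI BA BB.
  by exists C => // y /CAB[/AP ? /BQ ?]; split.
- by move=> P Q PQ [A BA AP]; exists A => // y /AP /PQ.
Qed.

Let zb_singleton (x : V) (U : set V) : nbhs x U -> U x.
Proof. by move=> [A BA]; apply; rewrite subrr; exact: zb0. Qed.

Let zb_nbhs_nbhs (x : V) (U : set V) : nbhs x U -> nbhs x (nbhs^~ U).
Proof.
move=> [A BA AU]; have [C BC CA] := zhalf BA.
exists C => // y Cy; exists C => // z Cz; apply: AU.
by rewrite -(subrK y z) -addrA; exact: CA.
Qed.

HB.instance Definition _ :=
  Nbhs_isNbhsTopological.Build V zb_filter zb_singleton zb_nbhs_nbhs.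

Let zb_add : continuous (fun z : V * V => z.1 + z.2).
Proof.
move=> [x y] U [A BA AU] /=; have [C BC CA] := zhalf BA.
exists ([set u | C (u - x)], [set v | C (v - y)]).
  by split; exists C.
move=> [u v] [/= Cu Cv]; apply: AU.
by rewrite opprD addrACA; exact: CA.
Qed.

Let zb_scale : continuous (fun z : K^o * V => z.1 *: z.2).
Proof.
move=> [s x] U [A BA AU] /=; have [C BC CA] := zhalf BA.
have [D BD DC] := zero_baseZ (`|s| + 1) BC.
have [r r0 Cr] := zero_base_absorbing x BC.
have s0 : 0 < `|s| + 1 by rewrite ltr_wpDl.
pose e := Num.min r 1.
have re : 0 < r / (1 + r) by rewrite divr_gt0// addr_gt0.
exists (ball s (r / (1 + r)), [set v | D (v - x)]).
  by split; [exact: nbhsx_ballx | exists D].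
move=> [t v] [/=]; rewrite -ball_normE/= => st Dv; apply: AU.
have -> : t *: v - s *: x = t *: (v - x) + (t - s) *: x.
  by rewrite scalerBr scalerBl addrA subrK.
have str : `|t - s| <= r / (1 + r) by rewrite distrC ltW.
apply: CA.
- have -> : t *: (v - x) = (t / (`|s| + 1)) *: ((`|s| + 1) *: (v - x)).
    by rewrite scalerA divfK// gt_eqF.
  apply: zbal => //; last exact: DC.
  rewrite normrM normfV (gtr0_norm s0) ler_pdivrMr// mul1r.
  rewrite -[t](subrK s) (le_trans (ler_normD _ _))// addrC lerD2l.
  by rewrite (le_trans str)// ler_pdivrMr ?addr_gt0// mul1r lerDr.
- have -> : (t - s) *: x = ((t - s) / r) *: (r *: x).
    by rewrite scalerA divfK// gt_eqF.
  apply: zbal => //; rewrite normrM normfV (gtr0_norm r0) ler_pdivrMr// mul1r.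
  by rewrite (le_trans str)// ler_pdivrMr ?addr_gt0// mulrDr mulr1 lerDl mulr_ge0// ltW.
Qed.

Let zb_convex :
  exists2 B : set_system V, (forall b, b \in B -> convex_set b) & basis B.
Proof.
exists [set U : set V | open U /\ convex_set U].
  by move=> b /[!inE] -[].
split; first by move=> U [].
move=> x U [A BA AU].
pose W : set V := [set z | exists2 C, zero_base C &
  forall y, C (y - z) -> A (y - x)].
exists W; last first.
  move=> z [C BC CA]; apply: AU; apply: CA; rewrite subrr; exact: zb0.
split; last by exists A.
split.
  rewrite openE => z [C BC CA]; have [D BD DC] := zhalf BC.
  exists D => // u Du; exists D => // v Dv; apply: CA.
  by rewrite -(subrK u v) -addrA; exact: DC.
move=> u v t /[!inE] -[C BC CA] [D BD DA].
have [E BE EI] := zero_baseI BC BD.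
pose k := t%:num; exists E => // y Ey.
set w : V := y - (k *: (u : V) + (1 - k) *: v).
have {}Ey : E w by exact: Ey.
have -> : y - x = k *: ((u : V) + (w - x)) + (1 - k) *: ((v : V) + (w - x)).
  have -> : y = k *: (u : V) + (1 - k) *: v + w by rewrite addrC subrK.
  rewrite -addrA; move: (w - x) => a.
  by rewrite !scalerDr addrACA -scalerDl [k + _]addrC subrK scale1r.
apply: (zero_base_absconvex BA).
- have k0 : 0 <= k by rewrite /k.
  have k1 : k <= 1 by rewrite /k.
  by rewrite !ger0_norm ?subr_ge0// addrC subrK.
- by rewrite addrA; apply: CA; rewrite addrAC subrr add0r; have [] := EI _ Ey.
- by rewrite addrA; apply: DA; rewrite addrAC subrr add0r; have [] := EI _ Ey.
Qed.

HB.instance Definition _ :=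
  PreTopologicalLmod_isTvs.Build K V zb_add zb_scale zb_convex.
HB.instance Definition _ :=
  PreTopologicalNmodule_isTopologicalNmodule.Build V zb_add.
HB.instance Definition _ :=
  TopologicalNmodule_isTopologicalLmodule.Build K V zb_scale.
HB.instance Definition _ := Uniform_isTvs.Build K V zb_convex.

HB.end.

(* Only the members of index m >= 1 matter.  The limit as |x| tends to infinity
   is split into the two one-sided limits. *)
Record weight_family (R : realType) := WeightFamily {
  weight :> nat -> R -> R ;
  weight_convex : forall m, (0 < m)%N ->
    convex_function [set: convex_lmodType R^o] (weight m) ;
  weight_cvgNy : forall m, (0 < m)%N ->
    weight m x / `|x| @[x --> -oo] --> +oo ;
  weight_cvgy : forall m, (0 < m)%N ->
    weight m x / `|x| @[x --> +oo] --> +oo ;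
  weight_gap : forall m, (0 < m)%N -> forall x : R,
    ln (1 + `|x|) <= weight m x - weight m.+1 x
}.

(* A real supremum: the set is bounded above for the weights at hand, see
   [legendre_bounded]. *)
Definition legendre (R : realType) (u : R -> R) (x : R) : R :=
  sup [set x * y - u y | y in [set: R]].

Section weights.
Context (R : realType) (phi : weight_family R).

Lemma weight_conv m (t x y : R) : (0 < m)%N -> 0 <= t <= 1 ->
  phi m (t * x + (1 - t) * y) <= t * phi m x + (1 - t) * phi m y.
Proof.
move=> m0 /andP[t0 t1].
have := @weight_convex _ phi m m0 (Itv01 t0 t1) x y.
by rewrite !inE => /(_ I I).
Qed.

Lemma legendre_bounded m (b : R) : (0 < m)%N ->
  exists K, forall y, b * y - phi m y <= K.
Proof.
move=> m0.
have /cvgryPge /(_ `|b|)[M1 [_ HM1]] := @weight_cvgy _ phi m m0.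
have /cvgryPge /(_ `|b|)[M2 [_ HM2]] := @weight_cvgNy _ phi m m0.
pose M := 1 + `|M1| + `|M2|.
have M0 : 0 < M by rewrite /M -addrA ltr_pwDl// addr_ge0.
have lin y : `|b| <= phi m y / `|y| -> y != 0 -> b * y - phi m y <= 0.
  move=> + y0; rewrite ler_pdivlMr ?normr_gt0// subr_le0; apply: le_trans.
  by rewrite -normrM ler_norm.
have big y : M < `|y| -> b * y - phi m y <= 0.
  move=> My; have y0 : y != 0 by rewrite -normr_gt0 (lt_trans M0).
  have [y0'|y0'] := ltP 0 y.
    apply: lin => //; apply: HM1.
    rewrite gtr0_norm// in My; apply: le_lt_trans My.
    by rewrite (le_trans (ler_norm _))// /M addrAC lerDr addr_ge0.
  apply: lin => //; apply: HM2; rewrite ler0_norm// in My.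
  rewrite ltrNr in My; apply: (lt_le_trans My).
  by rewrite lerNl (le_trans (ler_norm _))// normrN /M lerDr addr_ge0.
pose S := `|phi m M| + `|phi m (- M)|.
have S0 : 0 <= S by rewrite addr_ge0.
have upper z : `|z| <= M -> phi m z <= S.
  rewrite ler_norml => /andP[z1 z2].
  pose t := (z + M) / (2 * M).
  have t01 : 0 <= t <= 1.
    have MM : 0 < 2 * M by rewrite mulr_gt0.
    apply/andP; split; first by apply: divr_ge0; lra.
    by rewrite ler_pdivrMr//; lra.
  have := @weight_conv m t M (- M) m0 t01.
  have -> : t * M + (1 - t) * - M = z by rewrite /t; field; rewrite gt_eqF.
  move=> /le_trans; apply; case/andP: t01 => t0 t1.
  apply: lerD.
    by rewrite (le_trans (ler_norm _))// normrM ger0_norm// ler_piMl.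
  by rewrite (le_trans (ler_norm _))// normrM ger0_norm ?subr_ge0// ler_piMl//; lra.
exists (`|b| * M + S + 2 * `|phi m 0|) => y.
have [yM|/big /le_trans] := leP `|y| M; last first.
  by apply; rewrite !addr_ge0// mulr_ge0// ltW.
have h : 0 <= (2^-1 : R) <= 1 by lra.
have := @weight_conv m 2^-1 y (- y) m0 h.
have -> : 2^-1 * y + (1 - 2^-1) * - y = 0 by field.
have := upper (- y); rewrite normrN => /(_ yM) uy.
have by_ : b * y <= `|b| * M.
  by rewrite (le_trans (ler_norm _))// normrM ler_wpM2l.
have := ler_norm (- phi m 0); rewrite normrN; lra.
Qed.

Lemma legendre_ge m (x y : R) : (0 < m)%N ->
  x * y - phi m y <= legendre (phi m) x.
Proof.
move=> m0; apply: ub_le_sup; last by exists y.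
by have [K HK] := legendre_bounded x m0; exists K => _ [z _ <-].
Qed.

Lemma weight_le m n (x : R) : (0 < m)%N -> (m <= n)%N -> phi n x <= phi m x.
Proof.
move=> m0 /subnK <-; elim: (n - m)%N => [//|k IH].
apply: le_trans IH; rewrite addSn -subr_ge0.
apply: le_trans (weight_gap phi (leq_trans m0 (leq_addl _ _)) x).
by rewrite ln_ge0// lerDl.
Qed.

Lemma legendre_le m n (x : R) : (0 < m)%N -> (m <= n)%N ->
  legendre (phi m) x <= legendre (phi n) x.
Proof.
move=> m0 mn; apply: ge_sup; first by exists (x * 0 - phi m 0); exists 0.
move=> _ [y _ <-]; apply: le_trans (legendre_ge x y (leq_trans m0 mn)).
by rewrite lerD2l lerN2 weight_le.
Qed.

End weights.

Lemma ereal_sup_ltP (R : realType) (S : set R) (e : \bar R) : S !=set0 ->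
  (ereal_sup (EFin @` S) < e)%E <->
  exists2 r : R, (r%:E < e)%E & forall u, S u -> u <= r.
Proof.
move=> [u0 Su0]; split=> [Se|[r re ur]]; last first.
  apply: le_lt_trans re; apply: ge_ereal_sup => _ [u Su <-].
  by rewrite lee_fin; exact: ur.
have ub u : S u -> (u%:E <= ereal_sup (EFin @` S))%E.
  by move=> Su; apply: ereal_sup_ubound; exists u.
have /ub u0S := Su0; move: Se ub u0S; case: ereal_sup => [r| |] // re ub _.
  by exists r => // u /ub.
by case: e re.
Qed.

(* Smoothness and derivatives of complex-valued functions of a real variable
   are taken componentwise. *)
Definition class_C (R : realType) (m : nat) (f : R -> R[i]) : Prop :=
  forall u : R -> R,
  u = (fun x => complex.Re (f x)) \/ u = (fun x => complex.Im (f x)) ->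
  (forall a x, (a < m)%N -> derivable u^`(a) x 1) /\ continuous u^`(m).

Definition cderiv (R : realType) (f : R -> R[i]) (a : nat) (x : R) : R[i] :=
  ((fun y => complex.Re (f y))^`(a) x +i* (fun y => complex.Im (f y))^`(a) x)%C.

(* The norm q_m, with u standing for phi_m; meaningful for f of class C^m. *)
Definition Enorm (R : realType) (m : nat) (u : R -> R) (f : R -> R[i]) :
    \bar R :=
  ereal_sup (EFin @` [set normc (cderiv f a x) / expR (u x) |
    a in [set a | (a <= m)%N] & x in [set: R]]).

Definition entire (R : realType) (g : R[i] -> R[i]) : Prop :=
  forall z, derivable (g : R[i]^o -> R[i]^o) z 1.

(* The norm N_m, with u standing for phi_m. *)
Definition Qnorm (R : realType) (m : nat) (u : R -> R) (g : R[i] -> R[i]) :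
    \bar R :=
  ereal_sup (EFin @` [set normc (g z) /
    ((1 + normc z) ^+ m * expR (legendre u (complex.Im z))) | z in [set: R[i]]]).

Section norms.
Context (R : realType).

Lemma Enorm_ltP m (u : R -> R) (f : R -> R[i]) e :
  (Enorm m u f < e)%E <-> exists2 r : R, (r%:E < e)%E &
    forall a x, (a <= m)%N -> normc (cderiv f a x) <= r * expR (u x).
Proof.
rewrite ereal_sup_ltP; last first.
  by exists (normc (cderiv f 0 0) / expR (u 0)); exists 0%N => //; exists 0.
split=> -[r re H]; exists r => //.
  move=> a x am; rewrite -ler_pdivrMr ?expR_gt0//.
  by apply: H; exists a => //; exists x.
by move=> _ [a am [x _ <-]]; rewrite ler_pdivrMr ?expR_gt0//; exact: H.
Qed.

Lemma normc_ge0 (z : R[i]) : 0 <= normc z.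
Proof. by case: z => a b; exact: sqrtr_ge0. Qed.

Lemma normcE (z : R[i]) : `|z| = (normc z)%:C%C.
Proof. by []. Qed.

Lemma normc_comb (s t a b : R[i]) :
  normc (s * a + t * b) <= normc s * normc a + normc t * normc b.
Proof. by rewrite (le_trans (le_normcD _ _))// !normcM. Qed.

Lemma Qweight_gt0 m (u : R -> R) (z : R[i]) :
  0 < (1 + normc z) ^+ m * expR (legendre u (complex.Im z)).
Proof. by rewrite mulr_gt0 ?expR_gt0// exprn_gt0// ltr_pwDl// normc_ge0. Qed.

Lemma Qnorm_ltP m (u : R -> R) (g : R[i] -> R[i]) e :
  (Qnorm m u g < e)%E <-> exists2 r : R, (r%:E < e)%E &
    forall z, normc (g z) <=
      r * ((1 + normc z) ^+ m * expR (legendre u (complex.Im z))).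
Proof.
rewrite ereal_sup_ltP; last by eexists; exists 0.
split=> -[r re H]; exists r => //.
  by move=> z; rewrite -ler_pdivrMr ?Qweight_gt0//; apply: H; exists z.
by move=> _ [z _ <-]; rewrite ler_pdivrMr ?Qweight_gt0//; exact: H.
Qed.

Lemma derive1n_comb m (u v : R -> R) (c d : R) :
  (forall a x, (a < m)%N -> derivable u^`(a) x 1) ->
  (forall a x, (a < m)%N -> derivable v^`(a) x 1) ->
  forall a, (a <= m)%N ->
  (fun x => c * u x + d * v x)^`(a) = (fun x => c * derive1n a u x + d * derive1n a v x).
Proof.
move=> du dv; elim=> [//|a IH am]; rewrite derive1nS IH 1?ltnW//.
apply/funext => x; rewrite derive1E.
rewrite (_ : (fun _ => _) = c *: derive1n a u + d *: derive1n a v)//.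
have ua : derivable (derive1n a u) x 1 by exact: du.
have va : derivable (derive1n a v) x 1 by exact: dv.
have cu : derivable (c *: derive1n a u) x 1 by exact: derivableZ.
have dv' : derivable (d *: derive1n a v) x 1 by exact: derivableZ.
by rewrite deriveD// !deriveZ// -!derive1E !derive1nS.
Qed.

Lemma class_C_comb m (u v : R -> R) (c d : R) :
  (forall a x, (a < m)%N -> derivable u^`(a) x 1) /\ continuous u^`(m) ->
  (forall a x, (a < m)%N -> derivable v^`(a) x 1) /\ continuous v^`(m) ->
  (forall a x, (a < m)%N -> derivable (fun x => c * u x + d * v x)^`(a) x 1) /\
    continuous (fun x => c * u x + d * v x)^`(m).
Proof.
move=> [du cu] [dv cv]; split=> [a x am|].
  rewrite (derive1n_comb _ _ du dv) 1?ltnW//.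
  by apply: derivableD; apply: derivableZ; [exact: du|exact: dv].
rewrite (derive1n_comb _ _ du dv)// => x.
by apply: cvgD; apply: cvgM; try exact: cvg_cst; [exact: cu|exact: cv].
Qed.

End norms.

Section comb.
Context (R : realType).
Implicit Types (f g : R -> R[i]) (s t : R[i]).

Let RP m (u : R -> R) :=
  (forall a x, (a < m)%N -> derivable u^`(a) x 1) /\ continuous u^`(m).

Let re f := fun x => complex.Re (f x).
Let im f := fun x => complex.Im (f x).

Let comb (p q r s : R) (u v w z : R -> R) : R -> R :=
  fun x => 1 * (p * u x + q * v x) + 1 * (r * w x + s * z x).

Let combP m (p q r s : R) (u v w z : R -> R) : RP m u -> RP m v -> RP m w -> RP m z ->
  RP m (comb p q r s u v w z) /\
  forall a x, (a <= m)%N -> derive1n a (comb p q r s u v w z) x =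
    p * derive1n a u x + q * derive1n a v x +
    (r * derive1n a w x + s * derive1n a z x).
Proof.
move=> hu hv hw hz.
have h1 := class_C_comb p q hu hv; have h2 := class_C_comb r s hw hz.
split; first exact: (class_C_comb 1 1 h1 h2).
move=> a x am; rewrite /comb (derive1n_comb 1 1 h1.1 h2.1 am).
rewrite (derive1n_comb p q hu.1 hv.1 am) (derive1n_comb r s hw.1 hz.1 am).
by rewrite !mul1r.
Qed.

Let class_CP m f : class_C m f <-> RP m (re f) /\ RP m (im f).
Proof.
by split=> [H|[H1 H2] _ [->|->]//]; split; apply: H; [left|right].
Qed.

Let reE f g s t : re (s *: (f : R -> R[i]^o) + t *: (g : R -> R[i]^o)) =
  comb (complex.Re s) (- complex.Im s) (complex.Re t) (- complex.Im t)
    (re f) (im f) (re g) (im g).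
Proof.
apply/funext => x; rewrite /re /im /comb /=.
by rewrite -[(_ + _) x]/(s * f x + t * g x);
  case: s (f x) t (g x) => [? ?] [? ?] [? ?] [? ?] /=; ring.
Qed.

Let imE f g s t : im (s *: (f : R -> R[i]^o) + t *: (g : R -> R[i]^o)) =
  comb (complex.Re s) (complex.Im s) (complex.Re t) (complex.Im t)
    (im f) (re f) (im g) (re g).
Proof.
apply/funext => x; rewrite /re /im /comb /=.
by rewrite -[(_ + _) x]/(s * f x + t * g x);
  case: s (f x) t (g x) => [? ?] [? ?] [? ?] [? ?] /=; ring.
Qed.

Lemma class_C_lin m f g s t : class_C m f -> class_C m g ->
  class_C m (s *: (f : R -> R[i]^o) + t *: (g : R -> R[i]^o)) /\
  forall a x, (a <= m)%N ->
    cderiv (s *: (f : R -> R[i]^o) + t *: (g : R -> R[i]^o)) a x =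
    s * cderiv f a x + t * cderiv g a x.
Proof.
move=> /class_CP[f1 f2] /class_CP[g1 g2].
have [h1 h1'] := combP (complex.Re s) (- complex.Im s) (complex.Re t)
  (- complex.Im t) f1 f2 g1 g2.
have [h2 h2'] := combP (complex.Re s) (complex.Im s) (complex.Re t)
  (complex.Im t) f2 f1 g2 g1.
split; first by apply/class_CP; rewrite reE imE.
move=> a x am; rewrite /cderiv -/(re _) -/(im _) reE imE h1'// h2'//.
rewrite -/(re _) -/(im _) -/(re _) -/(im _).
by case: s t {h1 h1' h2 h2'} => [? ?] [? ?]; apply/eqP; rewrite eq_complex /=;
  apply/andP; split; apply/eqP; ring.
Qed.

Lemma Enorm_lin m (u : R -> R) f g s t (e1 e2 : R) :
  class_C m f -> class_C m g ->
  (forall a x, (a <= m)%N -> normc (cderiv f a x) <= e1 * expR (u x)) ->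
  (forall a x, (a <= m)%N -> normc (cderiv g a x) <= e2 * expR (u x)) ->
  forall a x, (a <= m)%N ->
    normc (cderiv (s *: (f : R -> R[i]^o) + t *: (g : R -> R[i]^o)) a x) <=
    (normc s * e1 + normc t * e2) * expR (u x).
Proof.
move=> cf cg hf hg a x am; rewrite (class_C_lin s t cf cg).2//.
rewrite (le_trans (normc_comb _ _ _ _))// mulrDl -!mulrA.
by apply: lerD; apply: ler_wpM2l; rewrite ?normc_ge0 ?hf ?hg.
Qed.

Lemma class_C0 m : class_C m (0 : R -> R[i]^o).
Proof.
have d0 a : derive1n a (fun _ : R => 0 : R) = fun=> 0.
  elim: a => [//|a IH]; rewrite derive1nS IH; apply/funext => x.
  by rewrite derive1E derive_cst.
move=> u uE; have {uE} -> : u = fun=> 0.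
  by case: uE => ->; apply/funext.
split=> [a x am|]; rewrite d0; first exact: derivable_cst.
exact: cst_continuous.
Qed.

Lemma cderiv0 a x : cderiv (0 : R -> R[i]^o) a x = 0.
Proof.
have d0 : derive1n a (fun _ : R => 0 : R) = fun=> 0.
  elim: a => [//|a IH]; rewrite derive1nS IH; apply/funext => y.
  by rewrite derive1E derive_cst.
by rewrite /cderiv /= d0.
Qed.

End comb.

Section Espace.
Context (R : realType) (phi : weight_family R).

Definition Epred : {pred R -> R[i]^o} := mem [set f : R -> R[i]^o |
  forall m, (0 < m)%N -> class_C m f /\ (Enorm m (phi m) f < +oo)%E].

Record Espace := MkE { Efun :> R -> R[i]^o ; _ : Efun \in Epred }.

HB.instance Definition _ := [isSub for Efun].
HB.instance Definition _ := gen_eqMixin Espace.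
HB.instance Definition _ := gen_choiceMixin Espace.

Lemma Epred_submod_closed : submod_closed Epred.
Proof.
split.
  rewrite inE /= => m m0; split; first exact: class_C0.
  apply/Enorm_ltP; exists 0; first exact: ltry.
  by move=> a x _; rewrite cderiv0 normc0 mul0r.
move=> s f g /[!inE] /= Hf Hg m m0.
have [cf /Enorm_ltP[r _ rf]] := Hf m m0.
have [cg /Enorm_ltP[r' _ rg]] := Hg m m0.
rewrite -[g]scale1r; split; first exact: (class_C_lin s 1 cf cg).1.
apply/Enorm_ltP; eexists; last exact: (Enorm_lin s 1 cf cg rf rg).
exact: ltry.
Qed.

HB.instance Definition _ := GRing.isSubmodClosed.Build _ _ Epred
  Epred_submod_closed.
HB.instance Definition _ := [SubChoice_isSubLmodule of Espace by <:].

Lemma EspaceP (f : Espace) m : (0 < m)%N ->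
  class_C m f /\ (Enorm m (phi m) f < +oo)%E.
Proof. by case: f => f /=; rewrite inE; apply. Qed.

(* Basic neighbourhoods of 0 for the topology defined by all the norms q_m:
   finite intersections of balls. *)
Definition Eball (n : nat) (e : R) : set Espace :=
  [set f | forall m, (0 < m <= n)%N -> (Enorm m (phi m) f < e%:E)%E].

Definition Ebase : set_system Espace :=
  [set U | exists n, exists2 e : R, 0 < e & U = Eball n e].

Let Ebase_ex : Ebase !=set0.
Proof. by exists (Eball 0 1), 0%N, 1. Qed.

Let EbaseI A B : Ebase A -> Ebase B -> exists2 C, Ebase C & C `<=` A `&` B.
Proof.
move=> [n [e e0 ->]] [k [d d0 ->]].
exists (Eball (maxn n k) (Num.min e d)).
  by exists (maxn n k), (Num.min e d); rewrite // lt_min e0.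
move=> f Hf; split=> m /andP[m0 mn].
  have := Hf m; rewrite m0 leq_max mn => /(_ isT) /lt_le_trans; apply.
  by rewrite lee_fin ge_min lexx.
have := Hf m; rewrite m0 leq_max mn orbT => /(_ isT) /lt_le_trans; apply.
by rewrite lee_fin ge_min lexx orbT.
Qed.

Let valE (s t : R[i]) (f g : Espace) :
  Efun (s *: f + t *: g) = s *: Efun f + t *: Efun g.
Proof. by []. Qed.

Let Enorm_lt_comb m s t (f g : Espace) (r r' e : R) : (0 < m)%N ->
  (forall a x, (a <= m)%N -> normc (cderiv f a x) <= r * expR (phi m x)) ->
  (forall a x, (a <= m)%N -> normc (cderiv g a x) <= r' * expR (phi m x)) ->
  normc s * r + normc t * r' < e ->
  (Enorm m (phi m) (s *: f + t *: g)%R < e%:E)%E.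
Proof.
move=> m0 hf hg he; apply/Enorm_ltP; exists (normc s * r + normc t * r').
  by rewrite lte_fin.
rewrite valE; apply: Enorm_lin => //; [exact: (EspaceP f m0).1|].
exact: (EspaceP g m0).1.
Qed.

Let Enorm_ge0 m (f : R -> R[i]) (r : R) :
  (forall a x, (a <= m)%N -> normc (cderiv f a x) <= r * expR (phi m x)) ->
  0 <= r.
Proof.
move=> /(_ 0%N 0 isT) H.
by rewrite -(pmulr_lge0 r (expR_gt0 (phi m 0))) (le_trans (normc_ge0 _) H).
Qed.

Let EbaseZ (r : R[i]) A : Ebase A ->
  exists2 C, Ebase C & forall x, C x -> A (r *: x).
Proof.
move=> [n [e e0 ->]].
have r0 : 0 < normc r + 1 by rewrite ltr_wpDl ?normc_ge0.
exists (Eball n (e / (normc r + 1))).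
  by exists n, (e / (normc r + 1)); rewrite ?divr_gt0.
move=> f Hf m /[dup] /andP[m0 _] /Hf /Enorm_ltP[d + dP].
rewrite lte_fin ltr_pdivlMr// => de.
rewrite -[r *: f]addr0 -[0](scale0r f).
apply: (Enorm_lt_comb (r := d) (r' := d)) => //.
rewrite normc0 mul0r addr0; apply: le_lt_trans de.
by rewrite mulrDr mulr1 mulrC lerDl (Enorm_ge0 dP).
Qed.

Let Ebase_absconvex A : Ebase A -> absolutely_convex A.
Proof.
move=> [n [e e0 ->]] s t f g.
rewrite !normcE -rmorphD/= -[1]/(1%:C)%C lecR => st Hf Hg m mn.
have /Enorm_ltP[r + rP] := Hf m mn; have /Enorm_ltP[d + dP] := Hg m mn.
rewrite !lte_fin => de re; case/andP: mn => m0 _.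
apply: (Enorm_lt_comb m0 rP dP).
have rd : Num.max r d < e by rewrite gt_max re.
apply: le_lt_trans rd.
apply: (@le_trans _ _ ((normc s + normc t) * Num.max r d)).
  by rewrite mulrDl; apply: lerD; apply: ler_wpM2l; rewrite ?normc_ge0// le_max
    lexx ?orbT.
by rewrite ler_piMl// le_max (Enorm_ge0 rP).
Qed.

Let Ebase_absorbing A (f : Espace) : Ebase A ->
  exists2 r : R[i], 0 < r & A (r *: f).
Proof.
move=> [n [e e0 ->]].
suff [r r0 Hr] : exists2 r : R, 0 < r & forall m, (0 < m <= n)%N ->
    forall a x, (a <= m)%N -> normc (cderiv f a x) <= r * expR (phi m x).
  have er : 0 < e / (2 * r) by rewrite divr_gt0// mulr_gt0.
  exists (e / (2 * r))%:C%C; first by rewrite ltcR.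
  move=> m mn; rewrite -[_ *: f]addr0 -[0](scale0r f).
  apply: (Enorm_lt_comb (r := r) (r' := r)); [by case/andP: mn|exact: Hr..|].
  have -> : normc (e / (2 * r))%:C%C = e / (2 * r).
    by rewrite /= expr0n addr0 sqrtr_sqr ger0_norm// ltW.
  rewrite normc0 mul0r addr0.
  have -> : e / (2 * r) * r = e / 2 by field; rewrite gt_eqF.
  by rewrite ltr_pdivrMr// ltr_pMr// ltr1n.
elim: n => [|n [r r0 IH]]; first by exists 1 => // -[|m] /andP[].
have [_ /Enorm_ltP[d _ dP]] := EspaceP f (ltn0Sn n).
exists (Num.max r d); first by rewrite lt_max r0.
move=> m /andP[m0]; rewrite leq_eqVlt => /predU1P[->|]; last first.
  rewrite ltnS => mn a x am; apply: (le_trans (IH m _ a x am)).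
    by rewrite m0.
  by rewrite ler_wpM2r ?expR_ge0// le_max lexx.
move=> a x am; apply: (le_trans (dP a x am)).
by rewrite ler_wpM2r ?expR_ge0// le_max lexx orbT.
Qed.

HB.instance Definition _ := Lmodule_hasZeroBase.Build R[i] Espace
  Ebase_ex EbaseI EbaseZ Ebase_absconvex Ebase_absorbing.


End Espace.

(* Boundedness in a topological vector space: every neighbourhood of 0 absorbs
   B. *)
Definition vn_bounded (K : numFieldType) (V : tvsType K) (B : set V) : Prop :=
  forall U : set V, nbhs 0 U -> exists2 r : K, 0 < r &
    forall t : K, r <= `|t| -> B `<=` [set t *: x | x in U].

Section Edual.
Context (R : realType) (phi : weight_family R).

Definition Edual_pred : {pred Espace phi -> R[i]^o} :=
  mem [set F : Espace phi -> R[i]^o | linear F /\ continuous F].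

Record Edual :=
  MkEdual { dual_fun :> Espace phi -> R[i]^o ; _ : dual_fun \in Edual_pred }.

HB.instance Definition _ := [isSub for dual_fun].
HB.instance Definition _ := gen_eqMixin Edual.
HB.instance Definition _ := gen_choiceMixin Edual.

Lemma Edual_submod_closed : submod_closed Edual_pred.
Proof.
split.
  rewrite inE /=; split; last exact: cst_continuous.
  by move=> s f g /=; rewrite scaler0 addr0.
move=> s F G /[!inE] /= -[lF cF] [lG cG]; split=> [t f g|f].
  rewrite -[LHS]/(s *: F (t *: f + g) + G (t *: f + g)) lF lG.
  rewrite -[in RHS]/(t *: (s *: F f + G f) + (s *: F g + G g)).
  by rewrite !scalerDr !scalerA [t * s]mulrC addrACA.
have cs : s *: F x @[x --> f] --> s *: F f.
  apply: (@cvgZ R[i] R[i]^o _ (nbhs f) _ (cst s) F s (F f)).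
    exact: cvg_cst.
  exact: cF.
exact: (@cvgD R[i] R[i]^o _ (nbhs f) _ _ G _ _ cs (cG f)).
Qed.

HB.instance Definition _ := GRing.isSubmodClosed.Build _ _ Edual_pred
  Edual_submod_closed.
HB.instance Definition _ := [SubChoice_isSubLmodule of Edual by <:].

HB.instance Definition _ := Topological.copy Edual (initial_topology
  (dual_fun : Edual -> {family @vn_bounded _ (Espace phi),
                        Espace phi -> R[i]^o})).

End Edual.

Section Qspace.
Context (R : realType) (phi : weight_family R).

Definition Qpred : {pred R[i] -> R[i]^o} := mem [set g : R[i] -> R[i]^o |
  entire g /\ exists2 m, (0 < m)%N & (Qnorm m (phi m) g < +oo)%E].

Record Qspace := MkQ { Qfun :> R[i] -> R[i]^o ; _ : Qfun \in Qpred }.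

HB.instance Definition _ := [isSub for Qfun].
HB.instance Definition _ := gen_eqMixin Qspace.
HB.instance Definition _ := gen_choiceMixin Qspace.

Let Qnorm_lin m (f g : R[i] -> R[i]^o) (s t : R[i]) (r d : R) :
  (forall z, normc (f z) <=
    r * ((1 + normc z) ^+ m * expR (legendre (phi m) (complex.Im z)))) ->
  (forall z, normc (g z) <=
    d * ((1 + normc z) ^+ m * expR (legendre (phi m) (complex.Im z)))) ->
  forall z, normc ((s *: f + t *: g) z) <= (normc s * r + normc t * d) *
    ((1 + normc z) ^+ m * expR (legendre (phi m) (complex.Im z))).
Proof.
move=> hf hg z; rewrite -[(_ + _) z]/(s * f z + t * g z).
rewrite (le_trans (normc_comb _ _ _ _))// mulrDl -!mulrA.
by apply: lerD; apply: ler_wpM2l; rewrite ?normc_ge0 ?hf ?hg.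
Qed.

Let Qnorm_mono m n (g : R[i] -> R[i]) (r : R) : (0 < m)%N -> (m <= n)%N ->
  (forall z, normc (g z) <=
    r * ((1 + normc z) ^+ m * expR (legendre (phi m) (complex.Im z)))) ->
  forall z, normc (g z) <=
    r * ((1 + normc z) ^+ n * expR (legendre (phi n) (complex.Im z))).
Proof.
move=> m0 mn H z; apply: (le_trans (H z)).
have r0 : 0 <= r.
  have := le_trans (normc_ge0 _) (H 0).
  by rewrite (pmulr_lge0 _ (Qweight_gt0 m (phi m) 0)).
have z1 : 1 <= 1 + normc z by rewrite lerDl normc_ge0.
apply: ler_wpM2l => //; apply: ler_pM; rewrite ?expR_ge0//.
- by rewrite exprn_ge0// (le_trans ler01).
- exact: ler_weXn2l.
- by rewrite ler_expR legendre_le.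
Qed.

Lemma Qpred_submod_closed : submod_closed Qpred.
Proof.
split.
  rewrite inE /=; split; first by move=> z; exact: derivable_cst.
  exists 1%N => //; apply/Qnorm_ltP; exists 0; first exact: ltry.
  by move=> z; rewrite normc0 mul0r.
move=> s f g /[!inE] /= -[ef [m m0 /Qnorm_ltP[r _ rP]]].
move=> [eg [n n0 /Qnorm_ltP[d _ dP]]]; split.
  by move=> z; apply: derivableD; [apply: derivableZ; exact: ef|exact: eg].
have mx : (0 < maxn m n)%N by rewrite leq_max m0.
exists (maxn m n) => //; apply/Qnorm_ltP; rewrite -[g]scale1r.
eexists; last by apply: Qnorm_lin; [exact: (Qnorm_mono m0 (leq_maxl _ _) rP)
  |exact: (Qnorm_mono n0 (leq_maxr _ _) dP)].
exact: ltry.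
Qed.

HB.instance Definition _ := GRing.isSubmodClosed.Build _ _ Qpred
  Qpred_submod_closed.
HB.instance Definition _ := [SubChoice_isSubLmodule of Qspace by <:].

(* Base of neighbourhoods of 0 for the locally convex inductive limit: the absolutely
   convex sets whose trace on each step Q(phi~_m) is a neighbourhood of 0. *)
Definition Qbase : set_system Qspace :=
  [set U | absolutely_convex U /\ forall m, (0 < m)%N ->
    exists2 e : R, 0 < e &
      forall g : Qspace, (Qnorm m (phi m) g < e%:E)%E -> U g].

Let Qbase_ex : Qbase !=set0.
Proof. by exists setT; split => // m m0; exists 1. Qed.

Let QbaseI A B : Qbase A -> Qbase B -> exists2 C, Qbase C & C `<=` A `&` B.
Proof.
move=> [cA HA] [cB HB]; exists (A `&` B) => //; split.
  by move=> s t x y st [Ax Bx] [Ay By]; split; [exact: cA|exact: cB].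
move=> m m0; have [e e0 He] := HA m m0; have [d d0 Hd] := HB m m0.
exists (Num.min e d); first by rewrite lt_min e0.
by move=> g gl; split; [apply: He|apply: Hd]; apply: (lt_le_trans gl);
  rewrite lee_fin ge_min lexx ?orbT.
Qed.

Let QnormZ_lt m (s : R[i]) (g : Qspace) (e : R) :
  (Qnorm m (phi m) g < (e / (normc s + 1))%:E)%E ->
  (Qnorm m (phi m) (s *: g)%R < e%:E)%E.
Proof.
have s0 : 0 < normc s + 1 by rewrite ltr_wpDl ?normc_ge0.
move=> /Qnorm_ltP[r]; rewrite lte_fin ltr_pdivlMr// => re rP.
apply/Qnorm_ltP; exists (normc s * r).
  rewrite lte_fin; apply: le_lt_trans re; rewrite mulrDr mulr1 mulrC lerDl.
  have := le_trans (normc_ge0 _) (rP 0).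
  by rewrite (pmulr_lge0 _ (Qweight_gt0 m (phi m) 0)).
move=> z; rewrite -[Qfun (s *: g) z]/(s * g z) normcM -mulrA.
by rewrite ler_wpM2l ?normc_ge0.
Qed.

Let QbaseZ (r : R[i]) A : Qbase A ->
  exists2 C, Qbase C & forall x, C x -> A (r *: x).
Proof.
move=> [cA HA]; exists [set x | A (r *: x)] => //; split.
  move=> s t x y st Ax Ay /=.
  by rewrite scalerDr !scalerA ![r * _]mulrC -!scalerA; exact: cA.
move=> m m0; have [e e0 He] := HA m m0.
have r0 : 0 < normc r + 1 by rewrite ltr_wpDl ?normc_ge0.
exists (e / (normc r + 1)); first by rewrite divr_gt0.
by move=> g /QnormZ_lt; exact: He.
Qed.

Let Qbase_absconvex A : Qbase A -> absolutely_convex A.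
Proof. by case. Qed.

Let Qbase_absorbing A (g : Qspace) : Qbase A ->
  exists2 r : R[i], 0 < r & A (r *: g).
Proof.
move=> [_ HA].
have [_ [m m0 /Qnorm_ltP[d _ dP]]] : entire g /\
    exists2 m, (0 < m)%N & (Qnorm m (phi m) g < +oo)%E.
  by case: g => g /=; rewrite inE.
have [e e0 He] := HA m m0.
have d1 : 0 < `|d| + 1 by rewrite ltr_wpDl.
have ed : 0 < e / (`|d| + 1) by rewrite divr_gt0.
exists (e / (`|d| + 1))%:C%C; first by rewrite ltcR.
apply: He; apply/Qnorm_ltP; exists (e / (`|d| + 1) * d).
  rewrite lte_fin mulrAC ltr_pdivrMr// ltr_pM2l//.
  by rewrite (le_lt_trans (ler_norm _))// ltrDl.
move=> z; rewrite -[Qfun _ z]/((e / (`|d| + 1))%:C%C * g z) normcM -mulrA.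
have -> : normc (e / (`|d| + 1))%:C%C = e / (`|d| + 1).
  by rewrite /= expr0n addr0 sqrtr_sqr ger0_norm// ltW.
by rewrite ler_pM2l.
Qed.

HB.instance Definition _ := Lmodule_hasZeroBase.Build R[i] Qspace
  Qbase_ex QbaseI QbaseZ Qbase_absconvex Qbase_absorbing.

End Qspace.

Definition cexp (R : realType) (z : R[i]) : R[i] :=
  ((expR (complex.Re z) * cos (complex.Im z)) +i*
   (expR (complex.Re z) * sin (complex.Im z)))%C.

Section exponentials.
Context (R : realType) (phi : weight_family R).

Let g (b c p q : R) : R -> R :=
  fun x => expR (b * x) * (p * cos (c * x) + q * sin (c * x)).

Let gD (b c p q x : R) :
  is_derive x 1 (g b c p q) (g b c (b * p + c * q) (b * q - c * p) x).
Proof.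
have lin (k : R) : is_derive x 1 (fun x : R => k * x) k.
  by apply: is_derive_eq; rewrite /GRing.scale /= mulr1.
have hb := lin b; have hc := lin c.
have he := is_derive1_comp (is_derive_expR (b * x)) hb.
have hcos := is_derive1_comp (is_derive_cos (c * x)) hc.
have hsin := is_derive1_comp (is_derive_sin (c * x)) hc.
have hD := is_deriveM he (is_deriveD (is_deriveZ p hcos) (is_deriveZ q hsin)).
apply: (is_derive_eq hD).
transitivity (expR (b * x) * (p * (- sin (c * x) * c) +
    q * (cos (c * x) * c)) +
  (p * cos (c * x) + q * sin (c * x)) * (expR (b * x) * b)); first by [].
by rewrite /g; ring.
Qed.

Let gn (b c p q : R) n :
  exists p' q', derive1n n (g b c p q) = g b c p' q'.
Proof.
elim: n => [|n [p' [q' IH]]]; first by exists p, q.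
exists (b * p' + c * q'), (b * q' - c * p'); rewrite derive1nS IH.
by apply/funext => x; rewrite derive1E; exact: derive_val.
Qed.

Lemma exp_in_E (lambda : R[i]) :
  (fun x : R => cexp (- 'i%C * lambda * x%:C%C)) \in Epred phi.
Proof.
case: lambda => a b; set f := fun x : R => _.
have Ref : (fun x => complex.Re (f x)) = g b (- a) 1 0.
  apply/funext => x; rewrite /f /g /cexp /=.
  by congr (expR _ * _); [ring|rewrite mul1r mul0r addr0; congr cos; ring].
have Imf : (fun x => complex.Im (f x)) = g b (- a) 0 1.
  apply/funext => x; rewrite /f /g /cexp /=.
  by congr (expR _ * _); [ring|rewrite mul1r mul0r add0r; congr sin; ring].
rewrite inE /= => m m0; split.
  move=> u uE; have {uE} [p [q ->]] : exists p q, u = g b (- a) p q.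
    by case: uE => ->; rewrite ?Ref ?Imf; eexists _, _.
  split=> [n x _|].
    by have [p' [q' ->]] := gn b (- a) p q n.
  have [p' [q' ->]] := gn b (- a) p q m => x.
  by apply: differentiable_continuous; apply/derivable1_diffP.
have [K HK] := legendre_bounded phi b m0.
have gle p q x : `|g b (- a) p q x| <= (`|p| + `|q|) * expR K * expR (phi m x).
  rewrite /g normrM (ger0_norm (expR_ge0 _)) mulrC -mulrA.
  apply: ler_pM; rewrite ?expR_ge0//.
    apply: (le_trans (ler_normD _ _)); rewrite !normrM; apply: lerD.
      by rewrite ler_piMr// ler_norml cos_geN1 cos_le1.
    by rewrite ler_piMr// ler_norml sin_geN1 sin_le1.
  by rewrite -expRD ler_expR -lerBlDr.
have one n : exists2 r, 0 <= r & forall x, normc (cderiv f n x) <=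
    r * expR (phi m x).
  have [p [q hp]] := gn b (- a) 1 0 n; have [p' [q' hp']] := gn b (- a) 0 1 n.
  exists ((`|p| + `|q|) * expR K + (`|p'| + `|q'|) * expR K).
    by rewrite !(addr_ge0, mulr_ge0, expR_ge0).
  move=> x; rewrite /cderiv Ref Imf hp hp' mulrDl.
  apply: le_trans (lerD (gle p q x) (gle p' q' x)).
  move: (g _ _ _ _ _) (g _ _ _ _ _) => u v /=.
  rewrite -(ler_pXn2r (ltn0Sn 1)) ?nnegrE ?sqrtr_ge0 ?addr_ge0//.
  rewrite sqr_sqrtr ?addr_ge0 ?sqr_ge0// sqrrD !real_normK ?num_real//.
  by rewrite addrAC lerDl mulrn_wge0// mulr_ge0.
suff [r Hr] : exists r, forall n x, (n <= m)%N ->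
    normc (cderiv f n x) <= r * expR (phi m x).
  by apply/Enorm_ltP; exists r => //; exact: ltry.
elim: {1}m => [|k [r IH]].
  by have [r _ H] := one 0%N; exists r => n x; rewrite leqn0 => /eqP ->.
have [d _ dP] := one k.+1; exists (Num.max r d) => n x.
rewrite leq_eqVlt => /predU1P[->|nk].
  by rewrite (le_trans (dP x))// ler_wpM2r ?expR_ge0// le_max lexx orbT.
rewrite (le_trans (IH n x nk))// ler_wpM2r ?expR_ge0// le_max lexx//.
Qed.

Definition expE (lambda : R[i]) : Espace phi := MkE (exp_in_E lambda).

End exponentials.

Definition topological_isomorphism (K : numFieldType)
    (V W : preTopologicalLmodType K) (A : {linear V -> W}) : Prop :=
  exists B : W -> V,
    [/\ cancel A B, cancel B A, continuous A & continuous B].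

(* Main.v *)
(* The transform of F is entire, and |F(e^(-izx))| is controlled by the norm
   q_m(e^(-izx)) <= (1 + |z|)^m exp(phi~_m(Im z)).

   Surjectivity.  If |g(z)| (1 + |z|)^3 <= r exp(phi~_m(Im z)), then g is the
   transform of f |-> int S(x) f(x) dx, where S(x) is (2 pi)^-1 times the integral
   of g(z) e^(izx) over a line Im z = y.  By Cauchy's theorem S does not depend on
   y, and a subgradient y of phi_m at x gives |S(x)| <= C r exp(- phi_m(x)).  The
   order of growth is lowered by writing g(z) = g(a) h(z) / h(a) + (z - a) g1(z)
   with h(z) = ((e^(iz) - 1) / z)^3: multiplication by z - a is the transpose of
   i d/dx - a.  Each functional so obtained is bounded by C r q_n, with C and n
   independent of g, and this gives the continuity of the inverse.

   Injectivity.  Combinations of exponentials are dense: Bernstein polynomials in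
   sin(x / P) approximate f uniformly on compact sets, and derivatives are gained
   one at a time by solving p' - k p = p1 within the exponential sums.

   Continuity of the transform.  If |F| <= 1 on the set where q_k <= c_k for all k,
   then by Montel's argument |F| <= 2 where q_k <= c_k for the finitely many k <= N;
   by Hahn-Banach F is then a sum of F_k with |F_k| <= 4 q_k / c_k, and such a sum
   has its transform in a given absolutely convex neighbourhood if the c_k are
   large enough. *)
From HB Require Import structures.
From mathcomp Require Import all_boot all_order all_algebra.
From mathcomp Require Import all_classical all_reals all_analysis.
From mathcomp Require Import complex ring lra.
Require Import Defs.

Set Implicit Arguments.
Unset Strict Implicit.
Unset Printing Implicit Defensive.

Import Order.TTheory GRing.Theory Num.Theory.
Import numFieldNormedType.Exports.
Import Normc.

Local Open Scope ring_scope.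
Local Open Scope classical_set_scope.

(** * Complex functions of a real variable *)

Section real_calculus.
Context {R : realType}.
Implicit Types (a b x y M : R) (u v U V : R -> R).

(** Continuity of the inverse needs bounds on the functionals that are uniform in g, whereas
    dividing by z - a spoils every bound near a. Estimates of g are therefore followed only for |Im
    z| above a threshold; this loses nothing, because the height y of the line that serves S(x) can
    always be taken above that threshold, by the superlinear growth of phi_m. The point a lies on
    the positive imaginary axis, where h has no zero; h decays like |z|^-3 on horizontal lines, and
    its growth 1 + exp(-3 Im z) is dominated by exp(phi~_m(Im z)). Quotients by z - a are only known
    to be continuous at a, so Cauchy's theorem is proved for continuous functions holomorphic off a
    finite set. In the density argument, k exceeds the imaginary parts of the frequencies in p1,
    which makes p' - k p = p1 solvable; the factor |x| lost in estimating the solution is paid by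
    the gap between phi_N and phi_{N+1}. The same gap gives the smallness at infinity behind
    Montel's argument. Both continuity statements are checked directly on basic neighbourhoods, with
    no open mapping theorem. *)

Lemma is_derive_continuous U x l : is_derive x 1 U l -> {for x, continuous U}.
Proof.
move=> dU; apply: differentiable_continuous; apply/derivable1_diffP.
exact: ex_derive.
Qed.

(** Mean value theorem for [V - U]. This comparison of increments does the work of the monotonicity
    of integrals in all later estimates. *)
Lemma increment_le U V u v a b : a <= b ->
  (forall x, a <= x <= b -> is_derive x 1 U (u x)) ->
  (forall x, a <= x <= b -> is_derive x 1 V (v x)) ->
  (forall x, a <= x <= b -> u x <= v x) -> U b - U a <= V b - V a.
Proof.
rewrite le_eqVlt => /predU1P[->|ab dU dV uv]; first by rewrite !subrr.
have dW x : a <= x <= b -> is_derive x 1 (V - U) (v x - u x).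
  by move=> xab; apply: is_deriveB; [exact: dV|exact: dU].
have cW : {within `[a, b], continuous (V - U)}.
  by apply: derivable_within_continuous => x; rewrite in_itv => /dW[].
have [x|c cab] := @MVT _ (V - U) (fun x => v x - u x) _ _ ab _ cW.
  by rewrite in_itv => /andP[xa xb]; apply: dW; rewrite !ltW.
rewrite -[(V - U) b]/(V b - U b) -[(V - U) a]/(V a - U a) => E.
have : 0 <= (v c - u c) * (b - a).
  rewrite mulr_ge0 ?subr_ge0 ?(ltW ab)// uv//.
  by move: cab; rewrite in_itv => /andP[? ?]; rewrite !ltW.
rewrite -E; lra.
Qed.

Lemma increment_norm U u a b M : a <= b ->
  (forall x, a <= x <= b -> is_derive x 1 U (u x)) ->
  (forall x, a <= x <= b -> `|u x| <= M) -> `|U b - U a| <= M * (b - a).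
Proof.
move=> ab dU uM.
have dl (k : R) x : a <= x <= b -> is_derive x 1 (fun y : R => k * y) k.
  by move=> _; apply: is_derive_eq; rewrite /GRing.scale /= mulr1.
have h1 := increment_le ab (dl (- M)) dU; have h2 := increment_le ab dU (dl M).
rewrite ler_norml; apply/andP; split.
  suff : - M * b - - M * a <= U b - U a by lra.
  by apply: h1 => x /uM; rewrite ler_norml => /andP[].
suff : U b - U a <= M * b - M * a by lra.
by apply: h2 => x /uM; rewrite ler_norml => /andP[].
Qed.

Lemma increment_normV U u a b M :
  (forall x, is_derive x 1 U (u x)) ->
  (forall x, `|x - a| <= `|b - a| -> `|u x| <= M) ->
  `|U b - U a| <= M * `|b - a|.
Proof.
move=> dU uM; have [ab|ba] := leP a b.
  rewrite ger0_norm ?subr_ge0// in uM *; apply: (increment_norm ab) => // x xab.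
  by apply: uM; rewrite ger0_norm; lra.
rewrite ltr0_norm ?subr_lt0// opprB in uM *; rewrite distrC.
apply: (increment_norm (ltW ba)) => // x xab.
by apply: uM; rewrite ler0_norm; lra.
Qed.

Lemma primitive_shift U V u a b : (forall x, is_derive x 1 U (u x)) ->
  (forall x, is_derive x 1 V (u x)) -> U b - U a = V b - V a.
Proof.
move=> dU dV; have dW x : is_derive x 1 (U - V) 0.
  by rewrite -(subrr (u x)); exact: is_deriveB.
have := is_derive_0_is_cst a b dW.
rewrite -[(U - V) a]/(U a - V a) -[(U - V) b]/(U b - V b); lra.
Qed.

Let primitive_right (u : R -> R) (a : R) : continuous u ->
  exists U : R -> R, forall x, a < x -> is_derive x 1 U (u x).
Proof.
move=> cu; exists (fun x => (\int[lebesgue_measure]_(t in `[a, x]) u t)%R) => x ax.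
have xx : x < x + 1 by rewrite ltrDl.
have iu : lebesgue_measure.-integrable `[a, x + 1] (EFin \o u).
  apply: continuous_compact_integrable; first exact: segment_compact.
  exact: continuous_subspaceT.
have [] := @continuous_FTC1 R u (BLeft a) x (x + 1) xx iu _ (cu x).
  by [].
by move=> dx <-; rewrite derive1E; exact/derivableP.
Qed.

(** The fundamental theorem gives primitives on right half-lines. Those on ]-(n+1), +oo[, normalised
    to vanish at 0, agree where both are primitives, and are glued by reading at x the one of index
    floor |x|. *)
Lemma primitive_exists (u : R -> R) : continuous u ->
  exists U : R -> R, forall x, is_derive x 1 U (u x).
Proof.
move=> cu.
have /choice[U dU] : forall n : nat, exists U : R -> R,
    U 0 = 0 /\ forall x, - n.+1%:R < x -> is_derive x 1 U (u x).
  move=> n; have [U dU] := primitive_right (- n.+1%:R) cu.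
  exists (fun x => U x - U 0); split; first by rewrite subrr.
  move=> x nx; have d1 := dU x nx.
  by apply: is_derive_eq; rewrite subr0.
have UE m n x : (m <= n)%N -> - m.+1%:R < x -> U m x = U n x.
  move=> mn mx; have mn' : - n.+1%:R <= - m.+1%:R :> R by rewrite lerN2 ler_nat.
  have [Um0 dm] := dU m; have [Un0 dn] := dU n.
  have m0 : - m.+1%:R < 0 :> R by rewrite oppr_lt0.
  have [x0|x0] := leP x 0.
    have H y : x <= y <= 0 -> is_derive y 1 (U m) (u y).
      by case/andP => xy _; apply: dm; apply: lt_le_trans xy.
    have H' y : x <= y <= 0 -> is_derive y 1 (U n) (u y).
      by case/andP => xy _; apply: dn; apply: le_lt_trans mn' (lt_le_trans mx xy).
    have h1 := increment_le x0 H H' (fun _ _ => lexx _).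
    have h2 := increment_le x0 H' H (fun _ _ => lexx _).
    by rewrite Um0 Un0 in h1 h2; lra.
  have H y : 0 <= y <= x -> is_derive y 1 (U m) (u y).
    by case/andP => xy _; apply: dm; apply: lt_le_trans xy.
  have H' y : 0 <= y <= x -> is_derive y 1 (U n) (u y).
    by case/andP => xy _; apply: dn; apply: le_lt_trans mn' (lt_le_trans m0 xy).
  have h1 := increment_le (ltW x0) H H' (fun _ _ => lexx _).
  have h2 := increment_le (ltW x0) H' H (fun _ _ => lexx _).
  by rewrite Um0 Un0 in h1 h2; lra.
exists (fun x => U (Num.truncn `|x|) x) => x.
(* This single index is at least floor |y| for all y within distance 1 of x, so the glued function
   coincides with [U N] near x. *)
pose N := Num.truncn (`|x| + 1).
have Nx y : `|y - x| < 1 -> U N y = U (Num.truncn `|y|) y.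
  move=> xy; apply/esym/UE.
    apply: le_truncn; rewrite -[y](subrK x) (le_trans (ler_normD _ _))//.
    by rewrite addrC lerD2l ltW.
  rewrite ltrNl (le_lt_trans (ler_norm _))// normrN; exact: truncnS_gt.
apply: (@near_eq_is_derive _ _ _ (U N)); last first.
  apply: (dU N).2; rewrite ltrNl (le_lt_trans (ler_norm _))// normrN.
  by apply: (@lt_trans _ _ (`|x| + 1)); rewrite ?ltrDl//; exact: truncnS_gt.
near=> y; apply: Nx; near: y.
by exists 1 => //= y; rewrite /ball/= distrC.
Unshelve. all: by end_near. Qed.

End real_calculus.

Section complex_norm.
Context {R : realType}.
Implicit Types (z w : R[i]).

Lemma normc_sqr z : normc z ^+ 2 = complex.Re z ^+ 2 + complex.Im z ^+ 2.
Proof. by case: z => a b; rewrite sqr_sqrtr// addr_ge0 ?sqr_ge0. Qed.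

Lemma le_normc_Re z : `|complex.Re z| <= normc z.
Proof.
rewrite -(ler_pXn2r (ltn0Sn 1)) ?nnegrE ?normc_ge0// normc_sqr.
by rewrite real_normK ?num_real// lerDl sqr_ge0.
Qed.

Lemma le_normc_Im z : `|complex.Im z| <= normc z.
Proof.
rewrite -(ler_pXn2r (ltn0Sn 1)) ?nnegrE ?normc_ge0// normc_sqr.
by rewrite real_normK ?num_real// lerDr sqr_ge0.
Qed.

Lemma normc_le_ReIm z : normc z <= `|complex.Re z| + `|complex.Im z|.
Proof.
rewrite -(ler_pXn2r (ltn0Sn 1)) ?nnegrE ?normc_ge0 ?addr_ge0// normc_sqr.
by rewrite sqrrD !real_normK ?num_real// addrAC lerDl mulrn_wge0// mulr_ge0.
Qed.

Lemma normc_real (x : R) : normc x%:C%C = `|x|.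
Proof. by rewrite /= expr0n addr0 sqrtr_sqr. Qed.

Lemma normcD z w : normc (z + w) <= normc z + normc w.
Proof. exact: le_normcD. Qed.

Lemma normc_opp z : normc (- z) = normc z.
Proof. by case: z => a b /=; rewrite !sqrrN. Qed.

Lemma normcB z w : normc (z - w) <= normc z + normc w.
Proof. by rewrite (le_trans (normcD _ _))// normc_opp. Qed.

Lemma normc_dist z w : normc (z - w) = normc (w - z).
Proof. by rewrite -normc_opp opprB. Qed.

Lemma normcX z n : normc (z ^+ n) = normc z ^+ n.
Proof.
elim: n => [|n IH]; first by rewrite !expr0 normc1.
by rewrite !exprS normcM IH.
Qed.

Lemma normc_eq0 z : (normc z == 0) = (z == 0).
Proof.
apply/eqP/eqP => [/eq0_normc//|->]; exact: normc0.
Qed.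

Lemma normc_gt0 z : (0 < normc z) = (z != 0).
Proof. by rewrite lt_neqAle normc_ge0 andbT eq_sym normc_eq0. Qed.

Lemma normc_i : normc ('i%C : R[i]) = 1.
Proof. by rewrite /= expr0n add0r expr1n sqrtr1. Qed.

Lemma complexP z w :
  complex.Re z = complex.Re w -> complex.Im z = complex.Im w -> z = w.
Proof. by case: z w => [a b] [c d] /= -> ->. Qed.

Lemma Re_add z w : complex.Re (z + w) = complex.Re z + complex.Re w.
Proof. by case: z w => [a b] [c d]. Qed.
Lemma Im_add z w : complex.Im (z + w) = complex.Im z + complex.Im w.
Proof. by case: z w => [a b] [c d]. Qed.
Lemma Re_opp z : complex.Re (- z) = - complex.Re z.
Proof. by case: z. Qed.
Lemma Im_opp z : complex.Im (- z) = - complex.Im z.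
Proof. by case: z. Qed.
Lemma Re_mul z w : complex.Re (z * w) =
  complex.Re z * complex.Re w - complex.Im z * complex.Im w.
Proof. by case: z w => [a b] [c d]. Qed.
Lemma Im_mul z w : complex.Im (z * w) =
  complex.Re z * complex.Im w + complex.Im z * complex.Re w.
Proof. by case: z w => [a b] [c d]. Qed.

End complex_norm.

Section complex_sequences.
Context {R : realType}.
Implicit Types (w v : nat -> R[i]) (l k s t : R[i]).

(** Stated with the real-valued [normc], since the norm of [R[i]] takes its values in [R[i]]. *)
Definition ctends w l := forall e : R, 0 < e ->
  exists N, forall n, (N <= n)%N -> normc (w n - l) < e.

Lemma ctendsP w l : ctends w l <->
  complex.Re (w n) @[n --> \oo] --> complex.Re l /\
  complex.Im (w n) @[n --> \oo] --> complex.Im l.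
Proof.
split=> [H|[hr hi] e e0].
  split; apply/cvgrPdist_lt => e /H[N HN]; exists N => // n /= /HN;
    apply: le_lt_trans; rewrite -?Re_opp -?Im_opp -?Re_add -?Im_add normc_dist.
    exact: le_normc_Re.
  exact: le_normc_Im.
have e2 : 0 < e / 2 by rewrite divr_gt0.
move/cvgrPdist_lt : hr => /(_ _ e2)[N1 _ H1].
move/cvgrPdist_lt : hi => /(_ _ e2)[N2 _ H2].
exists (maxn N1 N2) => n; rewrite geq_max => /andP[n1 n2].
have := H1 n n1; have := H2 n n2; rewrite /= normc_dist => h2 h1.
apply: le_lt_trans (normc_le_ReIm _) _.
by rewrite Re_add Im_add Re_opp Im_opp; lra.
Qed.

Lemma ctends_unique w l k : ctends w l -> ctends w k -> l = k.
Proof.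
move=> /ctendsP[l1 l2] /ctendsP[k1 k2]; apply: complexP.
  exact: cvg_unique l1 k1.
exact: cvg_unique l2 k2.
Qed.

Lemma ctends_lin w v l k s t : ctends w l -> ctends v k ->
  ctends (fun n => s * w n + t * v n) (s * l + t * k).
Proof.
move=> hw hv e e0; set M := normc s + normc t + 1.
have M0 : 0 < M by rewrite /M ltr_wpDl// addr_ge0 ?normc_ge0.
have eM : 0 < e / M by rewrite divr_gt0.
have [N1 H1] := hw _ eM; have [N2 H2] := hv _ eM.
exists (maxn N1 N2) => n; rewrite geq_max => /andP[/H1 n1 /H2 n2].
have -> : s * w n + t * v n - (s * l + t * k) =
  s * (w n - l) + t * (v n - k) by ring.
apply: le_lt_trans (normc_comb _ _ _ _) _.
apply: (@le_lt_trans _ _ ((normc s + normc t) * (e / M))).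
  by rewrite mulrDl; apply: lerD; rewrite ler_wpM2l ?normc_ge0// ltW.
rewrite mulrA ltr_pdivrMr// mulrC ltr_pM2l//.
by rewrite /M ltrDl.
Qed.

Lemma ctends_cst l : ctends (fun=> l) l.
Proof. by move=> e e0; exists 0%N => n _; rewrite subrr normc0. Qed.

Lemma ctends_eq w v l : (forall n, w n = v n) -> ctends w l -> ctends v l.
Proof. by move=> wv; have -> : v = w by apply/funext. Qed.

Lemma ctends_le w l (M : R) : (forall n, normc (w n) <= M) -> ctends w l ->
  normc l <= M.
Proof.
move=> wM wl; apply/ler_addgt0Pr => e /wl[N /(_ N (leqnn _)) HN].
rewrite -[l](subKr (w N)) opprB addrC subrK.
have -> : l = w N - (w N - l) by ring.
by rewrite (le_trans (normcB _ _))// lerD// ltW.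
Qed.

Lemma ctends0_dom w (d : nat -> R) : d n @[n --> \oo] --> (0 : R) ->
  (forall n, normc (w n) <= d n) -> ctends w 0.
Proof.
move=> /cvgrPdist_lt d0 wd e /d0[N _ HN]; exists N => n /HN /=.
rewrite subr0 sub0r normrN; apply: le_lt_trans.
by rewrite (le_trans (wd n))// ler_norm.
Qed.

Lemma ctends_inv w (C : R) :
  (forall n : nat, normc (w n) <= C / n.+1%:R) -> ctends w 0.
Proof.
apply: ctends0_dom; rewrite -[0](mulr0 C).
by apply: cvgM; [exact: cvg_cst|exact: cvg_harmonic].
Qed.

End complex_sequences.

Section cder.
Context {R : realType}.
Implicit Types (f g : R -> R[i]) (x : R) (l k s : R[i]).

Definition cder f x l :=
  is_derive x 1 (fun y => complex.Re (f y)) (complex.Re l) /\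
  is_derive x 1 (fun y => complex.Im (f y)) (complex.Im l).

Definition rcont f := continuous (fun y => complex.Re (f y)) /\
  continuous (fun y => complex.Im (f y)).

Lemma cder_eq f x l k : cder f x l -> l = k -> cder f x k.
Proof. by move=> ? <-. Qed.

Lemma cder_cst s x : cder (fun=> s) x 0.
Proof. by split; exact: is_derive_cst. Qed.

Lemma cderD f g x l k : cder f x l -> cder g x k ->
  cder (fun y => f y + g y) x (l + k).
Proof.
move=> [f1 f2] [g1 g2]; rewrite /cder Re_add Im_add.
under eq_fun do rewrite Re_add.
by under [in X in _ /\ X]eq_fun do rewrite Im_add; split; exact: is_deriveD.
Qed.

Lemma cderM f g x l k : cder f x l -> cder g x k ->
  cder (fun y => f y * g y) x (l * g x + f x * k).
Proof.
move=> [f1 f2] [g1 g2]; rewrite /cder Re_add Im_add !Re_mul !Im_mul.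
under eq_fun do rewrite Re_mul.
under [in X in _ /\ X]eq_fun do rewrite Im_mul.
split.
  apply: is_derive_eq (is_deriveB (is_deriveM f1 g1) (is_deriveM f2 g2)) _.
  by rewrite /GRing.scale /=; ring.
apply: is_derive_eq (is_deriveD (is_deriveM f1 g2) (is_deriveM f2 g1)) _.
by rewrite /GRing.scale /=; ring.
Qed.

Lemma cderZ s f x l : cder f x l -> cder (fun y => s * f y) x (s * l).
Proof.
by move=> df; apply: cder_eq (cderM (cder_cst s x) df) _; ring.
Qed.

Lemma cderN f x l : cder f x l -> cder (fun y => - f y) x (- l).
Proof.
move=> /(cderZ (-1)); rewrite mulN1r.
by under eq_fun do rewrite mulN1r.
Qed.

Lemma cder_real x : cder (fun y => y%:C%C) x 1.
Proof. by split => /=; [exact: is_derive_id|exact: is_derive_cst]. Qed.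

Lemma cderX f x l n : cder f x l ->
  cder (fun y => f y ^+ n.+1) x (n.+1%:R * f x ^+ n * l).
Proof.
move=> df; elim: n => [|n IH].
  by apply: cder_eq df _; rewrite expr0 !mul1r.
under eq_fun do rewrite exprS.
apply: cder_eq (cderM df IH) _.
by rewrite [n.+2%:R]mulrSr [f x ^+ n.+1]exprS; ring.
Qed.

Lemma cder_exp f x l : cder f x l ->
  cder (fun y => cexp (f y)) x (l * cexp (f x)).
Proof.
move=> [f1 f2]; rewrite /cder /cexp /=.
have he := is_derive1_comp (is_derive_expR (complex.Re (f x))) f1.
have hc := is_derive1_comp (is_derive_cos (complex.Im (f x))) f2.
have hs := is_derive1_comp (is_derive_sin (complex.Im (f x))) f2.
split.
  apply: is_derive_eq (is_deriveM he hc) _.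
  by rewrite Re_mul /GRing.scale /=; ring.
apply: is_derive_eq (is_deriveM he hs) _.
by rewrite Im_mul /GRing.scale /=; ring.
Qed.

Lemma cder_rcont f g : (forall x, cder f x (g x)) -> rcont f.
Proof.
by move=> df; split=> x; have [d1 d2] := df x;
  [exact: is_derive_continuous d1|exact: is_derive_continuous d2].
Qed.

(** The factor 2 comes from treating real and imaginary parts separately by the real mean value
    theorem. *)
Lemma cder_norm f g (a b M : R) : a <= b ->
  (forall x, a <= x <= b -> cder f x (g x)) ->
  (forall x, a <= x <= b -> normc (g x) <= M) ->
  normc (f b - f a) <= 2 * M * (b - a).
Proof.
move=> ab df gM; rewrite (le_trans (normc_le_ReIm _))// Re_add Im_add Re_opp Im_opp.
have -> : 2 * M * (b - a) = M * (b - a) + M * (b - a) by ring.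
apply: lerD.
  apply: (@increment_norm _ (fun y => complex.Re (f y)) (fun y => complex.Re (g y)))
    => // [x /df[]//|x /gM].
  by apply: le_trans; exact: le_normc_Re.
apply: (@increment_norm _ (fun y => complex.Im (f y)) (fun y => complex.Im (g y)))
    => // [x /df[]//|x /gM].
by apply: le_trans; exact: le_normc_Im.
Qed.

Lemma cder_normV f g (a b M : R) :
  (forall x, cder f x (g x)) ->
  (forall x, `|x - a| <= `|b - a| -> normc (g x) <= M) ->
  normc (f b - f a) <= 2 * M * `|b - a|.
Proof.
move=> df gM; rewrite (le_trans (normc_le_ReIm _))// Re_add Im_add Re_opp Im_opp.
have -> : 2 * M * `|b - a| = M * `|b - a| + M * `|b - a| by ring.
apply: lerD.
  apply: (@increment_normV _ (fun y => complex.Re (f y)) (fun y => complex.Re (g y)))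
    => // [x|x /gM]; first by have [] := df x.
  by apply: le_trans; exact: le_normc_Re.
apply: (@increment_normV _ (fun y => complex.Im (f y)) (fun y => complex.Im (g y)))
    => // [x|x /gM]; first by have [] := df x.
by apply: le_trans; exact: le_normc_Im.
Qed.

(** [cder_normV] is used twice: on f minus its tangent at a, whose derivative is g x - g a, and on g
    to bound that derivative. Hence the 4. *)
Lemma cder_taylor f g h (a b M : R) :
  (forall x, cder f x (g x)) -> (forall x, cder g x (h x)) ->
  (forall x, `|x - a| <= `|b - a| -> normc (h x) <= M) ->
  normc (f b - f a - (b - a)%:C%C * g a) <= 4 * M * `|b - a| ^+ 2.
Proof.
move=> df dg hM.
pose F x := f x - (x - a)%:C%C * g a.
have dF x : cder F x (g x - g a).
  apply: cderD; first exact: df.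
  apply: cderN; rewrite -[X in cder _ _ X]mul1r.
  under eq_fun do rewrite mulrC.
  rewrite mulrC; apply: cderZ; rewrite -[X in cder _ _ X]addr0.
  under eq_fun do rewrite rmorphB /=.
  by apply: cderD; [exact: cder_real|exact: cder_cst].
have -> : f b - f a - (b - a)%:C%C * g a = F b - F a.
  by rewrite /F subrr mul0r; ring.
have -> : 4 * M * `|b - a| ^+ 2 = 2 * (2 * M * `|b - a|) * `|b - a| by ring.
apply: (cder_normV dF) => x xab; apply: le_trans (_ : 2 * M * `|x - a| <= _).
  by apply: (cder_normV dg) => y yx; apply: hM; exact: le_trans xab.
apply: ler_wpM2l xab; rewrite mulr_ge0//.
apply: le_trans (hM a _); first exact: normc_ge0.
by rewrite subrr normr0.
Qed.

Lemma rcont_lin f g s l : rcont f -> rcont g -> rcont (fun x => s * f x + l * g x).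
Proof.
move=> [f1 f2] [g1 g2]; split=> x.
  under eq_fun do rewrite Re_add !Re_mul.
  by apply: cvgD; apply: cvgB; apply: cvgM; try exact: cvg_cst;
    [exact: f1|exact: f2|exact: g1|exact: g2].
under eq_fun do rewrite Im_add !Im_mul.
by apply: cvgD; apply: cvgD; apply: cvgM; try exact: cvg_cst;
  [exact: f2|exact: f1|exact: g2|exact: g1].
Qed.

Lemma rcontM f g : rcont f -> rcont g -> rcont (fun x => f x * g x).
Proof.
move=> [f1 f2] [g1 g2]; split=> x.
  under eq_fun do rewrite Re_mul.
  by apply: cvgB; apply: cvgM; [exact: f1|exact: g1|exact: f2|exact: g2].
under eq_fun do rewrite Im_mul.
by apply: cvgD; apply: cvgM; [exact: f1|exact: g2|exact: f2|exact: g1].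
Qed.

End cder.

(** * Integrals over segments and over the real line *)

Section integrals.
Context {R : realType}.
Implicit Types (u v : R -> R) (f g : R -> R[i]) (a b c M : R) (s t : R[i]).

(* Meaningful for continuous u: the integral of u is the increment of prim u. *)
Definition prim u : R -> R :=
  xget (fun=> 0) [set U : R -> R | forall x : R, is_derive x 1 U (u x)].

Definition int a b u := prim u b - prim u a.

Definition cint a b f : R[i] :=
  (int a b (fun x => complex.Re (f x)) +i* int a b (fun x => complex.Im (f x)))%C.

Lemma primP u : continuous u -> forall x : R, is_derive x 1 (prim u) (u x).
Proof. by move=> /primitive_exists H; exact: (xgetPex (fun=> 0) H). Qed.

Lemma intE u U a b : (forall x : R, is_derive x 1 U (u x)) -> int a b u = U b - U a.
Proof.
move=> dU; apply: (primitive_shift (u := u)) => // x.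
exact: (@xgetPex _ (fun=> 0)
  [set U : R -> R | forall x : R, is_derive x 1 U (u x)] (ex_intro _ U dU) x).
Qed.

Lemma cintE f F a b : (forall x, cder F x (f x)) -> cint a b f = F b - F a.
Proof.
move=> dF; apply: complexP; rewrite /cint /= ?Re_add ?Im_add ?Re_opp ?Im_opp.
  by apply: (intE (U := fun x => complex.Re (F x))) => x; have [] := dF x.
by apply: (intE (U := fun x => complex.Im (F x))) => x; have [] := dF x.
Qed.

Definition cprim f x : R[i] :=
  (prim (fun x => complex.Re (f x)) x +i* prim (fun x => complex.Im (f x)) x)%C.

Lemma cprimP f : rcont f -> forall x, cder (cprim f) x (f x).
Proof. by move=> [f1 f2] x; split; apply: primP. Qed.

Lemma cint_cat f a b c : cint a b f + cint b c f = cint a c f.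
Proof. by apply: complexP; rewrite /cint /= /int; ring. Qed.

Lemma cint_lin f g s t a b : rcont f -> rcont g ->
  cint a b (fun x => s * f x + t * g x) = s * cint a b f + t * cint a b g.
Proof.
move=> cf cg; rewrite (cintE (f := f) (F := cprim f)); last exact: cprimP.
rewrite (cintE (f := g) (F := cprim g)); last exact: cprimP.
rewrite (cintE (F := fun x => s * cprim f x + t * cprim g x)); last first.
  by move=> x; apply: cderD; apply: cderZ; exact: cprimP.
by ring.
Qed.

Lemma cint_norm f a b M : rcont f -> a <= b ->
  (forall x, a <= x <= b -> normc (f x) <= M) ->
  normc (cint a b f) <= 2 * M * (b - a).
Proof.
move=> cf ab fM; rewrite (cintE (f := f) (F := cprim f)); last exact: cprimP.
by apply: (cder_norm (g := f)) => // x _; exact: cprimP.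
Qed.

Lemma rcont_cst s : rcont (fun _ : R => s).
Proof. by split=> x; exact: cvg_cst. Qed.

Definition decays (C : R) f := forall x, normc (f x) <= C / (1 + x ^+ 2).

(** The improper integral, truncated symmetrically at integers. The limits exist for continuous
    integrands satisfying [decays], by [line_int_cvg]. *)
Definition line_int f : R[i] :=
  (lim (complex.Re (cint (- n%:R) n%:R f) @[n --> \oo]) +i*
   lim (complex.Im (cint (- n%:R) n%:R f) @[n --> \oo]))%C.

(** Adding the integral of C / (1 + x^2), known through atan, makes the sequence nondecreasing. Both
    [V] (the sum) and [W] (the added term) are monotone and bounded, hence their difference
    converges. *)
Let int_cvg u C : continuous u -> (forall x, `|u x| <= C / (1 + x ^+ 2)) ->
  cvgn (fun n => int (- n%:R) n%:R u).
Proof.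
move=> cu uC; have dU := primP cu.
have datan (x : R) : is_derive x 1 (fun x : R => C * atan x) (C / (1 + x ^+ 2)).
  by have d := is_derive1_atan x; apply: is_derive_eq.
have C0 : 0 <= C by have := le_trans (normr_ge0 _) (uC 0); rewrite expr0n addr0 divr1.
have atan_mono x y : x <= y -> C * atan x <= C * atan y.
  move=> xy; rewrite -subr_ge0 -[leLHS](subrr (0 : R)).
  apply: (@increment_le _ (fun=> 0) _ (fun=> 0) _ _ _ xy _ (fun x _ => datan x)).
  by move=> z _; rewrite divr_ge0// addr_ge0// sqr_ge0.
have bnd x y : x <= y -> `|prim u y - prim u x| <= C * atan y - C * atan x.
  move=> xy; rewrite ler_norml; apply/andP; split.
    have := increment_le xy (fun x _ => is_deriveN (datan x)) (fun x _ => dU x).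
    rewrite -[(- _) y]/(- (C * atan y)) -[(- _) x]/(- (C * atan x)) => H.
    suff : - (C * atan y) - - (C * atan x) <= prim u y - prim u x by lra.
    by apply: H => z _; have := uC z; rewrite ler_norml => /andP[].
  apply: (increment_le xy (fun x _ => dU x) (fun x _ => datan x)) => z _.
  by have := uC z; rewrite ler_norml => /andP[].
have nn (n : nat) : - n%:R <= n%:R :> R by have := ler0n R n; lra.
pose V n := prim u n%:R - prim u (- n%:R) + (C * atan n%:R - C * atan (- n%:R)).
pose W n : R := C * atan n%:R - C * atan (- n%:R).
have Cpi (x : R) : `|C * atan x| <= C * pi.
  rewrite normrM ger0_norm// ler_wpM2l// ler_norml.
  have := atan_gtNpi2 x; have := atan_ltpi2 x; have := pi_gt0 R; lra.
have Wc : cvgn W.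
  apply: nondecreasing_is_cvgn.
    move=> n m nm; rewrite /W lerB//; apply: atan_mono; rewrite ?lerN2 ler_nat//.
  exists (2 * C * pi) => _ [n _ <-]; rewrite /W.
  have := Cpi n%:R; have := Cpi (- n%:R); rewrite !ler_norml; lra.
have Vc : cvgn V.
  apply: nondecreasing_is_cvgn.
    move=> n m nm; have nm' : n%:R <= m%:R :> R by rewrite ler_nat.
    have := bnd _ _ nm'; have nm2 : - m%:R <= - n%:R :> R by rewrite lerN2.
    by have := bnd _ _ nm2; rewrite /V !ler_norml; lra.
  exists (4 * C * pi) => _ [n _ <-]; rewrite /V.
  have := bnd _ _ (nn n).
  have := Cpi n%:R; have := Cpi (- n%:R); rewrite !ler_norml; lra.
rewrite (_ : (fun n => _) = V \- W); first exact: is_cvgB.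
by apply/funext => n; rewrite /V /W /= /int; lra.
Qed.

Lemma line_int_cvg f C : rcont f -> decays C f ->
  ctends (fun n => cint (- n%:R) n%:R f) (line_int f).
Proof.
move=> [f1 f2] fC; apply/ctendsP; split => /=.
  by apply: (int_cvg f1) => x; apply: le_trans (fC x); exact: le_normc_Re.
by apply: (int_cvg f2) => x; apply: le_trans (fC x); exact: le_normc_Im.
Qed.

Lemma line_int_unique f l :
  ctends (fun n => cint (- n%:R) n%:R f) l -> line_int f = l.
Proof.
by move=> /ctendsP[h1 h2]; apply: complexP => /=; exact: cvg_lim.
Qed.

Lemma line_int_lin f g s t C D : rcont f -> rcont g -> decays C f -> decays D g ->
  line_int (fun x => s * f x + t * g x) = s * line_int f + t * line_int g.
Proof.
move=> cf cg fC gD; apply: line_int_unique.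
apply: ctends_eq (ctends_lin s t (line_int_cvg cf fC) (line_int_cvg cg gD)).
by move=> n; rewrite cint_lin.
Qed.

Lemma decays_lin f g s t C D : decays C f -> decays D g ->
  decays (normc s * C + normc t * D) (fun x => s * f x + t * g x).
Proof.
move=> fC gD x; rewrite (le_trans (normc_comb _ _ _ _))// mulrDl -!mulrA.
by apply: lerD; apply: ler_wpM2l; rewrite ?normc_ge0.
Qed.

Lemma decays_ge0 f C : decays C f -> 0 <= C.
Proof. by move=> /(_ 0); rewrite expr0n addr0 divr1; exact/le_trans/normc_ge0. Qed.

(** The total increment of atan is at most pi; the real and imaginary parts contribute pi C each. *)
Lemma line_int_norm f C : rcont f -> decays C f ->
  normc (line_int f) <= 2 * pi * C.
Proof.
move=> cf fC; apply: ctends_le (line_int_cvg cf fC) => n.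
rewrite (cintE (f := f) (F := cprim f)); last exact: cprimP.
have C0 := decays_ge0 fC.
have datan (x : R) : is_derive x 1 (fun x : R => C * atan x) (C / (1 + x ^+ 2)).
  by have d := is_derive1_atan x; apply: is_derive_eq.
have nn : - n%:R <= n%:R :> R by have := ler0n R n; lra.
have ub (U u : R -> R) : (forall x : R, is_derive x 1 U (u x)) ->
    (forall x, `|u x| <= C / (1 + x ^+ 2)) -> `|U n%:R - U (- n%:R)| <= pi * C.
  move=> dU uC; apply: le_trans (_ : C * atan n%:R - C * atan (- n%:R) <= _).
    rewrite ler_norml; apply/andP; split.
      have := increment_le nn (fun x _ => is_deriveN (datan x)) (fun x _ => dU x).
      rewrite -[(- _) n%:R]/(- (C * atan n%:R)).
      rewrite -[(- _) (- n%:R)]/(- (C * atan (- n%:R))) => H.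
      suff : - (C * atan n%:R) - - (C * atan (- n%:R)) <= U n%:R - U (- n%:R) by lra.
      by apply: H => z _; have := uC z; rewrite ler_norml => /andP[].
    apply: (increment_le nn (fun x _ => dU x) (fun x _ => datan x)) => z _.
    by have := uC z; rewrite ler_norml => /andP[].
  rewrite -mulrBr mulrC ler_wpM2r//.
  have := atan_gtNpi2 (- n%:R : R); have := atan_ltpi2 (n%:R : R); lra.
rewrite (le_trans (normc_le_ReIm _))// Re_add Im_add Re_opp Im_opp.
have -> : 2 * pi * C = pi * C + pi * C by ring.
have d := cprimP cf; apply: lerD.
  apply: (ub (fun x => complex.Re (cprim f x)) (fun x => complex.Re (f x))) => x.
    by have [] := d x.
  by apply: le_trans (fC x); exact: le_normc_Re.
apply: (ub (fun x => complex.Im (cprim f x)) (fun x => complex.Im (f x))) => x.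
  by have [] := d x.
by apply: le_trans (fC x); exact: le_normc_Im.
Qed.

End integrals.

(** * Cauchy's theorem *)

Section complex_functions.
Context {R : realType}.
Implicit Types (H G : R[i] -> R[i]) (z w l k : R[i]) (e : R).

Definition ccont H z := forall e, 0 < e -> exists2 d : R, 0 < d &
  forall w, normc (w - z) < d -> normc (H w - H z) < e.

(** Complex differentiability in first-order form, with real moduli; [cdiffP] identifies it with the
    derivative of the library. *)
Definition cdiff H z l := forall e, 0 < e -> exists2 d : R, 0 < d &
  forall w, normc (w - z) < d ->
    normc (H w - H z - l * (w - z)) <= e * normc (w - z).

Definition holo H z := exists l, cdiff H z l.

Lemma ccont_rcont H (g : R -> R[i]) :
  (forall z, ccont H z) -> rcont g -> rcont (fun t => H (g t)).
Proof.
move=> cH [g1 g2].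
have key (t : R) e : 0 < e -> \forall u \near t, normc (H (g u) - H (g t)) < e.
  move=> /(cH (g t))[d d0 Hd]; have d2 : 0 < d / 2 by rewrite divr_gt0.
  have /cvgrPdist_lt /(_ _ d2) n1 := g1 t.
  have /cvgrPdist_lt /(_ _ d2) n2 := g2 t.
  near=> u; apply: Hd; apply: le_lt_trans (normc_le_ReIm _) _.
  rewrite Re_add Im_add Re_opp Im_opp [`|complex.Re _ - _|]distrC.
  rewrite [`|complex.Im _ - _|]distrC (splitr d); apply: ltrD.
    by near: u.
  by near: u.
split=> t; apply/cvgrPdist_lt => e /(key t) K; near=> u;
    rewrite distrC -?Re_opp -?Im_opp -?Re_add -?Im_add.
  by apply: le_lt_trans (le_normc_Re _) _; near: u.
by apply: le_lt_trans (le_normc_Im _) _; near: u.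
Unshelve. all: by end_near. Qed.

Lemma rcont_hline c : rcont (fun x : R => (x +i* c)%C).
Proof. by split=> x /=; [exact: cvg_id|exact: cvg_cst]. Qed.

Lemma rcont_vline c : rcont (fun x : R => (c +i* x)%C).
Proof. by split=> x /=; [exact: cvg_cst|exact: cvg_id]. Qed.

Lemma cder_hline (c x : R) : cder (fun x : R => (x +i* c)%C) x 1.
Proof. by split => /=; [exact: is_derive_id|exact: is_derive_cst]. Qed.

Lemma cder_vline (c x : R) : cder (fun x : R => (c +i* x)%C) x 'i%C.
Proof. by split => /=; [exact: is_derive_cst|exact: is_derive_id]. Qed.

Lemma cdiff_ccont H z l : cdiff H z l -> ccont H z.
Proof.
move=> dH e e0; have [d d0 Hd] := dH 1 ltr01.
have l0 : 0 < 2 + normc l by rewrite ltr_wpDr// normc_ge0.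
exists (Num.min d (e / (2 + normc l))); first by rewrite lt_min d0 divr_gt0.
move=> w; rewrite lt_min => /andP[/Hd h1 h2].
have -> : H w - H z = (H w - H z - l * (w - z)) + l * (w - z) by ring.
apply: le_lt_trans (normcD _ _) _; rewrite normcM.
rewrite ltr_pdivlMr// in h2; apply: le_lt_trans h2.
have := normc_ge0 (w - z); nra.
Qed.

Lemma holo_ccont H z : holo H z -> ccont H z.
Proof. by move=> [l /cdiff_ccont]. Qed.

End complex_functions.

(** * Goursat's lemma on rectangles *)

Section Goursat.
Context {R : realType}.
Implicit Types (H G : R[i] -> R[i]) (z : R[i]) (a b c d m n : R).

(** The contour integral of [H] along the boundary of [a, b] x [c, d], counterclockwise: bottom
    minus top, plus i times right minus left. *)
Definition rect H a b c d : R[i] :=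
  cint a b (fun x => H (x +i* c)%C) - cint a b (fun x => H (x +i* d)%C) +
  'i%C * (cint c d (fun y => H (b +i* y)%C) - cint c d (fun y => H (a +i* y)%C)).

Local Arguments rect : simpl never.

Lemma rect_split H a b c d m n : rect H a b c d =
  rect H a m c n + rect H m b c n + rect H a m n d + rect H m b n d.
Proof.
rewrite /rect -!(cint_cat _ a m b) -!(cint_cat _ c n d); ring.
Qed.

Lemma rcont_h H c : (forall z, ccont H z) -> rcont (fun x => H (x +i* c)%C).
Proof. by move=> cH; apply: ccont_rcont => //; exact: rcont_hline. Qed.

Lemma rcont_v H c : (forall z, ccont H z) -> rcont (fun x => H (c +i* x)%C).
Proof. by move=> cH; apply: ccont_rcont => //; exact: rcont_vline. Qed.

Lemma rect_norm H a b c d (M : R) : (forall z, ccont H z) -> a <= b -> c <= d ->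
  (forall x y, a <= x <= b -> c <= y <= d -> normc (H (x +i* y)%C) <= M) ->
  normc (rect H a b c d) <= 4 * M * (b - a + (d - c)).
Proof.
move=> cH ab cd HM; rewrite /rect.
have aa : a <= a <= b by rewrite lexx.
have bb : a <= b <= b by rewrite lexx andbT.
have cc : c <= c <= d by rewrite lexx.
have dd : c <= d <= d by rewrite lexx andbT.
have h1 := cint_norm (rcont_h c cH) ab (fun x xab => HM x c xab cc).
have h2 := cint_norm (rcont_h d cH) ab (fun x xab => HM x d xab dd).
have h3 := cint_norm (rcont_v b cH) cd (fun y => HM b y bb).
have h4 := cint_norm (rcont_v a cH) cd (fun y => HM a y aa).
apply: le_trans (normcD _ _) _; rewrite normcM normc_i mul1r.
have := normcB (cint a b (fun x => H (x +i* c)%C)) (cint a b (fun x => H (x +i* d)%C)).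
have := normcB (cint c d (fun y => H (b +i* y)%C)) (cint c d (fun y => H (a +i* y)%C)).
lra.
Qed.

Lemma rect_lin H G (s t : R[i]) a b c d :
  (forall z, ccont H z) -> (forall z, ccont G z) ->
  rect (fun z => s * H z + t * G z) a b c d =
  s * rect H a b c d + t * rect G a b c d.
Proof.
move=> cH cG; rewrite /rect !cint_lin; try by [apply: rcont_h|apply: rcont_v].
by ring.
Qed.

Lemma ccont_affine (s t z : R[i]) : ccont (fun w => s + t * w) z.
Proof.
apply: (cdiff_ccont (l := t)) => e e0; exists 1 => // w _.
have -> : s + t * w - (s + t * z) - t * (w - z) = 0 by ring.
by rewrite normc0 mulr_ge0 ?normc_ge0// ltW.
Qed.

(** An affine function has the quadratic primitive [P], whose increments along the four sides
    cancel. On vertical sides dz = i dy, whence the factor - i. *)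
Lemma rect_affine (s t : R[i]) a b c d : rect (fun w => s + t * w) a b c d = 0.
Proof.
pose P (z : R[i]) := s * z + t * 2^-1 * (z * z).
have dP (g : R -> R[i]) x l : cder g x l ->
    cder (fun x => P (g x)) x (l * (s + t * g x)).
  move=> dg; rewrite /P; apply: cder_eq (cderD (cderZ s dg) (cderZ _ (cderM dg dg))) _.
  by field.
rewrite /rect.
rewrite !(cintE (f := fun x => s + t * (x +i* c)%C) (F := fun x => P (x +i* c)%C)); last first.
  by move=> x; rewrite -[X in cder _ _ X]mul1r; apply: dP; exact: cder_hline.
rewrite !(cintE (f := fun x => s + t * (x +i* d)%C) (F := fun x => P (x +i* d)%C)); last first.
  by move=> x; rewrite -[X in cder _ _ X]mul1r; apply: dP; exact: cder_hline.
have ii (w : R[i]) : w = - 'i%C * ('i%C * w).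
  by rewrite mulrA mulNr -expr2 sqr_i opprK mul1r.
rewrite !(cintE (f := fun x => s + t * (b +i* x)%C) (F := fun x => - 'i%C * P (b +i* x)%C)); last first.
  by move=> x; rewrite [X in cder _ _ X]ii; apply: cderZ; apply: dP; exact: cder_vline.
rewrite !(cintE (f := fun x => s + t * (a +i* x)%C) (F := fun x => - 'i%C * P (a +i* x)%C)); last first.
  by move=> x; rewrite [X in cder _ _ X]ii; apply: cderZ; apply: dP; exact: cder_vline.
have E (p q : R[i]) : 'i%C * (- 'i%C * p - - 'i%C * q) = p - q.
  transitivity (- 'i%C ^+ 2 * (p - q)); first by ring.
  by rewrite sqr_i opprK mul1r.
by rewrite mulrBr !E; ring.
Qed.

(** Subtracting the tangent map at the base point does not change the contour integral, and the
    remainder is at most e times the half-perimeter. *)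
Lemma rect_tangent H a b c d x0 y0 (l : R[i]) (e : R) :
  (forall z, ccont H z) -> 0 <= e -> a <= x0 <= b -> c <= y0 <= d ->
  (forall x y, a <= x <= b -> c <= y <= d ->
    normc (H (x +i* y)%C - H (x0 +i* y0)%C - l * ((x +i* y)%C - (x0 +i* y0)%C)) <=
      e * normc ((x +i* y)%C - (x0 +i* y0)%C)) ->
  normc (rect H a b c d) <= 4 * e * (b - a + (d - c)) ^+ 2.
Proof.
move=> cH e0 xab ycd Hl; set z0 : R[i] := (x0 +i* y0)%C in Hl.
pose A w := (H z0 - l * z0) + l * w.
have cA w : ccont A w by exact: ccont_affine.
have -> : rect H a b c d = rect (fun z => 1 * H z + (-1) * A z) a b c d.
  by rewrite rect_lin// rect_affine mulr0 addr0 mul1r.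
set L := b - a + (d - c).
have -> : 4 * e * L ^+ 2 = 4 * (e * L) * L by ring.
apply: rect_norm; [|lra|lra|].
  move=> z; rewrite (_ : (fun _ => _) = fun z => H z - A z); last first.
    by apply/funext => w; rewrite mul1r mulN1r.
  move=> e' e'0; have e2 : 0 < e' / 2 by rewrite divr_gt0.
  have [r1 r10 h1] := cH z _ e2; have [r2 r20 h2] := cA z _ e2.
  exists (Num.min r1 r2); first by rewrite lt_min r10.
  move=> w; rewrite lt_min => /andP[/h1 {}h1 /h2 {}h2].
  have -> : H w - A w - (H z - A z) = (H w - H z) - (A w - A z) by ring.
  by apply: le_lt_trans (normcB _ _) _; lra.
move=> x y hx hy.
have zz : normc ((x +i* y)%C - z0) <= L.
  apply: le_trans (normc_le_ReIm _) _; rewrite /L /=.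
  by apply: lerD; rewrite ler_norml; lra.
have -> : 1 * H (x +i* y)%C + -1 * A (x +i* y)%C =
   H (x +i* y)%C - H z0 - l * ((x +i* y)%C - z0) by rewrite /A; ring.
by apply: le_trans (Hl _ _ hx hy) _; rewrite ler_wpM2l.
Qed.

Section bisection.
Variables (H : R[i] -> R[i]) (a0 b0 c0 d0 : R).
Hypotheses (cH : forall z, ccont H z) (ab0 : a0 <= b0) (cd0 : c0 <= d0).

Let quad : Type := R * R * (R * R).
Let rectq (q : quad) := rect H q.1.1 q.1.2 q.2.1 q.2.2.
Let half (x y : R) := (x + y) / 2.
(** Selects a quarter carrying at least a fourth of the contour integral. The last quarter is the
    default; [Q_large] shows that it qualifies when the other three fail. *)
Let pick_quarter (q : quad) : quad :=
  let: ((a, b), (c, d)) := q in let m := half a b in let n := half c d in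
  if normc (rectq q) <= 4 * normc (rectq ((a, m), (c, n))) then ((a, m), (c, n))
  else if normc (rectq q) <= 4 * normc (rectq ((m, b), (c, n))) then ((m, b), (c, n))
  else if normc (rectq q) <= 4 * normc (rectq ((a, m), (n, d))) then ((a, m), (n, d))
  else ((m, b), (n, d)).
Let Q k := iter k pick_quarter ((a0, b0), (c0, d0)).

Let Q_large k : normc (rectq (Q 0)) <= 4 ^+ k * normc (rectq (Q k)).
Proof.
elim: k => [|k IH]; first by rewrite expr0 mul1r.
apply: le_trans IH _; rewrite exprSr -mulrA ler_pM2l ?exprn_gt0// /Q iterS -/(Q k).
case: (Q k) => [[a b] [c d]].
rewrite /pick_quarter; case: ifPn => //; case: ifPn => //; case: ifPn => //.
rewrite -!ltNge => h1 h2 h3.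
have : normc (rectq (a, b, (c, d))) <=
   normc (rectq (a, half a b, (c, half c d))) +
   normc (rectq (half a b, b, (c, half c d))) +
   normc (rectq (a, half a b, (half c d, d))) +
   normc (rectq (half a b, b, (half c d, d))).
  rewrite [X in normc X <= _](rect_split H a b c d (half a b) (half c d)).
  by do 3![apply: le_trans (normcD _ _) _; rewrite lerD2r].
lra.
Qed.

Let Q_width k : (Q k).1.2 - (Q k).1.1 = (b0 - a0) / 2 ^+ k /\
                (Q k).2.2 - (Q k).2.1 = (d0 - c0) / 2 ^+ k.
Proof.
elim: k => [|k]; first by rewrite /= expr0 !divr1.
rewrite /Q iterS -/(Q k) exprSr invfM; case: (Q k) => [[a b] [c d]] /= [h1 h2].
rewrite !mulrA -h1 -h2 /half.
by case: ifP => _; [|case: ifP => _; [|case: ifP => _]]; split => /=; lra.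
Qed.

Let Q_nested k : (Q k).1.1 <= (Q k.+1).1.1 /\ (Q k.+1).1.2 <= (Q k).1.2 /\
                 (Q k).2.1 <= (Q k.+1).2.1 /\ (Q k.+1).2.2 <= (Q k).2.2.
Proof.
have [w1 w2] := Q_width k.
have : 0 <= (Q k).1.2 - (Q k).1.1 by rewrite w1 divr_ge0 ?subr_ge0 ?exprn_ge0.
have : 0 <= (Q k).2.2 - (Q k).2.1 by rewrite w2 divr_ge0 ?subr_ge0 ?exprn_ge0.
rewrite {w1 w2} /Q iterS -/(Q k); case: (Q k) => [[a b] [c d]] /=; rewrite /half.
by case: ifP => _; [|case: ifP => _; [|case: ifP => _]] => /=; lra.
Qed.

Let nested_point (u v : nat -> R) : (forall k, u k <= u k.+1) ->
  (forall k, v k.+1 <= v k) -> (forall k, u k <= v k) ->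
  exists x, forall k, u k <= x <= v k.
Proof.
move=> hu hv uv.
have mu := homo_leq lexx le_trans hu.
have mv (j k : nat) : (j <= k)%N -> v k <= v j.
  by move=> mn; rewrite -lerN2; apply: (homo_leq (f := fun k => - v k) lexx le_trans) mn => i; rewrite lerN2.
have UV k : forall j, u j <= v k.
  move=> j; have [jk|kj] := leqP j k.
    by apply: le_trans (uv k); exact: mu.
  by apply: le_trans (uv j) _; apply: mv; exact: ltnW.
have su : has_ubound (range u) by exists (v 0%N) => _ [j _ <-].
exists (sup (range u)) => k; apply/andP; split.
  by apply: ub_le_sup => //; exists k.
by apply: ge_sup; [exists (u 0%N), 0%N|move=> _ [j _ <-]].
Qed.

(** The quarters shrink to a point where [H] is differentiable. At level k the tangent estimate is
    of order e (L / 2^k)^2, which cancels the factor 4^k lost by bisection, and e is arbitrary. *)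
Lemma Goursat : (forall x y, a0 <= x <= b0 -> c0 <= y <= d0 -> holo H (x +i* y)%C) ->
  rect H a0 b0 c0 d0 = 0.
Proof.
move=> hH.
have wk k : 0 <= (Q k).1.2 - (Q k).1.1 /\ 0 <= (Q k).2.2 - (Q k).2.1.
  by have [-> ->] := Q_width k; rewrite !divr_ge0 ?subr_ge0 ?exprn_ge0.
have [x0 Hx] : exists x, forall k, (Q k).1.1 <= x <= (Q k).1.2.
  apply: nested_point => k; [by have [] := Q_nested k|by have [_ []] := Q_nested k|].
  by have [+ _] := wk k; rewrite subr_ge0.
have [y0 Hy] : exists x, forall k, (Q k).2.1 <= x <= (Q k).2.2.
  apply: nested_point => k; [by have [_ [_ []]] := Q_nested k
    |by have [_ [_ []]] := Q_nested k|].
  by have [_] := wk k; rewrite subr_ge0.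
have [l dl] := hH x0 y0 (Hx 0%N) (Hy 0%N).
set L := b0 - a0 + (d0 - c0).
have L0 : 0 <= L by rewrite addr_ge0// subr_ge0.
suff small e : 0 < e -> normc (rect H a0 b0 c0 d0) <= 4 * e * L ^+ 2.
  apply/eqP; rewrite -normc_eq0; apply/eqP/le_anti; rewrite normc_ge0 andbT.
  apply/ler_addgt0Pr => e e0; rewrite add0r.
  have LL : 0 < 4 * L ^+ 2 + 1 by rewrite ltr_wpDl// mulr_ge0// sqr_ge0.
  apply: le_trans (small (e / (4 * L ^+ 2 + 1)) _) _; first by rewrite divr_gt0.
  rewrite mulrAC mulrA ler_pdivrMr//; have := sqr_ge0 L; nra.
move=> e0; have [d d1 Hd] := dl e e0.
have [k Lk] : exists k, L / 2 ^+ k < d.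
  exists (Num.truncn (L / d)).+1; rewrite ltr_pdivrMr ?exprn_gt0// mulrC.
  rewrite -ltr_pdivrMr//; apply: lt_trans (truncnS_gt _) _.
  by rewrite -natrX ltr_nat ltn_expl.
apply: le_trans (Q_large k) _.
have LkE : (Q k).1.2 - (Q k).1.1 + ((Q k).2.2 - (Q k).2.1) = L / 2 ^+ k.
  by have [-> ->] := Q_width k; rewrite -mulrDl.
have := @rect_tangent H _ _ _ _ _ _ l e cH (ltW e0) (Hx k) (Hy k).
rewrite LkE => Hk; apply: le_trans (_ : 4 ^+ k * (4 * e * (L / 2 ^+ k) ^+ 2) <= _).
  rewrite ler_pM2l ?exprn_gt0//; apply: Hk => x y hx hy; apply: Hd.
  apply: le_lt_trans Lk; apply: le_trans (normc_le_ReIm _) _.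
  rewrite -LkE; have := Hx k; have := Hy k => hy0 hx0.
  by apply: lerD; rewrite ler_norml /=; lra.
have -> : (4 : R) ^+ k = 2 ^+ k * 2 ^+ k by rewrite -exprMn; congr (_ ^+ _); lra.
rewrite le_eqVlt; apply/orP; left; apply/eqP.
by field; rewrite expf_neq0.
Qed.

End bisection.
End Goursat.

(** * Cauchy's theorem with finitely many exceptional points *)

Section Cauchy.
Context {R : realType}.
Implicit Types (H : R[i] -> R[i]) (a b c d x y e : R) (s : seq R[i]).

Lemma rect_Re0 H a b c d s : (forall z, ccont H z) ->
  (forall z, z \notin s -> holo H z) -> a <= b -> c <= d ->
  (forall z, z \in s -> ~~ (a <= complex.Re z <= b)) -> rect H a b c d = 0.
Proof.
move=> cH hH ab cd sab; apply: Goursat => // x y xab ycd; apply: hH.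
by apply/negP => /sab /=; rewrite xab.
Qed.

(** Compactness of [c, d] turns continuity at each point of the vertical segment into a radius that
    is uniform along it. *)
Lemma vline_equicont H x0 c d e : (forall z, ccont H z) -> 0 < e ->
  exists2 r : R, 0 < r & forall x y, `|x - x0| < r -> c <= y <= d ->
    normc (H (x +i* y)%C - H (x0 +i* y)%C) <= e.
Proof.
move=> cH e0.
have nc := (compact_near_coveringP _).1 (@segment_compact R c d) R (nbhs x0)
  (fun x y => normc (H (x +i* y)%C - H (x0 +i* y)%C) <= e) _.
suff /nc [r r0 Hr] : forall y, `[c, d] y -> \forall y' \near y & x \near x0,
    normc (H (x +i* y')%C - H (x0 +i* y')%C) <= e.
  exists r => // x y xr ycd.
  by apply: Hr => //=; rewrite ?in_itv//= distrC.
move=> y _; have e2 : 0 < e / 2 by rewrite divr_gt0.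
  have [r r0 Hr] := cH (x0 +i* y)%C _ e2.
  have r2 : 0 < r / 2 by rewrite divr_gt0.
  near=> y' x.
  have hy : `|y' - y| < r / 2.
    by rewrite distrC; near: y'; apply: (@nbhsx_ballx _ R).
  have hx : `|x - x0| < r / 2.
    by rewrite distrC; near: x; apply: (@nbhsx_ballx _ R).
  have -> : H (x +i* y')%C - H (x0 +i* y')%C =
     (H (x +i* y')%C - H (x0 +i* y)%C) - (H (x0 +i* y')%C - H (x0 +i* y)%C) by ring.
  rewrite (splitr e) (le_trans (normcB _ _))//; apply: lerD; apply/ltW/Hr.
    apply: le_lt_trans (normc_le_ReIm _) _; rewrite /=; lra.
  apply: le_lt_trans (normc_le_ReIm _) _; rewrite /= subrr normr0; lra.
Unshelve. all: by end_near. Qed.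

Section fixed.
Variables (H : R[i] -> R[i]) (s : seq R[i]).
Hypotheses (cH : forall z, ccont H z) (hH : forall z, z \notin s -> holo H z).

(* The integral over a rectangle is the increment of W c d, which is continuous, and
   locally constant off the real parts of the exceptional points. *)
Let W c d x := 'i%C * cint c d (fun y => H (x +i* y)%C) +
  cint 0 x (fun t => H (t +i* c)%C) - cint 0 x (fun t => H (t +i* d)%C).

Let rectW a b c d : rect H a b c d = W c d b - W c d a.
Proof.
rewrite /rect /W -(cint_cat (fun t => H (t +i* c)%C) 0 a b).
by rewrite -(cint_cat (fun t => H (t +i* d)%C) 0 a b); ring.
Qed.

Let int_cont (f : R -> R[i]) x0 e : rcont f -> 0 < e ->
  exists2 r : R, 0 < r & forall x, `|x - x0| < r ->
    normc (cint 0 x f - cint 0 x0 f) <= e.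
Proof.
move=> cf e0; have dF := cprimP cf.
have [c1 c2] := cder_rcont dF.
have e2 : 0 < e / 2 by rewrite divr_gt0.
have /cvgrPdist_lt /(_ _ e2)[r1 r10 h1] := c1 x0.
have /cvgrPdist_lt /(_ _ e2)[r2 r20 h2] := c2 x0.
exists (Num.min r1 r2); first by rewrite lt_min r10.
move=> x; rewrite lt_min distrC => /andP[/h1 {}h1 /h2 {}h2].
rewrite (cintE (f := f) (F := cprim f))// [cint _ x0 _](cintE (f := f) (F := cprim f))//.
rewrite normc_dist; apply: le_trans (normc_le_ReIm _) _.
rewrite !(Re_add, Im_add, Re_opp, Im_opp) (splitr e).
by apply: lerD; apply/ltW; [move: h1|move: h2]; apply: le_lt_trans;
  rewrite le_eqVlt; apply/orP; left; apply/eqP; congr `|_|; ring.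
Qed.

Let W_cont c d x0 e : c <= d -> 0 < e ->
  exists2 r : R, 0 < r & forall x, `|x - x0| < r -> normc (W c d x - W c d x0) <= e.
Proof.
move=> cd e0; have e3 : 0 < e / 3 by rewrite divr_gt0.
have [r1 r10 h1] := int_cont x0 (rcont_h c cH) e3.
have [r2 r20 h2] := int_cont x0 (rcont_h d cH) e3.
have e4 : 0 < e / 6 / (d - c + 1) by rewrite divr_gt0 ?divr_gt0// ltr_wpDl// subr_ge0.
have [r3 r30 h3] := vline_equicont x0 c d cH e4.
exists (Num.min r1 (Num.min r2 r3)); first by rewrite !lt_min r10 r20.
move=> x; rewrite !lt_min => /andP[/h1 {}h1 /andP[/h2 {}h2 xr]].
have := h3 x _ xr => {}h3.
have {}h3 : normc (cint c d (fun y => H (x +i* y)%C) -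
    cint c d (fun y => H (x0 +i* y)%C)) <= e / 3.
  have := @cint_lin R (fun y => H (x +i* y)%C) (fun y => H (x0 +i* y)%C)
    1 (-1) c d (rcont_v x cH) (rcont_v x0 cH).
  rewrite mul1r mulN1r => <-; apply: le_trans (cint_norm _ cd _) _.
  - by apply: rcont_lin; exact: rcont_v.
  - by move=> y /h3 h; rewrite mul1r mulN1r; exact: h.
  have dc : 0 < d - c + 1 by lra.
  rewrite -mulrA mulrAC -!mulrA.
  have : (d - c) * (d - c + 1)^-1 <= 1 by rewrite ler_pdivrMr//; lra.
  by rewrite mulrC; nra.
have -> : W c d x - W c d x0 =
  'i%C * (cint c d (fun y => H (x +i* y)%C) - cint c d (fun y => H (x0 +i* y)%C)) +
  (cint 0 x (fun t => H (t +i* c)%C) - cint 0 x0 (fun t => H (t +i* c)%C)) -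
  (cint 0 x (fun t => H (t +i* d)%C) - cint 0 x0 (fun t => H (t +i* d)%C)).
  by rewrite /W; ring.
apply: le_trans (normcB _ _) _.
apply: le_trans (lerD (normcD _ _) (lexx _)) _.
by rewrite normcM normc_i mul1r; lra.
Qed.

(** Goursat applies on [a + r, b - r], whose vertical strip contains no exceptional point; then r is
    taken small enough for the continuity of [W] at a and b. *)
Let W_close a b c d : a < b -> c <= d ->
  (forall z, z \in s -> ~~ (a < complex.Re z < b)) -> W c d b = W c d a.
Proof.
move=> ab cd sab; apply/eqP; rewrite -subr_eq0 -normc_eq0; apply/eqP/le_anti.
rewrite normc_ge0 andbT; apply/ler_addgt0Pr => e e0; rewrite add0r.
have e2 : 0 < e / 2 by rewrite divr_gt0.
have [r1 r10 h1] := W_cont a cd e2; have [r2 r20 h2] := W_cont b cd e2.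
pose r := Num.min (Num.min r1 r2) (b - a) / 2.
have r0 : 0 < r by rewrite divr_gt0// !lt_min r10 r20 subr_gt0.
have [rr1 rr2 rab] : [/\ r < r1, r < r2 & r <= (b - a) / 2].
  have m1 : Num.min (Num.min r1 r2) (b - a) <= b - a by rewrite ge_min lexx orbT.
  have m2 : Num.min (Num.min r1 r2) (b - a) <= r1 by rewrite !ge_min lexx.
  have m3 : Num.min (Num.min r1 r2) (b - a) <= r2 by rewrite !ge_min lexx orbT.
  by split; rewrite /r; lra.
have E : W c d (b - r) = W c d (a + r).
  apply/eqP; rewrite -subr_eq0 -rectW; apply/eqP; apply: (rect_Re0 cH hH) => //.
    by lra.
  move=> z /sab; apply: contra; lra.
have {}h1 := h1 (a + r); have {}h2 := h2 (b - r).
have -> : W c d b - W c d a =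
   (W c d (a + r) - W c d a) - (W c d (b - r) - W c d b) by rewrite E; ring.
rewrite (le_trans (normcB _ _))// (splitr e); apply: lerD.
  by apply: h1; rewrite addrC addKr gtr0_norm.
by apply: h2; rewrite addrC addKr normrN gtr0_norm.
Qed.

(** Induction on the number of exceptional points with real part strictly between a and b: the
    interval is cut at the real part of one of them. *)
Let W_const_lt c d : c <= d -> forall n a b, a < b ->
  (count (fun z => (a < complex.Re z < b)%R) s <= n)%N -> W c d b = W c d a.
Proof.
move=> cd; elim=> [|n IH] a b ab.
  rewrite leqn0 -[_ == _]negbK -lt0n -has_count => /hasPn; exact: W_close.
have [/hasP[z zs /andP[az zb]] sn|/hasPn h _] :=
    boolP (has (fun z => a < complex.Re z < b) s); last exact: W_close.
(* The cut removes z from both open subintervals, so each count drops by at least one. *)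
have sub (p q : pred R[i]) : (forall w, p w -> q w) -> ~~ p z -> q z ->
    (count q s <= n.+1)%N -> (count p s <= n)%N.
  move=> pq pz qz; rewrite -[in X in _ -> X]ltnS; apply: leq_trans.
  elim: (s) zs => //= w r IHr; rewrite inE => /predU1P[<-|/IHr h].
    by rewrite (negbTE pz) qz add0n add1n ltnS sub_count.
  rewrite -addnS leq_add//; case: (boolP (p w)) => // /pq ->//.
transitivity (W c d (complex.Re z)); apply: IH => //.
  apply: (sub _ _ _ _ _ sn); rewrite ?ltxx// ?az//.
  by move=> w /andP[h ->]; rewrite (lt_trans az).
apply: (sub _ _ _ _ _ sn); rewrite ?ltxx ?andbF// ?az//.
by move=> w /andP[-> h]; rewrite (lt_trans h).
Qed.

(** Allowing points of mere continuity makes the theorem applicable to difference quotients without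
    a removable singularity theorem. *)
Lemma Cauchy_rect a b c d : a <= b -> c <= d -> rect H a b c d = 0.
Proof.
rewrite le_eqVlt => /predU1P[->|ab] cd; first by rewrite rectW subrr.
by rewrite rectW (W_const_lt cd ab (leqnn _)) subrr.
Qed.

(** In the contour integral over [-n, n] x [c, d] the vertical sides have fixed length d - c and a
    vanishing integrand, so the two horizontal sides agree in the limit. *)
Lemma Cauchy_strip c d : c <= d ->
  (forall e, 0 < e -> exists N, forall n y, (N <= n)%N -> c <= y <= d ->
     normc (H (n%:R +i* y)%C) <= e /\ normc (H (- n%:R +i* y)%C) <= e) ->
  ctends (fun n => cint (- n%:R) n%:R (fun x => H (x +i* c)%C) -
                   cint (- n%:R) n%:R (fun x => H (x +i* d)%C)) 0.
Proof.
move=> cd small e e0.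
have dc : 0 < 4 * (d - c) + 1 by lra.
have e4 : 0 < e / 2 / (4 * (d - c) + 1) by rewrite !divr_gt0.
have [N HN] := small _ e4; exists N => n Nn.
have nn : - n%:R <= n%:R :> R by have := ler0n R n; lra.
have := Cauchy_rect nn cd.
rewrite /rect => /eqP; rewrite addr_eq0 => /eqP ->.
rewrite subr0 normc_opp normcM normc_i mul1r.
apply: le_lt_trans (normcB _ _) _.
have h1 := cint_norm (rcont_v n%:R cH) cd (fun y hy => (HN n y Nn hy).1).
have h2 := cint_norm (rcont_v (- n%:R) cH) cd (fun y hy => (HN n y Nn hy).2).
apply: le_lt_trans (lerD h1 h2) _.
have -> : 2 * (e / 2 / (4 * (d - c) + 1)) * (d - c) +
   2 * (e / 2 / (4 * (d - c) + 1)) * (d - c) =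
   e * (2 * (d - c) / (4 * (d - c) + 1)) by field; rewrite gt_eqF.
rewrite -[ltRHS]mulr1 ltr_pM2l// ltr_pdivrMr//; lra.
Qed.

End fixed.
End Cauchy.

Section holomorphic.
Context {R : realType}.
Implicit Types (H G : R[i] -> R[i]) (z w l k a : R[i]) (e : R).

Lemma posc_real (d : R[i]) : 0 < d -> exists2 r : R, 0 < r & d = r%:C%C.
Proof.
case: d => a b; rewrite ltcE /= => /andP[/eqP -> a0].
by exists a.
Qed.

Lemma cdiffP H z l : cdiff H z l <-> is_derive (z : R[i]^o) 1 (H : R[i]^o -> R[i]^o) l.
Proof.
have quotE h : h != 0 -> h^-1 *: (H (h *: (1 : R[i]^o) + z) - H z) - l =
    h^-1 * (H (z + h) - H z - l * h).
  move=> h0; rewrite [h *: 1]mulr1 [_ + z]addrC -[_ *: _]/(_ * _).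
  by rewrite [RHS]mulrBr [l * h]mulrC mulKf.
split=> [dH|[dH lE] e e0].
  have cv : h^-1 *: (H (h *: (1 : R[i]^o) + z) - H z) @[h --> (0 : R[i]^o)^'] --> (l : R[i]^o).
    apply/(@cvgrPdist_le R[i] R[i]^o) => e /posc_real[r r0 ->].
    have [d d0 Hd] := dH r r0.
    exists d%:C%C => /=; first by rewrite ltcR.
    move=> h; rewrite /ball_ /= sub0r normrN normcE ltcR => hd h0.
    rewrite distrC quotE// normcE lecR normcM normcV mulrC.
    rewrite ler_pdivrMr ?normc_gt0//.
    by have := Hd (z + h); rewrite addrC addKr; exact.
  have der : derivable (H : R[i]^o -> R[i]^o) z 1 by apply/cvg_ex; exists l.
  split => //; apply: (@cvg_lim R[i]^o); [exact: norm_hausdorff|exact: cv].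
have cv : h^-1 *: (H (h *: (1 : R[i]^o) + z) - H z) @[h --> (0 : R[i]^o)^'] --> (l : R[i]^o).
  by rewrite -lE; exact: dH.
have e0' : 0 < e%:C%C by rewrite ltcR.
move/(@cvgrPdist_le R[i] R[i]^o) : cv => /(_ _ e0')[d' /= /posc_real[d d0 ->] Hd].
exists d => // w wd; have [->|wz] := eqVneq w z.
  by rewrite !subrr mulr0 subrr normc0 mulr0.
have wz0 : w - z != 0 by rewrite subr_eq0.
have := Hd (w - z); rewrite /ball_ /= sub0r normrN normcE ltcR => /(_ wd wz0).
rewrite distrC quotE// normcE lecR normcM normcV mulrC.
by rewrite ler_pdivrMr ?normc_gt0// subrKC.
Qed.

Lemma holoP H z : holo H z <-> derivable (H : R[i]^o -> R[i]^o) z 1.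
Proof.
split=> [[l /cdiffP[]]//|dH]; exists ('D_1 (H : R[i]^o -> R[i]^o) z).
by apply/cdiffP; exact/derivableP.
Qed.

Lemma cdiff_near H G z l (d : R) : 0 < d ->
  (forall w, normc (w - z) < d -> G w = H w) -> cdiff H z l -> cdiff G z l.
Proof.
move=> d0 GH dH e /dH[r r0 Hr]; exists (Num.min r d); first by rewrite lt_min r0.
move=> w; rewrite lt_min => /andP[wr wd]; rewrite !GH// ?subrr ?normc0//.
exact: Hr.
Qed.

Lemma cdiff_cst k z : cdiff (fun=> k) z 0.
Proof. by apply/cdiffP; exact: is_derive_cst. Qed.

Lemma cdiffD H G z l k : cdiff H z l -> cdiff G z k ->
  cdiff (fun w => H w + G w) z (l + k).
Proof. by move=> /cdiffP dH /cdiffP dG; apply/cdiffP; exact: is_deriveD. Qed.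

Lemma ccont_bounded H z : ccont H z -> exists2 d : R, 0 < d &
  forall w, normc (w - z) < d -> normc (H w) <= normc (H z) + 1.
Proof.
move=> /(_ 1 ltr01)[d d0 Hd]; exists d => // w /Hd h.
have -> : H w = H z + (H w - H z) by ring.
by apply: le_trans (normcD _ _) _; rewrite lerD2l ltW.
Qed.

Lemma cdiffM H G z l k : cdiff H z l -> cdiff G z k ->
  cdiff (fun w => H w * G w) z (l * G z + H z * k).
Proof.
move=> dH dG e e0; have [d1 d10 h1] := ccont_bounded (cdiff_ccont dH).
pose A := normc (H z) + 1; pose B := normc (G z) + 1; pose D := normc k + 1.
have A0 : 0 < A by rewrite ltr_wpDl// normc_ge0.
have B0 : 0 < B by rewrite ltr_wpDl// normc_ge0.
have D0 : 0 < D by rewrite ltr_wpDl// normc_ge0.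
have eA : 0 < e / 3 / A by rewrite !divr_gt0.
have eB : 0 < e / 3 / B by rewrite !divr_gt0.
have eD : 0 < e / 3 / D by rewrite !divr_gt0.
have [d2 d20 h2] := dH _ eB; have [d3 d30 h3] := dG _ eA.
have [d4 d40 h4] := cdiff_ccont dH eD.
exists (Num.min (Num.min d1 d2) (Num.min d3 d4)); first by rewrite !lt_min d10 d20 d30.
move=> w; rewrite !lt_min => /andP[/andP[/h1 {}h1 /h2 {}h2] /andP[/h3 {}h3 /h4 {}h4]].
have -> : H w * G w - H z * G z - (l * G z + H z * k) * (w - z) =
  H w * (G w - G z - k * (w - z)) + (H w - H z) * (k * (w - z)) +
  G z * (H w - H z - l * (w - z)) by ring.
apply: le_trans (normcD _ _) _; apply: le_trans (lerD (normcD _ _) (lexx _)) _.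
have -> : e * normc (w - z) = e / 3 * normc (w - z) + e / 3 * normc (w - z) +
  e / 3 * normc (w - z) by field.
have w0 := normc_ge0 (w - z).
rewrite !normcM; apply: lerD; [apply: lerD|].
- apply: le_trans (_ : A * (e / 3 / A * normc (w - z)) <= _).
    by apply: ler_pM; rewrite ?normc_ge0.
  by rewrite mulrA mulrC [A * _]mulrC divfK ?gt_eqF// mulrC.
- apply: le_trans (_ : e / 3 / D * (D * normc (w - z)) <= _).
    apply: ler_pM; rewrite ?normc_ge0 ?mulr_ge0 ?normc_ge0//; first exact: ltW.
    by rewrite ler_wpM2r// lerDl.
  by rewrite mulrA divfK ?gt_eqF.
apply: le_trans (_ : B * (e / 3 / B * normc (w - z)) <= _).
  by apply: ler_pM; rewrite ?normc_ge0// lerDl.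
by rewrite mulrA mulrC [B * _]mulrC divfK ?gt_eqF// mulrC.
Qed.

Lemma cdiff_eq H z l k : cdiff H z l -> l = k -> cdiff H z k.
Proof. by move=> ? <-. Qed.

Lemma cdiffZ k H z l : cdiff H z l -> cdiff (fun w => k * H w) z (k * l).
Proof.
by move=> dH; apply: cdiff_eq (cdiffM (cdiff_cst k z) dH) _; ring.
Qed.

Lemma cdiff_inv a z : z != a -> holo (fun w => (w - a)^-1) z.
Proof.
move=> za; apply/holoP; apply: derivableV; first by rewrite subr_eq0.
by apply: derivableB; [exact: derivable_id|exact: derivable_cst].
Qed.

Lemma holoD H G z : holo H z -> holo G z -> holo (fun w => H w + G w) z.
Proof. by move=> [l dH] [k dG]; exists (l + k); exact: cdiffD. Qed.

Lemma holoM H G z : holo H z -> holo G z -> holo (fun w => H w * G w) z.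
Proof. by move=> [l dH] [k dG]; eexists; exact: cdiffM dH dG. Qed.

Lemma holo_cst k z : holo (fun=> k) z.
Proof. by exists 0; exact: cdiff_cst. Qed.

Lemma holoZ k H z : holo H z -> holo (fun w => k * H w) z.
Proof. by apply: holoM; exact: holo_cst. Qed.

Lemma holoX H z n : holo H z -> holo (fun w => H w ^+ n) z.
Proof.
move=> dH; elim: n => [|n IH]; first exact: holo_cst.
by under eq_fun do rewrite exprS; exact: holoM.
Qed.

Lemma ccontD H G z : ccont H z -> ccont G z -> ccont (fun w => H w + G w) z.
Proof.
move=> cH cG e e0; have e2 : 0 < e / 2 by rewrite divr_gt0.
have [r r0 Hr] := cH _ e2; have [d d0 Hd] := cG _ e2.
exists (Num.min r d); first by rewrite lt_min r0.
move=> w; rewrite lt_min => /andP[/Hr h1 /Hd h2].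
have -> : H w + G w - (H z + G z) = (H w - H z) + (G w - G z) by ring.
by apply: le_lt_trans (normcD _ _) _; lra.
Qed.

Lemma ccont_cst k z : ccont (fun=> k) z.
Proof. by apply: holo_ccont; exact: holo_cst. Qed.

Lemma ccontM H G z : ccont H z -> ccont G z -> ccont (fun w => H w * G w) z.
Proof.
move=> cH cG e e0; have [d1 d10 h1] := ccont_bounded cH.
pose A := normc (H z) + 1; pose B := normc (G z) + 1.
have A0 : 0 < A by rewrite ltr_wpDl// normc_ge0.
have B0 : 0 < B by rewrite ltr_wpDl// normc_ge0.
have eA : 0 < e / 2 / A by rewrite !divr_gt0.
have eB : 0 < e / 2 / B by rewrite !divr_gt0.
have [d2 d20 h2] := cH _ eB; have [d3 d30 h3] := cG _ eA.
exists (Num.min d1 (Num.min d2 d3)); first by rewrite !lt_min d10 d20.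
move=> w; rewrite !lt_min => /andP[/h1 {}h1 /andP[/h2 {}h2 /h3 {}h3]].
have -> : H w * G w - H z * G z = H w * (G w - G z) + G z * (H w - H z) by ring.
apply: le_lt_trans (normcD _ _) _; rewrite !normcM.
rewrite ltr_pdivlMr// in h2; rewrite ltr_pdivlMr// in h3.
have : normc (H w) * normc (G w - G z) <= A * normc (G w - G z).
  by rewrite ler_wpM2r ?normc_ge0.
have : normc (G z) * normc (H w - H z) <= B * normc (H w - H z).
  by rewrite ler_wpM2r ?normc_ge0// lerDl.
lra.
Qed.

Lemma ccontZ k H z : ccont H z -> ccont (fun w => k * H w) z.
Proof. by apply: ccontM; exact: ccont_cst. Qed.

Lemma ccontX H z n : ccont H z -> ccont (fun w => H w ^+ n) z.
Proof.
move=> dH; elim: n => [|n IH]; first exact: ccont_cst.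
by under eq_fun do rewrite exprS; exact: ccontM.
Qed.

Lemma cexpD z w : cexp (z + w) = cexp z * cexp w.
Proof.
case: z w => [a b] [c d]; rewrite /cexp /= expRD cosD sinD.
by apply: complexP; rewrite /= ; ring.
Qed.

Lemma normc_cexp z : normc (cexp z) = expR (complex.Re z).
Proof.
case: z => a b; rewrite /cexp /= !exprMn -mulrDr cos2Dsin2 mulr1.
by rewrite sqrtr_sqr ger0_norm// expR_ge0.
Qed.

Lemma cexp0 : cexp (0 : R[i]) = 1.
Proof. by rewrite /cexp /= expR0 cos0 sin0 mulr1 mulr0. Qed.

Lemma cder_line k w x : cder (fun s : R => w + s%:C%C * k) x k.
Proof.
have := cderD (cder_cst w x) (cderZ k (cder_real x)).
rewrite add0r mulr1; under eq_fun do rewrite [k * _]mulrC; exact.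
Qed.

(* Taylor's formula along the segment from 0 to w. *)
Lemma cexp_taylor2 w :
  normc (cexp w - 1 - w) <= 4 * normc w ^+ 2 * expR (normc w).
Proof.
have dl x := cder_line w 0 x.
have d1 x := cder_exp (dl x).
have d2 x := cderZ w (d1 x).
have := @cder_taylor R _ _ _ 0 1 (normc w ^+ 2 * expR (normc w)) d1 d2.
rewrite mul0r addr0 cexp0 subr0 normr1 expr1n mulr1 mul1r add0r mulr1.
rewrite mulrA; apply => x.
rewrite subr0 add0r => x1; rewrite !normcM normc_cexp mulrA -expr2.
rewrite ler_wpM2l ?exprn_ge0 ?normc_ge0// ler_expR.
apply: le_trans (ler_norm _) _; apply: le_trans (le_normc_Re _) _.
by rewrite normcM normc_real ler_piMl// normc_ge0.
Qed.

Lemma cdiff_cexp0 : cdiff (@cexp R) 0 1.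
Proof.
move=> e e0; exists (Num.min 1 (e / (4 * expR 1))).
  by rewrite lt_min ltr01 divr_gt0// mulr_gt0// expR_gt0.
move=> w; rewrite lt_min !subr0 cexp0 mul1r => /andP[w1 we].
apply: le_trans (cexp_taylor2 w) _.
rewrite ltr_pdivlMr ?mulr_gt0 ?expR_gt0// in we.
have : expR (normc w) <= expR 1 by rewrite ler_expR ltW.
have := normc_ge0 w; have := expR_ge0 (normc w); nra.
Qed.

(** The functional equation transports differentiability from 0 to z. *)
Lemma cdiff_cexp z : cdiff (@cexp R) z (cexp z).
Proof.
move=> e e0; have z0 : 0 < normc (cexp z) by rewrite normc_cexp expR_gt0.
have ez : 0 < e / normc (cexp z) by rewrite divr_gt0.
have [d d0 Hd] := cdiff_cexp0 ez; exists d => // w wd.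
have := Hd (w - z); rewrite !subr0 cexp0 mul1r => /(_ wd).
have -> : cexp w = cexp (w - z) * cexp z by rewrite -cexpD subrK.
have -> : cexp (w - z) * cexp z - cexp z - cexp z * (w - z) =
  cexp z * (cexp (w - z) - 1 - (w - z)) by ring.
by rewrite normcM mulrAC ler_pdivlMr// mulrC.
Qed.

Lemma cdiff_scale H k z l : cdiff H (k * z) l -> cdiff (fun w => H (k * w)) z (k * l).
Proof.
move=> dH e e0; have k1 : 0 < normc k + 1 by rewrite ltr_wpDl// normc_ge0.
have ek : 0 < e / (normc k + 1) by rewrite divr_gt0.
have [d d0 Hd] := dH _ ek; exists (d / (normc k + 1)); first by rewrite divr_gt0.
move=> w; rewrite ltr_pdivlMr// => wd.
have E : k * w - k * z = k * (w - z) by ring.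
have := Hd (k * w); rewrite E normcM.
have -> : H (k * w) - H (k * z) - l * (k * (w - z)) =
   H (k * w) - H (k * z) - k * l * (w - z) by ring.
move=> H1; apply: le_trans (H1 _) _.
  by apply: le_lt_trans wd; rewrite mulrDr mulr1 mulrC lerDl normc_ge0.
rewrite mulrAC ler_pdivrMr// -!mulrA ler_pM2l// mulrDr mulr1 mulrC.
by rewrite lerDl normc_ge0.
Qed.

Lemma holo_cexp k z : holo (fun w => cexp (k * w)) z.
Proof. by exists (k * cexp (k * z)); apply: cdiff_scale; exact: cdiff_cexp. Qed.

End holomorphic.

(** * Difference quotients *)

Section division.
Context {R : realType}.
Implicit Types (N : R[i] -> R[i]) (a l z w : R[i]) (s : seq R[i]).

(** Meant for a zero a of [N] with derivative l there: this value makes the quotient continuous at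
    a. *)
Definition cdivide N a l z := if z == a then l else N z / (z - a).

Lemma cdivideM N a l z : N a = 0 -> (z - a) * cdivide N a l z = N z.
Proof.
move=> Na; rewrite /cdivide; case: eqVneq => [->|za].
  by rewrite subrr mul0r Na.
by rewrite mulrC divfK// subr_eq0.
Qed.

Let near_ne z a : z != a -> exists2 d : R, 0 < d &
  forall w, normc (w - z) < d -> w != a.
Proof.
move=> za; exists (normc (z - a)); first by rewrite normc_gt0 subr_eq0.
by move=> w; apply: contraTneq => ->; rewrite normc_dist ltxx.
Qed.

Lemma holo_divide N a l z : z != a -> holo N z -> holo (cdivide N a l) z.
Proof.
move=> za hN; have [d d0 Hd] := near_ne za.
have [k dk] : holo (fun w => N w * (w - a)^-1) z.
  by apply: holoM => //; exact: cdiff_inv.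
exists k; apply: (cdiff_near d0) dk => w /Hd wa.
by rewrite /cdivide (negbTE wa).
Qed.

Lemma ccont_divide N a l z : (forall w, ccont N w) -> cdiff N a l -> N a = 0 ->
  ccont (cdivide N a l) z.
Proof.
move=> cN dN Na; have [->|za] := eqVneq z a.
  move=> e e0; have e2 : 0 < e / 2 by rewrite divr_gt0.
  have [d d0 Hd] := dN _ e2; exists d => // w wd.
  rewrite /cdivide eqxx; case: eqVneq => [_|wa]; first by rewrite subrr normc0.
  have wa0 : w - a != 0 by rewrite subr_eq0.
  have -> : N w / (w - a) - l = (N w - N a - l * (w - a)) / (w - a).
    by rewrite Na; field.
  rewrite normcM normcV ltr_pdivrMr ?normc_gt0//.
  apply: le_lt_trans (Hd _ wd) _.
  by rewrite ltr_pM2r ?normc_gt0// ltr_pdivrMr// ltr_pMr// ltr1n.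
have [d d0 Hd] := near_ne za.
have c : ccont (fun w => N w * (w - a)^-1) z.
  by apply: ccontM => //; apply: holo_ccont; exact: cdiff_inv.
move=> e /c[r r0 Hr]; exists (Num.min r d); first by rewrite lt_min r0.
move=> w; rewrite lt_min => /andP[/Hr h /Hd wa].
by rewrite /cdivide (negbTE wa) (negbTE za).
Qed.

(** Here 1 + |z| <= (2 + |a|) |z - a|. The constant depends on a alone, in contrast to
    [divide_bounded], whose constant depends on [N]. *)
Lemma divide_far N a l z : 1 <= normc (z - a) ->
  normc (cdivide N a l z) * (1 + normc z) <= (2 + normc a) * normc (N z).
Proof.
move=> za1; have za : 0 < normc (z - a) by exact: lt_le_trans za1.
rewrite /cdivide; case: eqVneq => [E|_]; first by rewrite E subrr normc0 ltxx in za.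
rewrite normcM normcV mulrAC ler_pdivrMr// mulrAC [leLHS]mulrC.
rewrite ler_wpM2r ?normc_ge0//.
have : normc z <= normc a + normc (z - a).
  by rewrite -[z in leLHS](subrKC a) normcD.
have := normc_ge0 a; nra.
Qed.

(** Near a the quotient is bounded by continuity, P by p, and Q is at least q; this gives the
    constant [A]. Away from a one divides by |z - a|, which gives [B]. *)
Lemma divide_bounded N a l (P Q : R[i] -> R) (p q : R) :
  (forall w, ccont N w) -> cdiff N a l -> N a = 0 -> 0 < q ->
  (forall z, 0 <= P z) -> (forall z, q <= Q z) ->
  (forall z, normc (z - a) <= 1 -> P z <= p) ->
  (forall z, normc (N z) * P z <= Q z) ->
  exists C, forall z, normc (cdivide N a l z) * (1 + normc z) * P z <= C * Q z.
Proof.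
move=> cN dN Na q0 P0 qQ Pp NPQ.
have [d' d'0 Hd'] := ccont_bounded (@ccont_divide N a l a cN dN Na).
pose d := Num.min d' 1.
have d0 : 0 < d by rewrite lt_min d'0 ltr01.
have [dd' d1] : d <= d' /\ d <= 1 by rewrite !ge_min !lexx orbT.
have p0 : 0 <= p by apply: le_trans (P0 a) (Pp a _); rewrite subrr normc0.
pose A := (normc l + 1) * (2 + normc a) * p / q.
pose B := (1 + normc a) / d + 1.
have a0 := normc_ge0 a; have l0 := normc_ge0 l.
have A0 : 0 <= A by rewrite !(mulr_ge0, addr_ge0)// invr_ge0 ltW.
have B0 : 0 <= B by rewrite addr_ge0// divr_ge0 ?addr_ge0// ltW.
exists (A + B) => z; have Q0 : 0 <= Q z by apply: le_trans (qQ z); exact: ltW.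
rewrite mulrDl; have [zd|dz] := ltP (normc (z - a)) d.
  have z1 : normc z <= normc a + 1.
    by rewrite -(subrKC a z) (le_trans (normcD _ _))// lerD2l; lra.
  apply: le_trans (_ : A * Q z <= _); last by rewrite lerDl mulr_ge0.
  apply: le_trans (_ : A * q <= _); last by rewrite ler_wpM2l.
  rewrite /A divfK ?gt_eqF//; apply: ler_pM => //.
  - by rewrite mulr_ge0// ?addr_ge0 ?normc_ge0.
  - apply: ler_pM; rewrite ?normc_ge0 ?addr_ge0 ?normc_ge0//; last by lra.
    apply: le_trans (Hd' z _) _; first exact: lt_le_trans zd _.
    by rewrite /cdivide eqxx.
  by apply: Pp; lra.
apply: le_trans (_ : B * Q z <= _); last by rewrite lerDr mulr_ge0.
have za : 0 < normc (z - a) by exact: lt_le_trans dz.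
apply: le_trans (_ : B * (normc (N z) * P z) <= _); last by rewrite ler_wpM2l.
rewrite mulrA ler_wpM2r// /cdivide; case: eqVneq => [E|_].
  by rewrite E subrr normc0 ltxx in za.
rewrite normcM normcV mulrAC ler_pdivrMr// mulrAC [leLHS]mulrC.
rewrite ler_wpM2r ?normc_ge0//.
have z1 : normc z <= normc a + normc (z - a).
  by rewrite -[z in leLHS](subrKC a) normcD.
have : (1 + normc a) <= (1 + normc a) / d * normc (z - a).
  by rewrite mulrAC ler_pdivlMr// ler_wpM2l ?addr_ge0.
rewrite /B; nra.
Qed.

End division.

(** * The weights and the space E(phi) *)

Section weight_bounds.
Context {R : realType} (phi : weight_family R).
Implicit Types (x y k : R) (m : nat).

(** Finiteness of the Legendre transform at the two slopes k and -k. *)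
Lemma weight_growth m k : (0 < m)%N -> exists2 C, 0 <= C &
  forall x, k * `|x| <= phi m x + C.
Proof.
move=> m0; have [C1 H1] := legendre_bounded phi k m0.
have [C2 H2] := legendre_bounded phi (- k) m0.
exists (`|C1| + `|C2|) => [|x]; first by rewrite addr_ge0.
have := H1 x; have := H2 x; have := ler_norm C1; have := ler_norm C2.
have := normr_ge0 C1; have := normr_ge0 C2.
by case: (ger0P x) => _; lra.
Qed.

(** By convexity every slope to the left of x is at most every slope to the right; the supremum of
    the left slopes separates them. *)
Lemma weight_subgradient m x : (0 < m)%N ->
  exists k, forall y, k * y - phi m y <= k * x - phi m x.
Proof.
move=> m0; pose S := [set (phi m x - phi m y) / (x - y) | y in [set y | y < x]].
have slopes y y' : y < x -> x < y' ->
    (phi m x - phi m y) / (x - y) <= (phi m y' - phi m x) / (y' - x).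
  move=> yx xy'; have d1 : 0 < x - y by rewrite subr_gt0.
  have d2 : 0 < y' - x by rewrite subr_gt0.
  have d3 : 0 < y' - y by lra.
  pose t := (y' - x) / (y' - y).
  have t01 : 0 <= t <= 1.
    apply/andP; split; first by apply: divr_ge0; lra.
    by rewrite ler_pdivrMr//; lra.
  have := weight_conv phi y y' m0 t01.
  have -> : t * y + (1 - t) * y' = x by rewrite /t; field; rewrite gt_eqF.
  move=> H; rewrite ler_pdivrMr// mulrAC ler_pdivlMr//.
  have tE : t * (y' - y) = y' - x by rewrite /t divfK// gt_eqF.
  have : (y' - y) * phi m x <= (y' - y) * (t * phi m y + (1 - t) * phi m y').
    by rewrite ler_pM2l.
  have -> : (y' - y) * (t * phi m y + (1 - t) * phi m y') =
    t * (y' - y) * phi m y + ((y' - y) - t * (y' - y)) * phi m y' by ring.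
  by rewrite tE; lra.
have S0 : S !=set0 by exists ((phi m x - phi m (x - 1)) / (x - (x - 1))), (x - 1) => //=; lra.
have ubS y' : x < y' -> ubound S ((phi m y' - phi m x) / (y' - x)).
  by move=> xy' _ [y /= yx <-]; exact: slopes.
have hS : has_ubound S.
  by exists ((phi m (x + 1) - phi m x) / (x + 1 - x)); apply: ubS; lra.
exists (sup S) => y; have [yx|xy|->//] := ltgtP y x.
  have : (phi m x - phi m y) / (x - y) <= sup S by apply: ub_le_sup => //; exists y.
  by rewrite ler_pdivrMr ?subr_gt0//; lra.
have : sup S <= (phi m y - phi m x) / (y - x) by apply: ge_sup => //; exact: ubS.
by rewrite ler_pdivlMr ?subr_gt0//; lra.
Qed.

Lemma legendre_subgradient m x k :
  (forall y, k * y - phi m y <= k * x - phi m x) ->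
  legendre (phi m) k <= k * x - phi m x.
Proof.
move=> H; apply: ge_sup; first by exists (k * 0 - phi m 0), 0.
by move=> _ [y _ <-].
Qed.

(** A subgradient k at x gives the inequality through Young's equality. The point is that slopes
    below a threshold can be avoided uniformly in x, so that only values of the transform far from
    the real axis are needed. *)
Lemma legendre_line m (th : R) : (0 < m)%N -> 0 <= th ->
  exists C, forall x, exists2 k, th <= `|k| &
    legendre (phi m) k - k * x <= C - phi m x.
Proof.
move=> m0 th0; have [C1 C10 H1] := weight_growth (th + 1) m0.
(* If the subgradient at x is smaller than [th], then phi_m(x) <= phi_m(0) + th |x|, and growth with
   slope th + 1 confines x to |x| <= B. There the slope [th] itself serves, at the cost of the
   constant below. *)
pose B := phi m 0 + C1.
exists (`|legendre (phi m) th + phi m 0 + 2 * th * B|) => x.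
have [k Hk] := weight_subgradient x m0.
have Lk := legendre_subgradient Hk.
have [kt|kt] := leP th `|k|.
  exists k => //; have := normr_ge0 (legendre (phi m) th + phi m 0 + 2 * th * B).
  lra.
exists th; first exact: ler_norm.
have h0 := Hk 0; rewrite mulr0 in h0.
have kx : k * x <= th * `|x|.
  rewrite (le_trans (ler_norm _))// normrM ler_wpM2r// ltW//.
have h1 := H1 x.
have xB : `|x| <= B by rewrite /B; lra.
have : th * `|x| <= th * B by rewrite ler_wpM2l.
have : - (th * x) <= th * `|x|.
  by rewrite -mulrN ler_wpM2l// -normrN ler_norm.
have := ler_norm (legendre (phi m) th + phi m 0 + 2 * th * B).
lra.
Qed.

Lemma legendre_ge0 m k : (0 < m)%N -> - phi m 0 <= legendre (phi m) k.
Proof. by move=> m0; have := legendre_ge phi k 0 m0; rewrite mulr0 sub0r. Qed.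

Lemma legendre_max m k k0 k1 : (0 < m)%N -> k0 <= k <= k1 ->
  legendre (phi m) k <= Num.max (legendre (phi m) k0) (legendre (phi m) k1).
Proof.
move=> m0 /andP[k0k kk1]; apply: ge_sup; first by exists (k * 0 - phi m 0), 0.
move=> _ [y _ <-]; rewrite le_max.
have [y0|y0] := leP 0 y; apply/orP; [right|left].
  by apply: le_trans (legendre_ge phi k1 y m0); rewrite lerD2r ler_wpM2r.
by apply: le_trans (legendre_ge phi k0 y m0); rewrite lerD2r ler_wnM2r// ltW.
Qed.

(** phi_m minus a linear function is convex and bounded below, hence increasing along the rays from
    0 up to a constant: y is a convex combination of x and 0. *)
Lemma weight_monotone m k : (0 < m)%N -> exists2 C, 0 <= C &
  forall x y, 0 <= y <= x \/ x <= y <= 0 ->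
    phi m y - k * y <= phi m x - k * x + C.
Proof.
move=> m0; have [K HK] := legendre_bounded phi k m0.
exists (`|phi m 0 + K|) => // x y xy.
have [x0|x0] := eqVneq x 0.
  rewrite x0 in xy *; have -> : y = 0.
    by apply/eqP; rewrite eq_le; case: xy => /andP[-> ->].
  by rewrite lerDl.
pose t := y / x.
have t01 : 0 <= t <= 1.
  rewrite /t; case: xy => /andP[h1 h2].
    have x1 : 0 < x by rewrite lt_neqAle eq_sym x0 (le_trans h1).
    by rewrite divr_ge0 ?(ltW x1)//= ler_pdivrMr// mul1r.
  have x1 : x < 0 by rewrite lt_neqAle x0 (le_trans h1).
  by rewrite mulr_le0 ?invr_le0 ?(ltW x1)//= ler_ndivrMr// mul1r.
have := weight_conv phi x 0 m0 t01.
rewrite mulr0 addr0 /t divfK// -/t => H.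
have h := HK x; have h2 := ler_norm (phi m 0 + K).
have ty : t * x = y by rewrite /t divfK.
case/andP: t01 => t0 t1.
have : (1 - t) * (phi m 0 - phi m x + k * x) <= `|phi m 0 + K|.
  apply: le_trans (_ : (1 - t) * `|phi m 0 + K| <= _).
    by apply: ler_wpM2l; lra.
  by rewrite ler_piMl//; lra.
have -> : k * y = t * (k * x) by rewrite -ty; ring.
lra.
Qed.

(** The exponential of hypothesis (2): raising the index by one pays for a factor 1 + |x|. *)
Lemma expR_weight_gap m x : (0 < m)%N ->
  (1 + `|x|) * expR (phi m.+1 x) <= expR (phi m x).
Proof.
move=> m0; have x1 : 0 < 1 + `|x| by rewrite ltr_pwDl.
rewrite -[X in X * _]lnK ?posrE// -expRD ler_expR.
by rewrite -lerBrDr (weight_gap phi).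
Qed.

Lemma expR_weight_gapn m n x : (0 < m)%N ->
  (1 + `|x|) ^+ n * expR (phi (n + m) x) <= expR (phi m x).
Proof.
move=> m0; elim: n => [|n IH]; first by rewrite expr0 mul1r.
apply: le_trans IH; rewrite exprSr -mulrA ler_wpM2l ?exprn_ge0 ?addr_ge0//.
by rewrite expR_weight_gap// ltn_addl.
Qed.

Lemma weight_lower m : (0 < m)%N -> exists2 q : R, 0 < q &
  forall x, q <= expR (phi m x).
Proof.
move=> m0; have [C C0 HC] := weight_growth 0 m0.
exists (expR (- C)); first exact: expR_gt0.
by move=> x; rewrite ler_expR; have := HC x; rewrite mul0r; lra.
Qed.

End weight_bounds.

Section smooth_sequences.
Context {R : realType}.
Implicit Types (f : R -> R[i]) (a m : nat).

Lemma derive1n_is_derive (u : nat -> R -> R) :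
  (forall a (x : R), is_derive x 1 (u a) (u a.+1 x)) ->
  forall a, derive1n a (u 0%N) = u a.
Proof.
move=> du; elim=> [//|a IH]; rewrite derive1nS IH; apply/funext => x.
by rewrite derive1E; have d := du a x; exact: derive_val.
Qed.

Lemma cderiv_cder (f : nat -> R -> R[i]) :
  (forall a x, cder (f a) x (f a.+1 x)) ->
  (forall m, class_C m (f 0%N)) /\ forall a x, cderiv (f 0%N) a x = f a x.
Proof.
move=> df.
have Re_ := derive1n_is_derive (fun a x => (df a x).1).
have Im_ := derive1n_is_derive (fun a x => (df a x).2).
split=> [m u uE|a x]; last first.
  by apply: complexP; rewrite /cderiv /= ?Re_ ?Im_.
have cont a (p : R[i] -> R) : p = @complex.Re R \/ p = @complex.Im R ->
    (forall x, derivable (fun y => p (f a y)) x 1) /\ continuous (fun y => p (f a y)).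
  move=> pE; have d x : derivable (fun y => p (f a y)) x 1.
    by have [d1 d2] := df a x; case: pE => ->; exact: ex_derive.
  split=> // x; apply: differentiable_continuous; exact/derivable1_diffP.
case: uE => ->; split.
- by move=> a x _; rewrite Re_; apply: (cont a _ (or_introl erefl)).1.
- by rewrite Re_; exact: (cont m _ (or_introl erefl)).2.
- by move=> a x _; rewrite Im_; apply: (cont a _ (or_intror erefl)).1.
by rewrite Im_; exact: (cont m _ (or_intror erefl)).2.
Qed.

Lemma class_C_cder f m a x : class_C m f -> (a < m)%N ->
  cder (cderiv f a) x (cderiv f a.+1 x).
Proof.
move=> cf am; split => /=.
  have [d _] := cf _ (or_introl erefl); rewrite ?derive1nS derive1E.
  by apply/derivableP; exact: d.
have [d _] := cf _ (or_intror erefl); rewrite ?derive1nS derive1E.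
by apply/derivableP; exact: d.
Qed.

Lemma cderiv0E f x : cderiv f 0 x = f x.
Proof. by rewrite /cderiv /=; case: (f x). Qed.

End smooth_sequences.

Section Espace_tools.
Context {R : realType} (phi : weight_family R).
Local Notation E := (Espace phi).
Implicit Types (f g : E) (s t : R[i]) (n m a : nat) (r : R).

(** The inequality q_n(f) <= r for smooth f, freed from the extended real supremum [Enorm]. *)
Definition qle n (f : R -> R[i]) r := forall a x, (a <= n)%N ->
  normc (cderiv f a x) <= r * expR (phi n x).

Lemma Ecder f a x : cder (cderiv f a) x (cderiv f a.+1 x).
Proof.
have [cf _] := EspaceP f (ltn0Sn a.+1).
exact: class_C_cder cf _.
Qed.

Lemma Ecderiv_lin f g s t a x :
  cderiv (s *: f + t *: g) a x = s * cderiv f a x + t * cderiv g a x.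
Proof.
have [cf _] := EspaceP f (ltn0Sn a); have [cg _] := EspaceP g (ltn0Sn a).
exact: (class_C_lin s t cf cg).2.
Qed.

Lemma Ecderiv_sub f g a x : cderiv (f - g) a x = cderiv f a x - cderiv g a x.
Proof.
have -> : f - g = 1 *: f + (-1) *: g by rewrite scale1r scaleN1r.
by rewrite Ecderiv_lin mul1r mulN1r.
Qed.

Lemma Ecderiv_scale f s a x : cderiv (s *: f) a x = s * cderiv f a x.
Proof.
have -> : s *: f = s *: f + 0 *: f by rewrite scale0r addr0.
by rewrite Ecderiv_lin mul0r addr0.
Qed.

Lemma Eqle f n : (0 < n)%N -> exists2 r, 0 <= r & qle n f r.
Proof.
move=> n0; have [_ /Enorm_ltP[r _ H]] := EspaceP f n0; exists r => //.
have := le_trans (normc_ge0 _) (H 0%N 0 (leq0n n)).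
by rewrite pmulr_lge0// expR_gt0.
Qed.

Lemma qle_ge0 n (f : R -> R[i]) r : qle n f r -> 0 <= r.
Proof.
move=> /(_ 0%N 0 isT) H; have := le_trans (normc_ge0 _) H.
by rewrite pmulr_lge0// expR_gt0.
Qed.

Lemma qle_mono m n (f : R -> R[i]) r d : (0 < m)%N -> (m <= n)%N -> r <= d ->
  qle n f r -> qle m f d.
Proof.
move=> m0 mn rd H a x am.
apply: le_trans (H a x (leq_trans am mn)) _.
have r0 := qle_ge0 H; apply: ler_pM; rewrite ?expR_ge0//.
by rewrite ler_expR weight_le.
Qed.

Lemma qle_lin n f g s t r d : qle n f r -> qle n g d ->
  qle n (s *: f + t *: g) (normc s * r + normc t * d).
Proof.
move=> Hf Hg a x an; rewrite Ecderiv_lin.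
apply: le_trans (normc_comb _ _ _ _) _; rewrite mulrDl -!mulrA.
by apply: lerD; rewrite ler_wpM2l ?normc_ge0 ?Hf ?Hg.
Qed.

Lemma qle_scale n f s r : qle n f r -> qle n (s *: f) (normc s * r).
Proof.
move=> Hf a x an; rewrite Ecderiv_scale normcM -mulrA.
by rewrite ler_wpM2l ?normc_ge0 ?Hf.
Qed.

Lemma Ebuild (f : nat -> R -> R[i]) :
  (forall a x, cder (f a) x (f a.+1 x)) ->
  (forall m, (0 < m)%N -> exists r, forall a x, (a <= m)%N ->
     normc (f a x) <= r * expR (phi m x)) ->
  exists2 g : E, (forall x, g x = f 0%N x) & forall a x, cderiv g a x = f a x.
Proof.
move=> df fb; have [cf fE] := cderiv_cder df.
suff fP : f 0%N \in Epred phi by exists (MkE fP).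
rewrite inE => m m0; split; first exact: cf.
have [r Hr] := fb m m0; apply/Enorm_ltP; exists r; first exact: ltry.
by move=> a x am; rewrite fE; exact: Hr.
Qed.

Lemma Ederiv_exists f : exists g : E, forall a x, cderiv g a x = cderiv f a.+1 x.
Proof.
have [||g _ H] := @Ebuild (fun a => cderiv f a.+1); last by exists g.
  by move=> a x; exact: Ecder.
move=> m m0; have [r _ Hr] := Eqle f (ltn0Sn m); exists r => a x am.
apply: le_trans (Hr a.+1 x _) _ => //.
rewrite ler_wpM2l ?(qle_ge0 Hr)// ler_expR weight_le//.
Qed.

(** The weights decrease with the index, so the norms increase, and one norm of large index replaces
    the finite intersections in [Eball]. *)
Lemma nbhs_Espace f (U : set E) : nbhs f U <-> exists2 n, (0 < n)%N &
  exists2 e : R, 0 < e & forall g, qle n (g - f) e -> U g.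
Proof.
split=> [[A [n [e e0 ->]] H]|[n n0 [e e0 H]]].
  exists n.+1 => //; exists (e / 2); first by rewrite divr_gt0.
  move=> g gf; apply: H => m /andP[m0 mn]; apply/Enorm_ltP.
  exists (e / 2); first by rewrite lte_fin ltr_pdivrMr// ltr_pMr// ltr1n.
  exact: (qle_mono m0 (leqW mn) (lexx _) gf).
exists (Eball n e); first by exists n, e.
move=> g /(_ n); rewrite n0 leqnn => /(_ isT) /Enorm_ltP[r + Hr].
rewrite lte_fin => re; apply: H; apply: (qle_mono n0 (leqnn n) (ltW re)).
exact: Hr.
Qed.

Lemma Edual_bound (F : Edual phi) : exists2 n, (0 < n)%N & exists2 C, 0 <= C &
  forall f r, qle n f r -> normc (F f) <= C * r.
Proof.
case: F => F FP /=; have [lF cF] : linear F /\ continuous F by move: FP; rewrite inE.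
have F0 : F 0 = 0.
  by have := lF (-1) 0 0; rewrite scaleN1r oppr0 add0r scaleN1r addNr.
have FZ s f : F (s *: f) = s * F f.
  by have := lF s f 0; rewrite F0 !addr0.
have n1 : nbhs (F 0) [set z : R[i]^o | normc z < 1].
  rewrite F0; exists 1 => //= z; rewrite /ball_ /= sub0r normrN normcE.
  by rewrite -[1]/(1%:C)%C ltcR.
have /nbhs_Espace[n n0 [e e0 H]] := cF 0 _ n1.
exists n => //; exists (2 / e); first by rewrite divr_ge0// ltW.
move=> f r fr; apply/ler_addgt0Pr => d d0.
(* Scaling by k brings f into the ball of radius e; the term d e / 2 keeps the denominator positive
   when r = 0 and costs less than d in the end. *)
have r0 := qle_ge0 fr; pose k := e / (r + d * e / 2).
have k0 : 0 < k by rewrite divr_gt0// ltr_wpDl// divr_gt0// mulr_gt0.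
have : normc (F (k%:C%C *: f)) < 1.
  apply: H; rewrite subr0.
  apply: (qle_mono n0 (leqnn n)) (qle_scale k%:C%C fr).
  rewrite normc_real gtr0_norm// /k mulrAC ler_pdivrMr.
    by rewrite ler_pM2l// lerDl divr_ge0// mulr_ge0 ?ltW.
  by rewrite ltr_wpDl// divr_gt0// mulr_gt0.
rewrite FZ normcM normc_real gtr0_norm// -ltr_pdivlMl// mulr1 /k invf_div.
move=> /ltW /le_trans; apply.
have -> : (r + d * e / 2) / e = r / e + d / 2 by field; rewrite gt_eqF.
have : 0 <= r / e by rewrite divr_ge0// ltW.
lra.
Qed.

Lemma Edual_lin (F : Edual phi) s t f g : F (s *: f + t *: g) = s * F f + t * F g.
Proof.
case: F => F FP /=; have [lF cF] : linear F /\ continuous F by move: FP; rewrite inE.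
have F0 : F 0 = 0.
  by have := lF (-1) 0 0; rewrite scaleN1r oppr0 add0r scaleN1r addNr.
rewrite lF; congr (_ + _).
by have := lF t g 0; rewrite F0 !addr0.
Qed.

Lemma Edual_build (F : E -> R[i]) n (C : R) : (0 < n)%N ->
  (forall s t f g, F (s *: f + t *: g) = s * F f + t * F g) ->
  (forall f r, qle n f r -> normc (F f) <= C * r) ->
  exists G : Edual phi, forall f, G f = F f.
Proof.
move=> n0 lF FC.
suff FP : (F : E -> R[i]^o) \in @Edual_pred R phi by exists (MkEdual FP).
rewrite inE; split=> [s f g|f].
  by have := lF s 1 f g; rewrite scale1r mul1r.
have FB f' g' : F (f' - g') = F f' - F g'.
  by have := lF 1 (-1) f' g'; rewrite scale1r scaleN1r mul1r mulN1r.
apply/(@cvgrPdist_le R[i] R[i]^o E (nbhs f) (nbhs_filter f)) => e /posc_real[d d0 ->].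
have C1 : 0 < `|C| + 1 by rewrite ltr_wpDl.
apply/nbhs_Espace; exists n => //; exists (d / (`|C| + 1)); first by rewrite divr_gt0.
move=> g gf /=; rewrite distrC normcE lecR -FB.
apply: le_trans (FC _ _ gf) _; rewrite mulrA ler_pdivrMr// mulrC ler_pM2l//.
by rewrite (le_trans (ler_norm _))// lerDl.
Qed.

Lemma Edual_ext (F G : Edual phi) : (forall f, F f = G f) -> F = G.
Proof. by move=> FG; apply: val_inj; apply/funext. Qed.

End Espace_tools.

Section exponential_derivatives.
Context {R : realType}.
Implicit Types (mu k z : R[i]) (x y : R) (a j n : nat).

(* The mixed derivative d^a/dx^a d^j/dmu^j of exp(mu x). *)
Fixpoint expD j a mu x : R[i] :=
  if j is i.+1 then x%:C%C * expD i a mu x + a%:R * expD i a.-1 mu x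
  else mu ^+ a * cexp (mu * x%:C%C).

Lemma cder_mulx (k : R[i]) x : cder (fun y : R => k * y%:C%C) x k.
Proof. by apply: cder_eq (cderZ k (cder_real x)) _; rewrite mulr1. Qed.

Lemma expD_cderx j a mu x : cder (expD j a mu) x (expD j a.+1 mu x).
Proof.
elim: j a => [|j IH] a /=.
  apply: cder_eq (cderZ (mu ^+ a) (cder_exp (cder_mulx mu x))) _.
  by rewrite exprS; ring.
apply: cder_eq (cderD (cderM (cder_real x) (IH a)) (cderZ a%:R (IH a.-1))) _.
by case: a => [|a] /=; rewrite ?[a.+2%:R]mulrSr; ring.
Qed.

Lemma expD_cdermu j a mu k x y :
  cder (fun s => expD j a (mu + s%:C%C * k) x) y (k * expD j.+1 a (mu + y%:C%C * k) x).
Proof.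
have dl := cder_line k mu y.
elim: j a => [|j IH] a.
  have dk : cder (fun s : R => (mu + s%:C%C * k) * x%:C%C) y (k * x%:C%C).
    by apply: cder_eq (cderM dl (cder_cst _ _)) _; rewrite mulr0 addr0.
  have de := cder_exp dk.
  case: a => [|a].
    rewrite /=; under eq_fun do rewrite expr0 mul1r.
    by apply: cder_eq de _; rewrite mul0r addr0 expr0; ring.
  apply: cder_eq (cderM (cderX a dl) de) _.
  by rewrite /= exprS; ring.
apply: cder_eq (cderD (cderZ x%:C%C (IH a)) (cderZ a%:R (IH a.-1))) _.
by rewrite /=; ring.
Qed.

Lemma expD_norm j a mu x : normc (expD j a mu x) <=
  (1 + normc mu) ^+ a * (`|x| + a%:R) ^+ j * expR (normc mu * `|x|).
Proof.
have m0 := normc_ge0 mu.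
elim: j a => [|j IH] a.
  rewrite /= expr0 mulr1 normcM normcX normc_cexp; apply: ler_pM.
  - by rewrite exprn_ge0.
  - exact: expR_ge0.
  - by rewrite lerXn2r// ?nnegrE ?addr_ge0// lerDr.
  rewrite ler_expR (le_trans (ler_norm _))// (le_trans (le_normc_Re _))//.
  by rewrite normcM normc_real.
rewrite [expD _ _ _ _]/=; apply: le_trans (normcD _ _) _.
rewrite !normcM normc_real -[a%:R]/(a%:R : R[i]).
have -> : normc (a%:R : R[i]) = a%:R.
  have -> : (a%:R : R[i]) = (a%:R : R)%:C%C by rewrite rmorph_nat.
  by rewrite normc_real normr_nat.
set B := (1 + normc mu) ^+ a * (`|x| + a%:R) ^+ j * expR (normc mu * `|x|).
have Ba : normc (expD j a.-1 mu x) <= B.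
  apply: le_trans (IH a.-1) _; rewrite /B; apply: ler_wpM2r; first exact: expR_ge0.
  apply: ler_pM; rewrite ?exprn_ge0 ?addr_ge0//.
    by rewrite ler_weXn2l// ?lerDl// leq_pred.
  by rewrite lerXn2r// ?nnegrE ?addr_ge0// lerD2l ler_nat leq_pred.
rewrite exprS.
have -> : (1 + normc mu) ^+ a * ((`|x| + a%:R) * (`|x| + a%:R) ^+ j) *
  expR (normc mu * `|x|) = `|x| * B + a%:R * B by rewrite /B; ring.
by apply: lerD; rewrite ler_wpM2l// IH.
Qed.

End exponential_derivatives.

(** * The transform of a functional *)

Section Fourier_Laplace.
Context {R : realType} (phi : weight_family R).
Implicit Types (la mu : R[i]) (x : R) (F : Edual phi).

Lemma expD_weight n j (M : R) : (0 < n)%N -> 0 <= M -> exists2 C, 0 <= C &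
  forall mu a x, normc mu <= M -> (a <= n)%N ->
    normc (expD j a mu x) <= C * expR (phi n x).
Proof.
(* The slope M absorbs exp(|mu| |x|), and j absorbs the power of |x| + a, which is at most (n + 1)^j
   exp(j |x|). *)
move=> n0 M0; have [K K0 HK] := weight_growth phi (M + j%:R) n0.
exists ((1 + M) ^+ n * (n.+1%:R ^+ j) * expR K) => [|mu a x muM an].
  by rewrite !mulr_ge0 ?expR_ge0 ?exprn_ge0 ?addr_ge0.
apply: le_trans (expD_norm j a mu x) _.
rewrite -!mulrA; apply: ler_pM; rewrite ?exprn_ge0 ?addr_ge0 ?normc_ge0//.
  apply: le_trans (_ : (1 + M) ^+ a <= _).
    by rewrite lerXn2r// ?nnegrE ?addr_ge0 ?normc_ge0// lerD2l.
  by rewrite ler_weXn2l// lerDl.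
apply: le_trans (_ : (n.+1%:R * expR `|x|) ^+ j * expR (M * `|x|) <= _).
  apply: ler_pM; rewrite ?expR_ge0 ?exprn_ge0 ?addr_ge0//.
    rewrite lerXn2r// ?nnegrE ?addr_ge0// ?mulr_ge0 ?expR_ge0//.
    have h := expR_ge1Dx `|x|.
    have na : a%:R <= n%:R :> R by rewrite ler_nat.
    rewrite -natr1; have := normr_ge0 x; have := ler0n R n; nra.
  by rewrite ler_expR ler_wpM2r.
rewrite exprMn -mulrA ler_wpM2l ?exprn_ge0// -expRM_natl -!expRD ler_expR.
have := HK x; rewrite mulrDl; lra.
Qed.

Lemma expE_expD la a x : cderiv (expE phi la) a x = expD 0 a (- 'i%C * la) x.
Proof.
have <- : expD 0 0 (- 'i%C * la) = expE phi la.
  by apply/funext => y; rewrite /= expr0 mul1r.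
by have [_ ->] := cderiv_cder (fun a x => expD_cderx 0 a (- 'i%C * la) x).
Qed.

Lemma xexp_exists la : exists g : Espace phi,
  forall a x, cderiv g a x = expD 1 a (- 'i%C * la) x.
Proof.
have [||g _ H] := @Ebuild R phi (fun a => expD 1 a (- 'i%C * la)); last by exists g.
  by move=> a x; exact: expD_cderx.
move=> m m0; have [C _ H] := expD_weight 1 m0 (normc_ge0 (- 'i%C * la)).
by exists C => a x; exact: H.
Qed.

(** Derivatives bring powers of |la|, and x Im la <= phi~_n(Im la) + phi_n(x) is Young's
    inequality. *)
Lemma expE_qle n la : (0 < n)%N -> qle phi n (expE phi la)
  ((1 + normc la) ^+ n * expR (legendre (phi n) (complex.Im la))).
Proof.
move=> n0 a x an; rewrite expE_expD /= normcM normcX normcM normc_opp normc_i mul1r.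
rewrite -[leRHS]mulrA; apply: ler_pM; [by rewrite exprn_ge0 ?normc_ge0|exact: normc_ge0| |].
  apply: le_trans (_ : (1 + normc la) ^+ a <= _).
    by rewrite lerXn2r// ?nnegrE ?addr_ge0 ?normc_ge0// lerDr.
  by rewrite ler_weXn2l// lerDl normc_ge0.
rewrite normc_cexp -expRD ler_expR.
have -> : complex.Re (- 'i%C * la * x%:C%C) = complex.Im la * x.
  by case: la => p q /=; ring.
by have := legendre_ge phi (complex.Im la) x n0; lra.
Qed.

(** F commutes with d/dla because the second-order Taylor remainder of the exponentials in la is
    O(|h|^2) in the norm q_n that bounds F. *)
Lemma Fhat_cdiff F la (g : Espace phi) :
  (forall a x, cderiv g a x = expD 1 a (- 'i%C * la) x) ->
  cdiff (fun mu => F (expE phi mu)) la (- 'i%C * F g).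
Proof.
move=> gE; have [n n0 [C C0 HF]] := Edual_bound F.
have M0 : 0 <= normc la + 1 by rewrite addr_ge0// normc_ge0.
have [K K0 HK] := expD_weight 2 n0 M0.
have key h : normc h <= 1 ->
    normc (F (expE phi (la + h)) - F (expE phi la) - (- 'i%C * F g) * h) <=
    4 * C * K * normc h ^+ 2.
  move=> h1; pose r := 1 *: (1 *: expE phi (la + h) + (-1) *: expE phi la) + ('i%C * h) *: g.
  have -> : F (expE phi (la + h)) - F (expE phi la) - - 'i%C * F g * h = F r.
    by rewrite /r !Edual_lin; ring.
  have -> : 4 * C * K * normc h ^+ 2 = C * (4 * (normc h ^+ 2 * K)) by ring.
  apply: HF => a x an; rewrite /r !Ecderiv_lin !expE_expD gE.
  pose k := - 'i%C * h.
  have hk : normc k = normc h by rewrite normcM normc_opp normc_i mul1r.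
  have := @cder_taylor R _ _ _ 0 1 (normc h ^+ 2 * (K * expR (phi n x)))
    (expD_cdermu 0 a (- 'i%C * la) k x)
    (fun y => cderZ k (expD_cdermu 1 a (- 'i%C * la) k x y)).
  rewrite subr0 normr1 expr1n mulr1 mul0r addr0 [1%:C%C * k]mul1r => H.
  have {}H := H _.
  have -> : 1 * (1 * expD 0 a (- 'i%C * (la + h)) x + -1 * expD 0 a (- 'i%C * la) x) +
      'i%C * h * expD 1 a (- 'i%C * la) x =
    expD 0 a (- 'i%C * la + k) x - expD 0 a (- 'i%C * la) x -
      1%:C%C * (k * expD 1 a (- 'i%C * la) x).
    rewrite /k -mulrDr [1%:C%C * _]mul1r; move: (expD 1 a _ x) (expD 0 a _ x) (expD 0 a _ x) => *.
    by ring.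
  apply: le_trans (H _) _; last by rewrite !mulrA.
  move=> y; rewrite subr0 => y1; rewrite (normcM k) (normcM k) hk.
  rewrite mulrA -expr2 ler_wpM2l ?exprn_ge0 ?normc_ge0//.
  apply: HK => //; apply: le_trans (normcD _ _) _.
  rewrite (normcM _ k) hk normcM normc_opp normc_i mul1r normc_real lerD2l.
  by apply: mulr_ile1; rewrite ?normc_ge0.
move=> e e0; have C1 : 0 < 4 * C * K + 1 by rewrite ltr_wpDl// !mulr_ge0.
exists (Num.min 1 (e / (4 * C * K + 1))); first by rewrite lt_min ltr01 divr_gt0.
move=> w; rewrite lt_min ltr_pdivlMr// => /andP[/ltW w1 we].
have := key (w - la) w1; rewrite subrKC => /le_trans; apply.
rewrite expr2 mulrA ler_wpM2r ?normc_ge0//; apply: le_trans (ltW we).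
rewrite mulrC ler_wpM2l ?normc_ge0//; lra.
Qed.

Lemma Fhat_holo F la : holo (fun mu => F (expE phi mu)) la.
Proof.
have [g gE] := xexp_exists la.
by exists (- 'i%C * F g); exact: Fhat_cdiff.
Qed.

Lemma Fhat_Qpred F : (fun mu : R[i] => F (expE phi mu) : R[i]^o) \in Qpred phi.
Proof.
rewrite inE; split; first by move=> z; apply/holoP; exact: Fhat_holo.
have [n n0 [C C0 HF]] := Edual_bound F.
exists n => //; apply/Qnorm_ltP; exists C; first exact: ltry.
by move=> z; apply: HF; exact: expE_qle.
Qed.

End Fourier_Laplace.

(** Used to place points outside the finite exceptional sets. *)
Lemma injective_fresh (T : eqType) (f : nat -> T) (s : seq T) :
  injective f -> exists k, f k \notin s.
Proof.
move=> fi; have [/allP h|/allPn[k _ ?]] :=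
    boolP (all (fun k => f k \in s) (iota 0 (size s).+1)); last by exists k.
have u : uniq (map f (iota 0 (size s).+1)) by rewrite map_inj_uniq ?iota_uniq.
suff : (size (map f (iota 0 (size s).+1)) <= size s)%N.
  by rewrite size_map size_iota ltnn.
by apply: uniq_leq_size u _ => _ /mapP[k /h fk ->].
Qed.

(** * Surjectivity *)

Section line_integrals.
Context {R : realType}.
Implicit Types (f : R -> R[i]) (x t : R).

Lemma rcont_lipschitz f (L : R) :
  (forall x y, normc (f x - f y) <= L * `|x - y|) -> rcont f.
Proof.
move=> fL; have key p : (forall z, `|p z| <= normc z) ->
    (forall z w : R[i], p (z - w) = p z - p w) -> continuous (fun x => p (f x) : R).
  move=> pn pB x; apply/cvgrPdist_lt => e e0.
  have L1 : 0 < `|L| + 1 by rewrite ltr_wpDl.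
  have eL : 0 < e / (`|L| + 1) by rewrite divr_gt0.
  exists (e / (`|L| + 1)) => // y /=; rewrite ltr_pdivlMr// => xy.
  rewrite -pB; apply: le_lt_trans (pn _) _; apply: le_lt_trans (fL _ _) _.
  apply: le_lt_trans xy; rewrite mulrC ler_wpM2l// (le_trans (ler_norm _))//.
  by rewrite lerDl.
split; apply: key => [z|z w].
- exact: le_normc_Re.
- by rewrite Re_add Re_opp.
- exact: le_normc_Im.
by rewrite Im_add Im_opp.
Qed.

Lemma rcont_inv f : rcont f -> (forall x, f x != 0) -> rcont (fun x => (f x)^-1).
Proof.
move=> [f1 f2] f0.
pose N x : R := (complex.Re (f x) ^+ 2 + complex.Im (f x) ^+ 2)^-1.
have cN : continuous N.
  move=> x; apply: cvgV; last by apply: cvgD; apply: cvgM; [exact: f1|exact: f1|exact: f2|exact: f2].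
  by rewrite -normc_sqr sqrf_eq0 normc_eq0.
have E x : (f x)^-1 = ((complex.Re (f x) * N x) +i* (- complex.Im (f x) * N x))%C.
  rewrite /N; have := f0 x; case: (f x) => a b _; rewrite /= mulNr.
  by apply: complexP.
split=> x; under eq_fun do rewrite E /=.
  by apply: cvgM; [exact: f1|exact: cN].
by apply: cvgM; [apply: cvgN; exact: f2|exact: cN].
Qed.

Lemma line_int_scale f (s : R[i]) C : rcont f -> decays C f ->
  line_int (fun x => s * f x) = s * line_int f.
Proof.
move=> cf fC; have := line_int_lin s 0 cf cf fC fC.
rewrite mul0r addr0 => <-; congr line_int.
by apply/funext => x; rewrite mul0r addr0.
Qed.

Lemma line_int_strip (H : R[i] -> R[i]) (s : seq R[i]) (c d M : R) :
  (forall z, ccont H z) -> (forall z, z \notin s -> holo H z) -> c <= d ->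
  (forall x y, c <= y <= d -> normc (H (x +i* y)%C) <= M / (1 + x ^+ 2)) ->
  line_int (fun x => H (x +i* c)%C) = line_int (fun x => H (x +i* d)%C).
Proof.
move=> cH hH cd HM; have rc y : rcont (fun x => H (x +i* y)%C).
  by apply: ccont_rcont => //; exact: rcont_hline.
have cc : c <= c <= d by rewrite lexx.
have dd : c <= d <= d by rewrite lexx andbT.
have t1 := line_int_cvg (rc c) (fun x => HM x c cc).
have t2 := line_int_cvg (rc d) (fun x => HM x d dd).
have t3 := ctends_lin 1 (-1) t1 t2.
have M0 : 0 <= M by apply: decays_ge0 (fun x => HM x c cc).
suff E : 1 * line_int (fun x => H (x +i* c)%C) +
    (-1) * line_int (fun x => H (x +i* d)%C) = 0.
  by apply/eqP; rewrite -subr_eq0 -E mul1r mulN1r.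
apply: ctends_unique t3 _.
apply: ctends_eq (Cauchy_strip cH hH cd _) => [n|e e0]; first by rewrite mul1r mulN1r.
exists (Num.truncn (M / e)).+1 => n y Nn cyd.
suff b x : `|x| = n%:R -> M / (1 + x ^+ 2) <= e.
  split; (apply: le_trans (HM _ _ cyd) _; apply: b); first by rewrite normr_nat.
  by rewrite normrN normr_nat.
move=> xn; have x1 : 0 < 1 + x ^+ 2 by rewrite ltr_pwDl// sqr_ge0.
rewrite ler_pdivrMr// mulrC -ler_pdivrMr//.
apply: le_trans (ltW (truncnS_gt _)) _.
have : (Num.truncn (M / e)).+1%:R <= n%:R :> R by rewrite ler_nat.
by rewrite -[x ^+ 2]real_normK ?num_real// xn; nra.
Qed.

(** Serves where a derivative passes through a limit, with a quadratic remainder that is uniform: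
    integrals with a parameter and pointwise limits of functions. *)
Lemma cder_quadratic f (x0 K : R) (l : R[i]) : 0 <= K ->
  (forall h : R, `|h| <= 1 -> normc (f (x0 + h) - f x0 - h%:C%C * l) <= K * `|h| ^+ 2) ->
  cder f x0 l.
Proof.
move=> K0 main.
have key (p : R[i] -> R) : (forall z, `|p z| <= normc z) ->
    (forall z w : R[i], p (z - w) = p z - p w) ->
    (forall (k : R) z, p (k%:C%C * z) = k * p z) ->
    is_derive x0 1 (fun x => p (f x)) (p l).
  move=> pn pB pZ.
  have cvp : h^-1 *: (p (f (h *: (1 : R) + x0)) - p (f x0))
      @[h --> (0 : R)^'] --> p l.
    apply/cvgrPdist_le => e e0; have K1 : 0 < K + 1 by rewrite ltr_wpDl.
    exists (Num.min 1 (e / (K + 1))) => /=; first by rewrite lt_min ltr01 divr_gt0.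
    move=> h; rewrite /ball_ /= sub0r normrN lt_min => /andP[/ltW h1 he] h0.
    have := le_trans (pn _) (main h h1); rewrite pB pB pZ => mn.
    rewrite distrC -[_ *: (_ - _)]/(h^-1 * _) [h *: 1]mulr1 [h + x0]addrC.
    set A := p _ - p _ in mn *.
    have -> : h^-1 * A - p l = h^-1 * (A - h * p l).
      by field.
    rewrite normrM normfV ler_pdivrMl ?normr_gt0//.
    apply: le_trans mn _; rewrite expr2 mulrA mulrC ler_wpM2l//.
    rewrite ltr_pdivlMr// in he; apply: le_trans (ltW he).
    by rewrite mulrC ler_wpM2l// lerDl.
  have dd : derivable (fun x => p (f x)) x0 1 by apply/cvg_ex; eexists; exact: cvp.
  by split => //; apply: cvg_lim.
split; apply: key => [z|z y|k z].
- exact: le_normc_Re.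
- by rewrite Re_add Re_opp.
- by rewrite Re_mul /= mul0r subr0.
- exact: le_normc_Im.
- by rewrite Im_add Im_opp.
by rewrite Im_mul /= mul0r addr0.
Qed.

(** Differentiation under the integral sign. An integrable bound on the second derivative makes the
    Taylor remainder of the integrand integrable and quadratic, so no dominated convergence is
    involved. *)
Lemma cder_line_int (u v w : R -> R -> R[i]) (x0 M : R) :
  (forall x, rcont (u x)) -> (forall x, rcont (v x)) ->
  (forall x, exists C, decays C (u x)) -> (forall x, exists C, decays C (v x)) ->
  (forall t x, cder (fun x => u x t) x (v x t)) ->
  (forall t x, cder (fun x => v x t) x (w x t)) ->
  (forall t x, `|x - x0| <= 1 -> normc (w x t) <= M / (1 + t ^+ 2)) ->
  cder (fun x => line_int (u x)) x0 (line_int (v x0)).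
Proof.
move=> cu cv du dv uv vw wM.
pose K := 2 * pi * (4 * M).
have M0 : 0 <= M.
  by have := wM 0 x0; rewrite subrr normr0 expr0n addr0 divr1 => /(_ ler01); exact/le_trans/normc_ge0.
have K0 : 0 <= K by rewrite !mulr_ge0// pi_ge0.
have main h : `|h| <= 1 -> normc (line_int (u (x0 + h)) - line_int (u x0) -
    h%:C%C * line_int (v x0)) <= K * `|h| ^+ 2.
  move=> h1; have [C1 D1] := du (x0 + h); have [C2 D2] := du x0.
  have [C3 D3] := dv x0.
  pose I t := 1 * (1 * u (x0 + h) t + (-1) * u x0 t) + (- h%:C%C) * v x0 t.
  have -> : line_int (u (x0 + h)) - line_int (u x0) - h%:C%C * line_int (v x0) =
      line_int I.
    rewrite (line_int_lin _ _ (rcont_lin 1 (-1) (cu _) (cu _)) (cv _)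
      (decays_lin 1 (-1) D1 D2) D3).
    by rewrite (line_int_lin _ _ (cu _) (cu _) D1 D2); ring.
  have -> : K * `|h| ^+ 2 = 2 * pi * (4 * M * `|h| ^+ 2) by rewrite /K; ring.
  apply: line_int_norm => [|t]; first by do 2![apply: rcont_lin => //].
  have := @cder_taylor R _ _ _ x0 (x0 + h) (M / (1 + t ^+ 2)) (uv t) (vw t).
  have -> : x0 + h - x0 = h by rewrite addrC addKr.
  move=> H; have -> : I t = u (x0 + h) t - u x0 t - h%:C%C * v x0 t.
    by rewrite /I; ring.
  have -> : 4 * M * `|h| ^+ 2 / (1 + t ^+ 2) = 4 * (M / (1 + t ^+ 2)) * `|h| ^+ 2.
    by ring.
  by apply: H => x xh; apply: wM; exact: le_trans xh h1.
exact: cder_quadratic K0 main.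
Qed.

(** The integral of 2 / (1 + (t - p)^2) over the line, origin of the 2 pi in the inversion
    formula. *)
Lemma atan_shift_cvg (p : R) :
  ctends (fun n => (2 * (atan (n%:R - p) - atan (- n%:R - p)))%:C%C) (2 * pi)%:C%C.
Proof.
have cyp (q : R) : (n%:R + q) @[n --> \oo] --> +oo.
  apply/cvgryPge => A; have /cvgryPge /(_ (A - q))[N _ HN] := @cvgr_idn R.
  by exists N => // n /= /HN /=; rewrite lerBlDr.
apply/ctendsP; split => /=; last exact: cvg_cst.
apply: cvgM; first exact: cvg_cst.
rewrite (_ : pi = pi / 2 - (- (pi / 2))); last by rewrite opprK -splitr.
apply: cvgB.
  apply: (@cvg_comp _ _ _ (fun n : nat => n%:R - p) (@atan R) _ _ _ (cyp (- p))).
  exact: cvgy_atan.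
rewrite (_ : (fun n => _) = fun n => - atan (n%:R + p)); last first.
  by apply/funext => n; rewrite -atanN opprD.
apply: cvgN; apply: (@cvg_comp _ _ _ (fun n : nat => n%:R + p) (@atan R) _ _ _ (cyp p)).
exact: cvgy_atan.
Qed.

End line_integrals.

(** * Inversion for functions with cubic decay *)

Section inverse_transform.
Context {R : realType} (phi : weight_family R).
Variables (m : nat) (G : R[i] -> R[i]) (s : seq R[i]) (r : R).
Hypotheses (m0 : (0 < m)%N) (cG : forall z, ccont G z)
  (hG : forall z, z \notin s -> holo G z)
  (Gr : forall z, normc (G z) * (1 + normc z) ^+ 3 <=
    r * expR (legendre (phi m) (complex.Im z))).

Local Notation wt y := (expR (legendre (phi m) y)).

Let r0 : 0 <= r.
Proof.
have h : 0 <= normc (G 0) * (1 + normc 0) ^+ 3.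
  by rewrite mulr_ge0 ?normc_ge0// exprn_ge0// addr_ge0// normc_ge0.
by have := le_trans h (Gr 0); rewrite pmulr_lge0 ?expR_gt0.
Qed.

(** Two of the three powers make line integrals converge; the third pays for the factor t that a
    derivative in x produces. *)
Let cube_ge (t y : R) : (1 + `|t|) * (1 + t ^+ 2) <= (1 + normc (t +i* y)%C) ^+ 3.
Proof.
have h : `|t| <= normc (t +i* y)%C by exact: (le_normc_Re (t +i* y)%C).
have t0 := normr_ge0 t; have := normc_ge0 (t +i* y)%C.
rewrite -[t ^+ 2]real_normK ?num_real//.
move: (normc _) h => N h N0.
apply: le_trans (_ : (1 + `|t|) ^+ 3 <= _).
  by rewrite [leRHS]exprS ler_wpM2l; nra.
by rewrite lerXn2r// ?nnegrE ?addr_ge0// lerD2l.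
Qed.

Let G_line (t y : R) :
  normc (G (t +i* y)%C) * (1 + `|t|) <= r * wt y / (1 + t ^+ 2).
Proof.
have t1 : 0 < 1 + t ^+ 2 by rewrite ltr_pwDl// sqr_ge0.
rewrite ler_pdivlMr// -mulrA; apply: le_trans (Gr (t +i* y)%C).
by rewrite ler_wpM2l ?normc_ge0// cube_ge.
Qed.

Let G_line0 (t y : R) : normc (G (t +i* y)%C) <= r * wt y / (1 + t ^+ 2).
Proof.
apply: le_trans (G_line t y); rewrite ler_peMr ?normc_ge0//.
by rewrite lerDl.
Qed.

Let kernel x (z : R[i]) := G z * cexp ('i%C * x%:C%C * z).

(** The inverse Fourier transform up to (2 pi)^-1, which is restored in [inverse_transform]. *)
Let S x := line_int (fun t => kernel x (t +i* 0)%C).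

Let kernel_norm x (t y : R) :
  normc (kernel x (t +i* y)%C) = normc (G (t +i* y)%C) * expR (- (y * x)).
Proof.
by rewrite /kernel normcM normc_cexp /=; congr (_ * expR _); ring.
Qed.

Let kernel_decays x y : decays (r * wt y * expR (- (y * x))) (fun t => kernel x (t +i* y)%C).
Proof.
by move=> t; rewrite kernel_norm mulrAC ler_wpM2r ?expR_ge0// G_line0.
Qed.

Let kernel_cont x z : ccont (kernel x) z.
Proof. by apply: ccontM => //; apply: holo_ccont; exact: holo_cexp. Qed.

Let kernel_rcont x y : rcont (fun t => kernel x (t +i* y)%C).
Proof. by apply: ccont_rcont; [exact: kernel_cont|exact: rcont_hline]. Qed.

Let S_shift_le x y0 y1 : y0 <= y1 ->
  line_int (fun t => kernel x (t +i* y0)%C) = line_int (fun t => kernel x (t +i* y1)%C).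
Proof.
move=> y01.
pose M := r * expR (Num.max (legendre (phi m) y0) (legendre (phi m) y1)) *
  expR ((`|y0| + `|y1|) * `|x|).
apply: (@line_int_strip _ _ s _ _ M) => // [z zs|t y yy].
  by apply: holoM; [exact: hG|exact: holo_cexp].
apply: le_trans (kernel_decays x y t) _; rewrite ler_wpM2r//.
  by rewrite invr_ge0 addr_ge0// sqr_ge0.
rewrite /M; apply: ler_pM; rewrite ?expR_ge0 ?mulr_ge0 ?expR_ge0//.
  by rewrite ler_wpM2l// ler_expR legendre_max.
rewrite ler_expR; apply: le_trans (ler_norm _) _; rewrite normrN normrM.
by rewrite ler_wpM2r// ler_norml; case: (ger0P y0) (ger0P y1) => ? [] ?; lra.
Qed.

Let S_shift x y : S x = line_int (fun t => kernel x (t +i* y)%C).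
Proof. by have [y0|/ltW y0] := leP 0 y; [|apply/esym]; exact: S_shift_le. Qed.

(** The line is chosen for each x: at height k the integrand carries exp(phi~_m(k) - k x), which is
    at most exp(C0 - phi_m(x)). Since |k| >= th, only the bound by [rq] enters. *)
Let S_bound (th rq C0 : R) : 0 <= rq ->
  (forall z, th <= `|complex.Im z| -> normc (G z) * (1 + normc z) ^+ 3 <=
    rq * wt (complex.Im z)) ->
  (forall x, exists2 k, th <= `|k| & legendre (phi m) k - k * x <= C0 - phi m x) ->
  forall x, normc (S x) <= 2 * pi * (rq * expR C0) * expR (- phi m x).
Proof.
move=> rq0 Gq HC x; have [k kth kx] := HC x; rewrite (S_shift x k).
have -> : 2 * pi * (rq * expR C0) * expR (- phi m x) =
  2 * pi * (rq * expR (C0 - phi m x)) by rewrite expRD; ring.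
apply: line_int_norm => [|t]; first exact: kernel_rcont.
have t1 : 0 < 1 + t ^+ 2 by rewrite ltr_pwDl// sqr_ge0.
rewrite kernel_norm ler_pdivlMr//.
apply: le_trans (_ : rq * expR (legendre (phi m) k - k * x) <= _); last first.
  by rewrite ler_wpM2l// ler_expR.
rewrite expRD mulrA mulrAC ler_wpM2r ?expR_ge0//.
apply: le_trans (Gq (t +i* k)%C kth); rewrite ler_wpM2l ?normc_ge0//.
apply: le_trans (cube_ge t k); by rewrite ler_peMl ?(ltW t1)// lerDl normr_ge0.
Qed.

Let S_rcont : rcont S.
Proof.
apply: (@rcont_lipschitz _ _ (2 * pi * (2 * (r * wt 0)))) => x y.
have -> : S x - S y = line_int (fun t => 1 * kernel x (t +i* 0)%C + (-1) * kernel y (t +i* 0)%C).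
  rewrite (line_int_lin _ _ (kernel_rcont x 0) (kernel_rcont y 0)
    (kernel_decays x 0) (kernel_decays y 0)).
  by rewrite mul1r mulN1r.
rewrite -[2 * pi * _ * _]mulrA; apply: line_int_norm => [|t].
  by apply: rcont_lin; exact: kernel_rcont.
have -> : 1 * kernel x (t +i* 0)%C + -1 * kernel y (t +i* 0)%C =
    G (t +i* 0)%C * (cexp ('i%C * t%:C%C * x%:C%C) - cexp ('i%C * t%:C%C * y%:C%C)).
  rewrite /kernel -[(t +i* 0)%C]/(t%:C%C).
  by rewrite ![_ * x%:C%C * t%:C%C]mulrAC ![_ * y%:C%C * t%:C%C]mulrAC; ring.
have d1 z := cder_exp (cder_mulx ('i%C * t%:C%C) z).
have := @cder_normV _ _ _ y x `|t| d1; rewrite normcM => H.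
apply: le_trans (_ : normc (G (t +i* 0)%C) * (2 * `|t| * `|x - y|) <= _).
  rewrite ler_wpM2l ?normc_ge0//; apply: H => z _.
  rewrite normcM normc_cexp normcM normc_i mul1r normc_real.
  have -> : complex.Re ('i%C * t%:C%C * z%:C%C) = 0 by rewrite /=; ring.
  by rewrite expR0 mulr1.
apply: le_trans (_ : 2 * `|x - y| * (normc (G (t +i* 0)%C) * (1 + `|t|)) <= _).
  by have := normc_ge0 (G (t +i* 0)%C); have := normr_ge0 (x - y); nra.
have -> : 2 * (r * wt 0) * `|x - y| / (1 + t ^+ 2) =
  2 * `|x - y| * (r * wt 0 / (1 + t ^+ 2)) by ring.
by rewrite ler_wpM2l ?mulr_ge0// G_line.
Qed.

(** Two steps in the index give the factor (1 + |x|)^2, which dominates 1 + x^2. *)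
Let pairing_decays (A t : R) (f : Espace phi) : 0 <= A ->
  (forall x, normc (S x) <= A * expR (- phi m x)) ->
  qle phi (2 + m) f t -> decays (A * t) (fun x => S x * f x).
Proof.
move=> A0 SA ft x; have x1 : 0 < 1 + x ^+ 2 by rewrite ltr_pwDl// sqr_ge0.
have t0 := qle_ge0 ft.
have f0 := ft 0%N x isT; rewrite cderiv0E in f0.
rewrite normcM ler_pdivlMr//.
apply: le_trans (_ : (A * expR (- phi m x)) * (t * expR (phi (2 + m)%N x)) * (1 + x ^+ 2) <= _).
  by rewrite ler_wpM2r ?(ltW x1)//; apply: ler_pM; rewrite ?normc_ge0.
have -> : A * expR (- phi m x) * (t * expR (phi (2 + m)%N x)) * (1 + x ^+ 2) =
  A * t * (expR (- phi m x) * ((1 + x ^+ 2) * expR (phi (2 + m)%N x))) by ring.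
rewrite ler_piMr ?mulr_ge0// expRN mulrC ler_pdivrMr ?expR_gt0// mul1r.
apply: le_trans (expR_weight_gapn phi 2 x m0); rewrite ler_wpM2r ?expR_ge0//.
by rewrite -[x ^+ 2]real_normK ?num_real//; have := normr_ge0 x; nra.
Qed.

Let f_rcont (f : Espace phi) : rcont f.
Proof.
have := cder_rcont (fun x => Ecder f 0 x).
by rewrite (_ : cderiv f 0 = f)//; apply/funext => x; rewrite cderiv0E.
Qed.

Section evaluation.
Variables (la : R[i]) (las : la \notin s).
Let p := complex.Re la.
Let q := complex.Im la.

(* The line Im z = q + e, with e = 1 or -1, avoids la. *)
Let w (e t : R) : R[i] := 'i%C * ((t +i* (q + e))%C - la).

Let wE (e t : R) : w e t = ((- e) +i* (t - p))%C.
Proof.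
by rewrite /w /p /q; case: la => a b; apply: complexP => /=; ring.
Qed.

Let w_ne0 (e t : R) : `|e| = 1 -> w e t != 0.
Proof.
move=> e1; rewrite wE eq_complex /= oppr_eq0 negb_and.
by rewrite -normr_eq0 e1 oner_eq0.
Qed.

Let w_ge1 (e t : R) : `|e| = 1 -> 1 <= normc (w e t).
Proof.
by move=> e1; rewrite -e1 -normrN; have := le_normc_Re (w e t); rewrite wE.
Qed.

Let w_le (e t : R) : `|e| = 1 -> normc (w e t) <= (2 + `|p|) * (1 + `|t|).
Proof.
move=> e1; apply: le_trans (normc_le_ReIm _) _; rewrite wE /= normrN e1.
have := ler_normB t p; have := normr_ge0 t; have := normr_ge0 p; nra.
Qed.

Let w_rcont e : rcont (w e).
Proof.
split=> x; under eq_fun do rewrite wE /=; first exact: cvg_cst.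
by apply: cvgB; [exact: cvg_id|exact: cvg_cst].
Qed.

Let I x := S x * expE phi la x.

(** A primitive of [I], obtained by dividing the exponential by its rate w. As |exp(w x)| = exp(-e
    x), it vanishes at +oo for e = 1 and at -oo for e = -1. *)
Let U e x := line_int (fun t => G (t +i* (q + e))%C / w e t * cexp (w e t * x%:C%C)).
Let V e x := line_int (fun t => G (t +i* (q + e))%C * cexp (w e t * x%:C%C)).

Let G_rcont e : rcont (fun t => G (t +i* (q + e))%C).
Proof. by apply: ccont_rcont => //; exact: rcont_hline. Qed.

Let exp_rcont e x : rcont (fun t => cexp (w e t * x%:C%C)).
Proof.
apply: ccont_rcont; first by move=> z; apply: holo_ccont; exists (cexp z); exact: cdiff_cexp.
by apply: rcontM; [exact: w_rcont|exact: rcont_cst].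
Qed.

Let Gw_rcont e : `|e| = 1 -> rcont (fun t => G (t +i* (q + e))%C / w e t).
Proof.
move=> e1; apply: rcontM; first exact: G_rcont.
by apply: rcont_inv => [|t]; [exact: w_rcont|exact: w_ne0].
Qed.

Let exp_norm e x t : normc (cexp (w e t * x%:C%C)) = expR (- (e * x)).
Proof. by rewrite normc_cexp wE /=; congr expR; ring. Qed.

Let V_eq e x : V e x = I x.
Proof.
rewrite /I (S_shift x (q + e)) mulrC -(line_int_scale _ (kernel_rcont x _) (kernel_decays x _)).
congr line_int; apply/funext => t; rewrite /kernel /=.
rewrite mulrCA -cexpD /w; congr (_ * cexp _); ring.
Qed.

Let V_decays e x : decays (r * wt (q + e) * expR (- (e * x)))
  (fun t => G (t +i* (q + e))%C * cexp (w e t * x%:C%C)).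
Proof.
by move=> t; rewrite normcM exp_norm mulrAC ler_wpM2r ?expR_ge0// G_line0.
Qed.

Let U_decays e x : `|e| = 1 -> decays (r * wt (q + e) * expR (- (e * x)))
  (fun t => G (t +i* (q + e))%C / w e t * cexp (w e t * x%:C%C)).
Proof.
move=> e1 t; apply: le_trans (V_decays e x t).
rewrite !normcM ler_wpM2r ?normc_ge0// normcV ler_piMr ?normc_ge0//.
by rewrite invf_le1 ?w_ge1// (lt_le_trans ltr01)// w_ge1.
Qed.

Let U_cder e x : `|e| = 1 -> cder (U e) x (I x).
Proof.
move=> e1; rewrite -(V_eq e x).
pose M := r * wt (q + e) * (2 + `|p|) * expR (`|x| + 1).
apply: (@cder_line_int _
  (fun y t => G (t +i* (q + e))%C / w e t * cexp (w e t * y%:C%C))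
  (fun y t => G (t +i* (q + e))%C * cexp (w e t * y%:C%C))
  (fun y t => w e t * (G (t +i* (q + e))%C * cexp (w e t * y%:C%C))) x M).
- by move=> y; apply: rcontM; [exact: Gw_rcont|exact: exp_rcont].
- by move=> y; apply: rcontM; [exact: G_rcont|exact: exp_rcont].
- by move=> y; eexists; exact: U_decays.
- by move=> y; eexists; exact: V_decays.
- move=> t y; have d := cderZ (G (t +i* (q + e))%C / w e t)
    (cder_exp (cder_mulx (w e t) y)).
  by apply: cder_eq d _; field; exact: w_ne0.
- move=> t y; have d := cderZ (G (t +i* (q + e))%C)
    (cder_exp (cder_mulx (w e t) y)).
  by apply: cder_eq d _; ring.
move=> t y yx; rewrite (normcM (w e t)) (normcM (G _)) exp_norm.
apply: le_trans (_ : (2 + `|p|) * (normc (G (t +i* (q + e))%C) * (1 + `|t|)) *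
   expR (`|x| + 1) <= _); last first.
  have -> : M / (1 + t ^+ 2) =
    (2 + `|p|) * (r * wt (q + e) / (1 + t ^+ 2)) * expR (`|x| + 1) by rewrite /M; ring.
  rewrite ler_wpM2r ?expR_ge0// ler_wpM2l ?addr_ge0//; exact: G_line.
rewrite mulrA; apply: ler_pM; rewrite ?mulr_ge0 ?normc_ge0 ?expR_ge0//.
  by rewrite [leRHS]mulrCA [leLHS]mulrC ler_wpM2l ?normc_ge0// w_le.
rewrite ler_expR; apply: le_trans (ler_norm _) _; rewrite normrN normrM e1 mul1r.
rewrite -[y in leLHS](subrKC x).
by apply: le_trans (ler_normD _ _) _; rewrite lerD2l.
Qed.

(** The residue at la, by hand: G / w is - i times the difference quotient [D] plus G(la) / w. The
    integrals of [D] over the two lines agree by Cauchy, and 1/w(-1) - 1/w(1) = 2 / (1 + (t - p)^2)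
    has integral 2 pi. *)
Let U0_diff : U (-1) 0 - U 1 0 = (2 * pi)%:C%C * G la.
Proof.
have n1 : `|1 : R| = 1 by rewrite normr1.
have nN1 : `|-1 : R| = 1 by rewrite normrN1.
have [l dG] := hG las.
pose N z := G z - G la; pose D := cdivide N la l.
have cN z : ccont N z by apply: ccontD => //; exact: ccont_cst.
have dN : cdiff N la l.
  by rewrite -[l]addr0; apply: cdiffD => //; exact: cdiff_cst.
have Nla : N la = 0 by rewrite /N subrr.
have cD z : ccont D z by exact: ccont_divide.
have hD z : z \notin la :: s -> holo D z.
  rewrite inE negb_or => /andP[zla zs]; apply: holo_divide => //.
  by apply: holoD; [exact: hG|exact: holo_cst].
have rD e : rcont (fun t => D (t +i* (q + e))%C).
  by apply: ccont_rcont => //; exact: rcont_hline.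
have atE n : cint (- n%:R) n%:R (fun t : R => (2 / (1 + (t - p) ^+ 2))%:C%C) =
    (2 * (atan (n%:R - p) - atan (- n%:R - p)))%:C%C.
  rewrite (cintE (F := fun t => (2 * atan (t - p))%:C%C)).
    by rewrite mulrBr rmorphB.
  move=> t; split => /=; last exact: is_derive_cst.
  have d1 : is_derive t 1 (fun t : R => t - p) 1.
    by apply: is_derive_eq; rewrite subr0.
  have d2 := @is_derive1_comp _ (@atan R) (fun t => t - p) t _ _ (is_derive1_atan (t - p)) d1.
  by apply: is_derive_eq (is_deriveZ 2 d2) _; rewrite mulr1.
have rat : rcont (fun t : R => (2 / (1 + (t - p) ^+ 2))%:C%C).
  split=> t /=; last exact: cvg_cst.
  apply: cvgM; first exact: cvg_cst.
  apply: cvgV; first by rewrite gt_eqF// ltr_pwDl// sqr_ge0.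
  apply: cvgD; first exact: cvg_cst.
  by apply: cvgM; (apply: cvgB; [exact: cvg_id|exact: cvg_cst]).
have U0 e : `|e| = 1 -> ctends (fun n => cint (- n%:R) n%:R
    (fun t => G (t +i* (q + e))%C / w e t)) (U e 0).
  move=> e1; have := line_int_cvg _ (U_decays 0 e1).
  rewrite /U (_ : (fun t => _ * cexp _) = (fun t => G (t +i* (q + e))%C / w e t)).
    by apply; exact: Gw_rcont.
  by apply/funext => t; rewrite mulr0 cexp0 mulr1.
have key t : G (t +i* (q - 1))%C / w (-1) t - G (t +i* (q + 1))%C / w 1 t =
   - 'i%C * (1 * D (t +i* (q - 1))%C + (-1) * D (t +i* (q + 1))%C) +
   G la * (2 / (1 + (t - p) ^+ 2))%:C%C.
  have DE e : `|e| = 1 -> G (t +i* (q + e))%C / w e t =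
      - 'i%C * D (t +i* (q + e))%C + G la / w e t.
    move=> e1; have := w_ne0 t e1; rewrite /w mulf_eq0 negb_or => /andP[i0 z0].
    rewrite /D /cdivide -subr_eq0 (negbTE z0) /N.
    have ii : ('i%C : R[i])^-1 = - 'i%C.
      by apply: (mulfI i0); rewrite mulfV// mulrN -expr2 sqr_i opprK.
    by rewrite !invfM ii; ring.
  rewrite !DE//.
  have -> : (2 / (1 + (t - p) ^+ 2))%:C%C = (w (-1) t)^-1 - (w 1 t)^-1.
    rewrite !wE; set x := t - p; have x1 : 1 + x ^+ 2 != 0.
      by rewrite gt_eqF// ltr_pwDl// sqr_ge0.
    by apply: complexP => /=; field; rewrite ?sqrrN ?expr1n.
  by ring.
have T1 := ctends_lin 1 (-1) (U0 _ nN1) (U0 _ n1).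
have TD : ctends (fun n => cint (- n%:R) n%:R (fun t => 1 * D (t +i* (q - 1))%C +
    (-1) * D (t +i* (q + 1))%C)) 0.
  apply: ctends_eq (Cauchy_strip cD hD (_ : q - 1 <= q + 1) _) => [n||e e0].
  - by rewrite cint_lin// mul1r mulN1r.
  - by lra.
  (* Bounds the numerator of [D] on the strip: by convexity the weight at y is at most the larger of
     its values on the two edges. *)
  pose B := r * (wt (q - 1) + wt (q + 1)) + normc (G la).
  have B0 : 0 <= B by rewrite addr_ge0 ?normc_ge0// mulr_ge0// addr_ge0 ?expR_ge0.
  exists (Num.truncn (B / e + `|p| + 1)).+1 => n y Nn yq.
  have nB : B / e + `|p| + 1 < n%:R.
    by apply: lt_le_trans (truncnS_gt _) _; rewrite ler_nat.
  have Be : 0 <= B / e by rewrite divr_ge0// ltW.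
  suff b x : `|x| = n%:R -> normc (D (x +i* y)%C) <= e.
    by split; apply: b; rewrite ?normrN normr_nat.
  move=> xn; have zla : B / e + 1 <= normc ((x +i* y)%C - la).
    apply: le_trans (le_normc_Re _); rewrite Re_add Re_opp /= -/p.
    by have := lerB_dist x p; lra.
  have z0 : 0 < normc ((x +i* y)%C - la) by lra.
  rewrite /D /cdivide -subr_eq0 -normc_eq0 gt_eqF// normcM normcV ler_pdivrMr//.
  apply: le_trans (normcB _ _) _; apply: le_trans (_ : B <= _).
    rewrite lerD2r; apply: le_trans (G_line0 x y) _.
    rewrite ler_pdivrMr; last by rewrite ltr_pwDl// sqr_ge0.
    have : legendre (phi m) y <= Num.max (legendre (phi m) (q - 1)) (legendre (phi m) (q + 1)).
      exact: legendre_max.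
    rewrite -ler_expR => /(ler_wpM2l r0) h.
    apply: le_trans h _; apply: le_trans (_ : r * (wt (q - 1) + wt (q + 1)) * 1 <= _).
      rewrite mulr1 ler_wpM2l// /Num.max; case: ifP => _; rewrite ?lerDl ?lerDr expR_ge0//.
    by rewrite ler_wpM2l ?mulr_ge0 ?addr_ge0 ?expR_ge0// lerDl sqr_ge0.
  by rewrite -ler_pdivrMl// mulrC; lra.
have T2 := ctends_lin (- 'i%C) (G la) TD (atan_shift_cvg p).
have E : 1 * U (-1) 0 + (-1) * U 1 0 = - 'i%C * 0 + G la * (2 * pi)%:C%C.
  apply: ctends_unique T1 _; apply: ctends_eq T2 => n.
  rewrite -atE -cint_lin//; last by apply: rcont_lin.
  by rewrite -cint_lin; [congr cint; apply/funext => t; rewrite -key mul1r mulN1r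
    |exact: Gw_rcont..].
by move: E; rewrite mul1r mulN1r mulr0 add0r mulrC => ->.
Qed.

Let U_small e : `|e| = 1 -> ctends (fun n => U e (e * n%:R)) 0.
Proof.
move=> e1; apply: (@ctends_inv _ _ (2 * pi * (r * wt (q + e)))) => n.
have := line_int_norm _ (U_decays (e * n%:R) e1) => /(_ _)/le_trans; apply.
  by apply: rcontM; [exact: Gw_rcont|exact: exp_rcont].
rewrite -[leRHS]mulrA ler_wpM2l ?mulr_ge0 ?pi_ge0//.
rewrite mulrA -expr2 -[e ^+ 2]real_normK ?num_real// e1 expr1n mul1r.
rewrite ler_wpM2l ?mulr_ge0 ?expR_ge0// expRN lef_pV2 ?posrE ?expR_gt0//.
by rewrite -natr1 addrC; exact: expR_ge1Dx.
Qed.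

(** Each half-line uses the primitive that vanishes at its end: the integral over x < 0 is U (-1) 0,
    and that over x > 0 is - U 1 0. *)
Lemma inverse_transform_eval :
  line_int (fun x => S x * expE phi la x) = (2 * pi)%:C%C * G la.
Proof.
have n1 : `|1 : R| = 1 by rewrite normr1.
have nN1 : `|-1 : R| = 1 by rewrite normrN1.
rewrite -U0_diff; apply: line_int_unique.
have c1 := ctends_lin 1 (-1) (U_small n1) (U_small nN1).
have c2 := ctends_lin 1 1 c1 (ctends_cst (U (-1) 0 - U 1 0)).
have -> : U (-1) 0 - U 1 0 =
  1 * (1 * 0 + (-1) * 0) + 1 * (U (-1) 0 - U 1 0) by ring.
apply: ctends_eq c2 => n.
have ci e a b : `|e| = 1 -> cint a b I = U e b - U e a.
  by move=> e1; apply: cintE => x; exact: U_cder.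
rewrite -(cint_cat _ _ 0) (ci (-1))// (ci 1)// !mul1r !mulN1r.
by move: (U _ _) (U _ _) (U _ _) (U _ _) => *; ring.
Qed.

End evaluation.

(** The global bound r ensures convergence and the freedom to move the line; the norm of the
    functional involves only [rq], the bound for |Im z| >= th. *)
Lemma inverse_transform (th rq C0 : R) : 0 <= rq ->
  (forall z, th <= `|complex.Im z| -> normc (G z) * (1 + normc z) ^+ 3 <=
    rq * wt (complex.Im z)) ->
  (forall x, exists2 k, th <= `|k| & legendre (phi m) k - k * x <= C0 - phi m x) ->
  exists2 F : Edual phi, (forall la, F (expE phi la) = G la) &
    forall (f : Espace phi) t, qle phi (2 + m) f t -> normc (F f) <= 2 * pi * expR C0 * rq * t.
Proof.
move=> rq0 Gq HC; have SA := S_bound rq0 Gq HC.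
set A := 2 * pi * (rq * expR C0) in SA.
have A0 : 0 <= A by rewrite !mulr_ge0 ?pi_ge0 ?expR_ge0.
have pi20 : 0 < 2 * pi :> R by rewrite mulr_gt0// pi_gt0.
pose F (f : Espace phi) := (2 * pi)^-1%:C%C * line_int (fun x => S x * f x).
have Sf_rcont (f : Espace phi) : rcont (fun x => S x * f x).
  by apply: rcontM; [exact: S_rcont|exact: f_rcont].
have dec (f : Espace phi) : exists C, decays C (fun x => S x * f x).
  have [t _ ft] := Eqle f (isT : (0 < 2 + m)%N).
  by exists (A * t); exact: pairing_decays.
have [|f t ft|F' FE] := @Edual_build R phi F (2 + m) A isT.
- move=> a b f g; rewrite /F; have [C HC1] := dec f; have [D HD] := dec g.
  have -> : line_int (fun x => S x * (a *: f + b *: g : Espace phi) x) =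
      a * line_int (fun x => S x * f x) + b * line_int (fun x => S x * g x).
    rewrite -(line_int_lin a b (Sf_rcont f) (Sf_rcont g) HC1 HD).
    congr line_int; apply/funext => x.
    by rewrite -[(_ + _ : Espace phi) x]/(a * f x + b * g x); ring.
  by move: (line_int _) (line_int _) => *; ring.
- rewrite /F normcM normc_real normfV gtr0_norm// ler_pdivrMl//.
  exact: line_int_norm (pairing_decays A0 SA ft).
have evalF la : la \notin s -> F' (expE phi la) = G la.
  move=> las; rewrite FE /F inverse_transform_eval// mulrA -rmorphM/=.
  by rewrite mulVf ?gt_eqF// mul1r.
exists F' => [la|f t ft]; last first.
  have -> : 2 * pi * expR C0 * rq * t = A * t by rewrite /A; ring.
  rewrite FE /F normcM normc_real normfV gtr0_norm// ler_pdivrMl//.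
  apply: le_trans (line_int_norm (Sf_rcont f) (pairing_decays A0 SA ft)) _.
  by rewrite ler_pM2l.
(* Both sides are continuous in la and agree off [s]; a point of a sequence tending to la that
   avoids [s] settles the exceptional values. *)
have cF := holo_ccont (Fhat_holo F' la).
apply/eqP; rewrite -subr_eq0 -normc_eq0; apply/eqP/le_anti; rewrite normc_ge0 andbT.
apply/ler_addgt0Pr => e e0; rewrite add0r; have e2 : 0 < e / 2 by rewrite divr_gt0.
have [d1 d10 h1] := cF _ e2; have [d2 d20 h2] := @cG la _ e2.
pose d := Num.min d1 d2; have d0 : 0 < d by rewrite lt_min d10.
pose h k : R[i] := la + (d / k.+2%:R)%:C%C.
have hi : injective h.
  move=> k j /addrI /complexI /(mulfI (lt0r_neq0 d0)) /invr_inj /eqP.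
  by rewrite eqr_nat => /eqP[].
have [k ks] := injective_fresh s hi.
have hd : normc (h k - la) < d.
  rewrite /h addrC addKr normc_real gtr0_norm ?divr_gt0//.
  by rewrite ltr_pdivrMr// ltr_pMr// ltr1n.
have {}h1 : normc (F' (expE phi (h k)) - F' (expE phi la)) < e / 2.
  by apply: h1; apply: lt_le_trans hd _; rewrite ge_min lexx.
have {}h2 : normc (G (h k) - G la) < e / 2.
  by apply: h2; apply: lt_le_trans hd _; rewrite ge_min lexx orbT.
have -> : F' (expE phi la) - G la = (G (h k) - G la) -
    (F' (expE phi (h k)) - F' (expE phi la)) by rewrite (evalF _ ks); ring.
by apply: le_trans (normcB _ _) _; lra.
Qed.

End inverse_transform.

Section Espace_derivative.
Context {R : realType} (phi : weight_family R).
Local Notation E := (Espace phi).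

Lemma Espace_ext (f g : E) : (forall x, f x = g x) -> f = g.
Proof. by move=> fg; apply: val_inj; apply/funext. Qed.

Lemma Ederiv_op : exists D : E -> E,
  [/\ forall f a x, cderiv (D f) a x = cderiv f a.+1 x,
      forall s t f g, D (s *: f + t *: g) = s *: D f + t *: D g,
      forall n (f : E) t, (0 < n)%N -> qle phi n.+1 f t -> qle phi n (D f) t &
      forall la, D (expE phi la) = (- 'i%C * la) *: expE phi la].
Proof.
have [D HD] := choice (@Ederiv_exists R phi).
have D0 f x : D f x = cderiv f 1 x by rewrite -cderiv0E HD.
exists D; split=> [//|s t f g|n f t n0 ft a x an|la].
- apply: Espace_ext => x; rewrite D0 Ecderiv_lin -!D0.
  by [].
- rewrite HD; apply: le_trans (ft a.+1 x an) _.
  by rewrite ler_wpM2l ?(qle_ge0 ft)// ler_expR weight_le.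
apply: Espace_ext => x; rewrite D0 expE_expD /= expr1.
by [].
Qed.

End Espace_derivative.

(** * Lowering the order of growth *)

Section transform_induction.
Context {R : realType} (phi : weight_family R).
Local Notation E := (Espace phi).
Implicit Types (g : R[i] -> R[i]) (s : seq R[i]) (m n j : nat) (r rq th : R).

(** The exponent j measures the excess over the cubic decay that the inversion formula asks for; j =
    0 is the hypothesis of [inverse_transform]. *)
Definition growth g j m r (z : R[i]) := normc (g z) * (1 + normc z) ^+ 3 <=
  r * ((1 + normc z) ^+ j * expR (legendre (phi m) (complex.Im z))).

(* In transform_step, dividing by z - a is harmless only away from a: this is why
   the bound on F is required to depend on g through rq alone. *)
Definition transform_claim j := forall m th s, (0 < m)%N -> 0 <= th ->
  exists C n, [/\ 0 <= C, (0 < n)%N & forall g r rq, 0 <= rq ->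
    (forall z, ccont g z) -> (forall z, z \notin s -> holo g z) ->
    (forall z, growth g j m r z) ->
    (forall z, th <= `|complex.Im z| -> growth g j m rq z) ->
    exists2 F : Edual phi, (forall la, F (expE phi la) = g la) &
      forall (f : E) t, qle phi n f t -> normc (F f) <= C * rq * t].

Lemma transform_claim0 : transform_claim 0.
Proof.
move=> m th s m0 th0; have [C0 HC] := legendre_line phi m0 th0.
exists (2 * pi * expR C0), (2 + m)%N; split => //.
  by rewrite !mulr_ge0 ?pi_ge0 ?expR_ge0.
move=> g r rq rq0 cg hg gr gq; apply: (inverse_transform m0 cg hg (r := r)) => //.
  by move=> z; have := gr z; rewrite /growth expr0 mul1r.
by move=> z /gq; rewrite /growth expr0 mul1r.
Qed.

(** The function (e^(iz) - 1) / z, with value i at 0. *)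
Let kap : R[i] -> R[i] := cdivide (fun z => cexp ('i%C * z) + -1) 0 'i%C.

Let kapN_cdiff z : cdiff (fun z : R[i] => cexp ('i%C * z) + -1) z ('i%C * cexp ('i%C * z)).
Proof.
rewrite -[X in cdiff _ _ X]addr0; apply: cdiffD; last exact: cdiff_cst.
by apply: cdiff_scale; exact: cdiff_cexp.
Qed.

Let kapN0 : cexp ('i%C * 0) + -1 = 0 :> R[i].
Proof. by rewrite mulr0 cexp0 subrr. Qed.

Let kapN_cdiff0 : cdiff (fun z : R[i] => cexp ('i%C * z) + -1) 0 'i%C.
Proof. by apply: cdiff_eq (kapN_cdiff 0) _; rewrite mulr0 cexp0 mulr1. Qed.

Let kapN_ccont z : ccont (fun z : R[i] => cexp ('i%C * z) + -1) z.
Proof. by apply: holo_ccont; eexists; exact: kapN_cdiff. Qed.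

Let kap_ccont z : ccont kap z.
Proof. exact: ccont_divide. Qed.

Let kap_holo z : z != 0 -> holo kap z.
Proof. by move=> z0; apply: holo_divide => //; eexists; exact: kapN_cdiff. Qed.

Let kap_growth m : (0 < m)%N -> exists2 C, 0 <= C &
  forall z, growth (fun z => kap z ^+ 3) 0 m C z.
Proof.
move=> m0; pose Q (z : R[i]) := 1 + expR (- complex.Im z).
have [||||C HC] := @divide_bounded R _ 0 'i%C (fun=> 1) Q 1 1 kapN_ccont
  kapN_cdiff0 kapN0 ltr01.
- by move=> z; exact: ler01.
- by move=> z; rewrite lerDl expR_ge0.
- by move=> z _.
- move=> z; rewrite mulr1 /Q; apply: le_trans (normcD _ _) _.
  rewrite normc_opp normc1 normc_cexp [leLHS]addrC lerD2l.
  by rewrite le_eqVlt; apply/orP; left; apply/eqP; congr expR => /=; case: z => a b /=; ring.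
(* From |kap| (1 + |z|) <= C (1 + e^(-y)) and (1 + e)^3 <= 4 (1 + e^3); then 1 and e^(-3y) are
   compared with exp(phi~_m(y)) by Young's inequality at 0 and at -3. *)
pose K := `|C| ^+ 3 * (4 * (expR (phi m 0) + expR (phi m (- 3)))).
exists K; first by rewrite !mulr_ge0 ?exprn_ge0 ?addr_ge0 ?expR_ge0.
move=> z; rewrite /growth expr0 mul1r normcX -exprMn.
have k0 : 0 <= normc (kap z) * (1 + normc z).
  by rewrite mulr_ge0 ?normc_ge0// addr_ge0// normc_ge0.
have Q0 : 0 <= Q z by rewrite addr_ge0// expR_ge0.
apply: le_trans (_ : (`|C| * Q z) ^+ 3 <= _).
  rewrite lerXn2r// ?nnegrE ?mulr_ge0//.
  have := HC z; rewrite mulr1 => /le_trans; apply.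
  by rewrite ler_wpM2r// ler_norm.
set y := complex.Im z; set W := expR (legendre (phi m) y).
rewrite /K -[leRHS]mulrA -[4 * _ * W]mulrA exprMn ler_wpM2l ?exprn_ge0//.
have h1 : 1 <= expR (phi m 0) * W.
  by rewrite -expRD -expR0 ler_expR; have := legendre_ge phi y 0 m0; rewrite mulr0; lra.
have h2 : expR (- y) ^+ 3 <= expR (phi m (- 3)) * W.
  by rewrite -expRD -expRM_natl ler_expR; have := legendre_ge phi y (- 3) m0; lra.
rewrite /Q -/y; have := expR_ge0 (- y); move: (expR (- y)) h2 => e h2 e0.
apply: le_trans (_ : 4 * (1 + e ^+ 3) <= _); last by rewrite ler_pM2l// mulrDl lerD.
have : 0 <= (1 - e) ^+ 2 * (1 + e) by rewrite mulr_ge0 ?sqr_ge0// addr_ge0.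
by rewrite !exprS !expr0; lra.
Qed.

(** On the positive imaginary axis e^(iz) = e^(-y) differs from 1. This is where the interpolation
    point a is taken. *)
Let kap_imag (y : R) : 0 < y -> kap (0 +i* y)%C != 0.
Proof.
move=> y0; have z0 : (0 +i* y)%C != 0 :> R[i].
  by rewrite eq_complex /= eqxx /= gt_eqF.
rewrite /kap /cdivide (negbTE z0) subr0 mulf_neq0 ?invr_eq0//.
have -> : 'i%C * (0 +i* y)%C = (- y)%:C%C :> R[i] by apply: complexP => /=; ring.
rewrite subr_eq0 /cexp /= cos0 sin0 mulr1 mulr0 eq_complex /= eqxx andbT.
by rewrite lt_eqF// -expR0 ltr_expR oppr_lt0.
Qed.

Lemma transform_step j : transform_claim j -> transform_claim j.+1.
Proof.
move=> IH m th s m0 th0.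
(* Candidates for a: on the axis where h does not vanish, and high enough for the bound by [rq] to
   control g(a). *)
pose pt k : R[i] := (0 +i* (th + k.+1%:R))%C.
have ptinj : injective pt.
  by move=> k i [] /addrI /eqP; rewrite eqr_nat => /eqP[].
have [k ks] := injective_fresh s ptinj; set a := pt k in ks.
pose ya := th + k.+1%:R; have ya0 : 0 < ya by rewrite ltr_wpDl.
have a0 : a != 0 by rewrite eq_complex /= eqxx /= gt_eqF.
pose h z := kap z ^+ 3.
have ha : h a != 0 by rewrite expf_neq0// kap_imag.
have ch z : ccont h z by apply: ccontX; exact: kap_ccont.
have hh z : z != 0 -> holo h z by move=> z0; apply: holoX; exact: kap_holo.
have [Ch Ch0 hCh] := kap_growth m0.
(* The functional with transform h is fixed here, before g; 0 is exceptional because kap is only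
   known to be continuous there. *)
have [CH [nH [CH0 nH0 HH]]] := transform_claim0 [:: 0] m0 (lexx 0).
have [H HE Hb] : exists2 F : Edual phi, (forall la, F (expE phi la) = h la) &
      forall (f : E) t, qle phi nH f t -> normc (F f) <= CH * Ch * t.
  by apply: (HH h Ch Ch) => // z; rewrite inE; exact: hh.
have th2 : 0 <= ya + 1 by rewrite addr_ge0// ltW.
(* Beyond the height ya + 1 one has |z - a| >= 1, so division is harmless; a and 0 join the
   exceptional points. *)
have [C1 [n1 [C10 n10 H1]]] := IH m (ya + 1) (a :: 0 :: s) m0 th2.
have [D [_ Dlin Db DE]] := Ederiv_op phi.
pose wt z := expR (legendre (phi m) (complex.Im z)).
have wt0 z : 0 <= wt z by exact: expR_ge0.
have z1 z : 0 <= 1 + normc z :> R by rewrite addr_ge0// normc_ge0.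
pose K := (1 + normc a) ^+ j.+1 * wt a.
have K0 : 0 <= K by rewrite mulr_ge0// exprn_ge0.
pose K2 := 1 + K * Ch / normc (h a).
have K20 : 0 <= K2 by rewrite addr_ge0// divr_ge0 ?normc_ge0// mulr_ge0.
pose B1 := C1 * ((2 + normc a) * K2).
have B10 : 0 <= B1 by rewrite !mulr_ge0// addr_ge0// normc_ge0.
have Kh0 : 0 <= K / normc (h a) by rewrite divr_ge0// normc_ge0.
exists (K / normc (h a) * (CH * Ch) + (1 + normc a) * B1), (maxn nH n1.+1).
split; [|by rewrite leq_max nH0|].
  by apply: addr_ge0; apply: mulr_ge0 => //; exact: mulr_ge0.
move=> g r rq rq0 cg hg gr gq.
have zX z i : 1 <= (1 + normc z) ^+ i :> R.
  by apply: exprn_ege1; rewrite lerDl normc_ge0.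
have ga : normc (g a) <= rq * K.
  apply: le_trans (gq a _); first by rewrite ler_peMr ?normc_ge0.
  by rewrite /= (le_trans _ (ler_norm _))// lerDl.
pose c := g a / h a.
have cK : normc c <= rq * (K / normc (h a)).
  by rewrite normcM normcV mulrA ler_wpM2r// invr_ge0 normc_ge0.
pose N z := g z + - c * h z.
have Na : N a = 0 by rewrite /N /c mulNr divfK// subrr.
have [lg dg] := hg a ks; have [lh dh] := hh a a0.
have dN : cdiff N a (lg + - c * lh) by apply: cdiffD => //; exact: cdiffZ.
have cN z : ccont N z by apply: ccontD => //; exact: ccontZ.
pose g1 := cdivide N a (lg + - c * lh).
have NQ r' z : growth g j.+1 m r' z ->
    normc (N z) * (1 + normc z) ^+ 3 <=
    (r' + rq * (K * Ch / normc (h a))) * ((1 + normc z) ^+ j.+1 * wt z).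
  move=> gz; have hz := hCh z; rewrite /growth expr0 mul1r in hz.
  apply: le_trans (_ : (normc (g z) + normc c * normc (h z)) * (1 + normc z) ^+ 3 <= _).
    rewrite ler_wpM2r ?exprn_ge0//.
    by apply: le_trans (normcD _ _) _; rewrite normcM normc_opp.
  rewrite !mulrDl; apply: lerD; first exact: gz.
  rewrite -[leLHS]mulrA; apply: le_trans (_ : rq * (K / normc (h a)) * (Ch * wt z) <= _).
    apply: ler_pM; [exact: normc_ge0| |exact: cK|exact: hz].
    by rewrite mulr_ge0 ?normc_ge0// exprn_ge0.
  have -> : rq * (K / normc (h a)) * (Ch * wt z) =
    rq * (K * Ch / normc (h a)) * wt z by ring.
  have X0 : 0 <= rq * (K * Ch / normc (h a)).
    by apply: mulr_ge0 => //; rewrite divr_ge0 ?normc_ge0// mulr_ge0.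
  by rewrite ler_wpM2l// ler_peMl// zX.
have gE z : g z = c * h z + (z - a) * g1 z by rewrite cdivideM// /N; ring.
have g1q z : ya + 1 <= `|complex.Im z| -> growth g1 j m ((2 + normc a) * K2 * rq) z.
  move=> zy; have zth : th <= `|complex.Im z|.
    by apply: le_trans zy; rewrite /ya -addrA lerDl.
  have za1 : 1 <= normc (z - a).
    apply: le_trans (le_normc_Im _); rewrite Im_add Im_opp /= -/ya.
    have := lerB_dist (complex.Im z) ya; rewrite (gtr0_norm ya0); lra.
  have N1 := NQ rq z (gq z zth).
  have z10 : 0 < 1 + normc z by rewrite ltr_pwDl// normc_ge0.
  rewrite /growth -(ler_pM2r z10) mulrAC.
  apply: le_trans (_ : (2 + normc a) * normc (N z) * (1 + normc z) ^+ 3 <= _).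
    by rewrite ler_wpM2r ?exprn_ge0// divide_far.
  rewrite -mulrA; apply: le_trans (_ : (2 + normc a) * _ <= _).
    by apply: ler_wpM2l N1; rewrite addr_ge0// normc_ge0.
  rewrite le_eqVlt; apply/orP; left; apply/eqP.
  by rewrite /K2 /wt exprSr; ring.
(* This bound is only qualitative: it may depend on g, since the induction hypothesis does not let
   it enter the norm of the functional. *)
have [r1 g1r] : exists r1, forall z, growth g1 j m r1 z.
  pose r2 := `|r| + rq * (K * Ch / normc (h a)) + 1.
  have r21 : 1 <= r2.
    rewrite /r2 lerDr addr_ge0//; apply: mulr_ge0 => //.
    by rewrite divr_ge0 ?normc_ge0// mulr_ge0.
  have r20 : 0 <= r2 by apply: le_trans r21.
  have [|||||Cd HCd] := @divide_bounded R N a (lg + - c * lh)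
    (fun z => (1 + normc z) ^+ 3) (fun z => r2 * ((1 + normc z) ^+ j.+1 * wt z))
    ((2 + normc a) ^+ 3) (expR (- phi m 0)) cN dN Na.
  - exact: expR_gt0.
  - by move=> z; rewrite exprn_ge0.
  - move=> z; apply: le_trans (_ : 1 * (1 * wt z) <= _).
      by rewrite !mul1r ler_expR legendre_ge0.
    apply: ler_pM; rewrite ?mul1r//.
    by rewrite ler_peMl// zX.
  - move=> z za1; rewrite lerXn2r// ?nnegrE ?addr_ge0 ?normc_ge0//.
    have : normc z <= normc a + normc (z - a).
      by rewrite -[z in leLHS](subrKC a) normcD.
    by lra.
  - move=> z; apply: le_trans (NQ _ z (gr z)) _.
    rewrite ler_wpM2r ?mulr_ge0 ?exprn_ge0// /r2.
    by have := ler_norm r; lra.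
  exists (Cd * r2) => z; have z10 : 0 < 1 + normc z by rewrite ltr_pwDl// normc_ge0.
  rewrite /growth -(ler_pM2r z10) mulrAC.
  apply: le_trans (HCd z) _.
  by rewrite le_eqVlt; apply/orP; left; apply/eqP; rewrite /wt exprSr; ring.
have rq2 : 0 <= (2 + normc a) * K2 * rq by rewrite !mulr_ge0// addr_ge0// normc_ge0.
have [F1 F1E F1b] : exists2 F : Edual phi, (forall la, F (expE phi la) = g1 la) &
      forall (f : E) t, qle phi n1 f t ->
        normc (F f) <= C1 * ((2 + normc a) * K2 * rq) * t.
  apply: (H1 g1 r1) => //.
    by move=> z; exact: ccont_divide.
  move=> z; rewrite !inE !negb_or => /and3P[za z0 zs]; apply: holo_divide => //.
  by apply: holoD; [exact: hg|apply: holoZ; exact: hh].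
(* On e^(-i la x) the operator D is multiplication by - i la, so i F1 D - a F1 has transform (la -
   a) g1(la). D costs one index, hence n1.+1 above. *)
pose F (f : E) := c * H f + ('i%C * F1 (D f) + - a * F1 f).
have Fb (f : E) t : qle phi (maxn nH n1.+1) f t ->
    normc (F f) <= (K / normc (h a) * (CH * Ch) + (1 + normc a) * B1) * rq * t.
  move=> ft; have t0 := qle_ge0 ft.
  have fH := Hb f t (qle_mono nH0 (leq_maxl _ _) (lexx _) ft).
  have f2 := qle_mono (ltn0Sn n1) (leq_maxr nH _) (lexx _) ft.
  have f1 := F1b f t (qle_mono n10 (leqnSn _) (lexx _) f2).
  have fD := F1b (D f) t (Db _ _ _ n10 f2).
  have E1 : C1 * ((2 + normc a) * K2 * rq) * t = B1 * rq * t by rewrite /B1; ring.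
  rewrite E1 in f1 fD.
  apply: le_trans (normcD _ _) _; apply: le_trans (lerD (lexx _) (normcD _ _)) _.
  rewrite (normcM c) (normcM 'i%C) (normcM (- a)) normc_opp normc_i mul1r !mulrDl !addrA; apply: lerD; first apply: lerD.
  - apply: le_trans (_ : rq * (K / normc (h a)) * (CH * Ch * t) <= _).
      by apply: ler_pM; rewrite ?normc_ge0//.
    by rewrite le_eqVlt; apply/orP; left; apply/eqP; ring.
  - by rewrite mul1r.
  by apply: le_trans (ler_wpM2l (normc_ge0 a) f1) _; rewrite !mulrA.
have Flin (u v : R[i]) (f1 f2 : E) : F (u *: f1 + v *: f2) = u * F f1 + v * F f2.
  by rewrite /F Dlin !Edual_lin; move: (H _) (H _) (F1 _) (F1 _) (F1 _) (F1 _) => *; ring.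
have [F' F'E] := Edual_build (leq_trans nH0 (leq_maxl _ _)) Flin Fb.
exists F' => [la|f t ft]; last by rewrite F'E; exact: Fb.
rewrite F'E /F DE HE.
have -> : F1 ((- 'i%C * la) *: expE phi la) = (- 'i%C * la) * g1 la.
  have := Edual_lin F1 (- 'i%C * la) 0 (expE phi la) 0.
  by rewrite scaler0 !addr0 mul0r addr0 F1E.
rewrite F1E gE; congr (_ + _).
transitivity (- ('i%C ^+ 2) * la * g1 la - a * g1 la); first by ring.
by rewrite sqr_i; ring.
Qed.

Lemma transform_claimP j : transform_claim j.
Proof. by elim: j => [|j IH]; [exact: transform_claim0|exact: transform_step]. Qed.

(** Membership in Q(phi~_m) is growth of excess m + 3, and the threshold 0 makes the two bounds of
    the claim coincide. *)
Lemma transform_onto m : (0 < m)%N -> exists C n, [/\ 0 <= C, (0 < n)%N &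
  forall (g : R[i] -> R[i]) r, (forall z, holo g z) ->
    (forall z, normc (g z) <=
      r * ((1 + normc z) ^+ m * expR (legendre (phi m) (complex.Im z)))) ->
    exists2 F : Edual phi, (forall la, F (expE phi la) = g la) &
      forall (f : E) t, qle phi n f t -> normc (F f) <= C * r * t].
Proof.
move=> m0; have [C [n [C0 n0 H]]] := transform_claimP (m + 3) [::] m0 (lexx 0).
exists C, n; split => // g r hg gr.
have r0 : 0 <= r.
  by have := le_trans (normc_ge0 _) (gr 0); rewrite pmulr_lge0// Qweight_gt0.
have gg z : growth g (m + 3) m r z.
  rewrite /growth exprD; set X := (1 + normc z) ^+ 3.
  have X0 : 0 <= X by rewrite exprn_ge0// addr_ge0// normc_ge0.
  apply: le_trans (ler_wpM2r X0 (gr z)) _.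
  by rewrite le_eqVlt; apply/orP; left; apply/eqP; ring.
by apply: (H g r r) => // z; exact: holo_ccont.
Qed.

End transform_induction.

(** * Density of the exponentials *)

Section Bernstein.
Context {R : realType}.
Implicit Types (t x y : R) (u : nat -> R[i]) (b : nat -> R) (n k : nat).

(* The Bernstein operator of degree n, computed by de Casteljau's recursion. *)
Fixpoint bernstein n u t : R[i] :=
  if n is n'.+1 then (1 - t)%:C%C * bernstein n' u t +
    t%:C%C * bernstein n' (fun k => u k.+1) t else u 0%N.

Fixpoint bernsteinR n b t : R :=
  if n is n'.+1 then (1 - t) * bernsteinR n' b t +
    t * bernsteinR n' (fun k => b k.+1) t else b 0%N.

Lemma bernstein_dist n u b (c : R[i]) t : 0 <= t <= 1 ->
  (forall k, (k <= n)%N -> normc (u k - c) <= b k) ->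
  normc (bernstein n u t - c) <= bernsteinR n b t.
Proof.
move=> /andP[t0 t1]; elim: n u b => [|n IH] u b ub /=; first exact: ub.
have -> : (1 - t)%:C%C * bernstein n u t + t%:C%C * bernstein n (fun k => u k.+1) t - c =
  (1 - t)%:C%C * (bernstein n u t - c) +
  t%:C%C * (bernstein n (fun k => u k.+1) t - c) by rewrite rmorphB /=; ring.
apply: le_trans (normc_comb _ _ _ _) _.
rewrite !normc_real !ger0_norm ?subr_ge0//; apply: lerD; apply: ler_wpM2l.
- by rewrite subr_ge0.
- by apply: IH => k kn; apply: ub; exact: leqW.
- by [].
by apply: IH => k kn; apply: ub.
Qed.

(** The expectation of A + B (X - s)^2 for X binomial with parameters n and t: squared bias plus
    variance. *)
Lemma bernsteinR_quad n (A B s t : R) :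
  bernsteinR n (fun k => A + B * (k%:R - s) ^+ 2) t =
  A + B * ((n%:R * t - s) ^+ 2 + n%:R * t * (1 - t)).
Proof.
elim: n s => [|n IH] s /=; first by rewrite !mul0r addr0.
have -> : (fun k => A + B * (k.+1%:R - s) ^+ 2) =
          (fun k => A + B * (k%:R - (s - 1)) ^+ 2).
  by apply/funext => k; rewrite -natr1; congr (_ + _ * _ ^+ _); ring.
by rewrite !IH -natr1; ring.
Qed.

(** From y cos y <= sin y at y = x/2: sin x = 2 sin(x/2) cos(x/2) >= x cos(x/2)^2 = x (1 + cos x) /
    2. *)
Lemma sin_ge_half x : 0 <= x <= pi / 2 -> x / 2 <= sin x.
Proof.
have pi0 := pi_gt0 R; have xcos y : 0 <= y <= pi / 2 -> y * cos y <= sin y.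
  move=> /andP[y0 y1].
  have d1 (z : R) : is_derive z 1 (fun z => z * cos z) (cos z - z * sin z).
    have d := is_deriveM (is_derive_id z 1) (is_derive_cos z).
    by apply: is_derive_eq d _; rewrite /GRing.scale /=; ring.
  have := @increment_le R _ _ _ _ 0 y y0 (fun z _ => d1 z) (fun z _ => is_derive_sin z).
  rewrite sin0 mul0r !subr0 => H; apply: H => z /andP[z0 zy].
  by rewrite lerBlDr lerDl mulr_ge0// sin_ge0_pi//; lra.
move=> /andP[x0 x1]; have h : 0 <= x / 2 <= pi / 2 by lra.
have c0 : 0 <= cos (x / 2) by apply: cos_ge0_pihalf; lra.
have cx : 0 <= cos x by apply: cos_ge0_pihalf; lra.
have -> : sin x = sin (x / 2) * cos (x / 2) *+ 2.
  by rewrite {1}[x](splitr x) sinD; ring.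
have cE : cos x = cos (x / 2) ^+ 2 *+ 2 - 1.
  by rewrite {1}[x](splitr x) cosD; have := cos2Dsin2 (x / 2); lra.
have := ler_wpM2r c0 (xcos _ h); rewrite cE in cx; nra.
Qed.

(** sin y - sin x = 2 cos w sin v with v the half-difference and w the midpoint, and cos w >= sin v.
    A quadratic lower bound is what survives up to the endpoints, where the arcsine is not
    Lipschitz. *)
Lemma sin_dist x y : - (pi / 2) <= x -> x <= y -> y <= pi / 2 ->
  (y - x) ^+ 2 / 8 <= sin y - sin x.
Proof.
move=> x1 xy y1; have pi0 := pi_gt0 R.
pose v := (y - x) / 2; pose w := (y + x) / 2.
have v01 : 0 <= v <= pi / 2 by rewrite /v; lra.
have sv := sin_ge_half v01.
have -> : sin y - sin x = cos w * sin v *+ 2.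
  have -> : y = w + v by rewrite /w /v; field.
  have -> : x = w - v by rewrite /w /v; field.
  by rewrite sinB sinD; ring.
have cw : sin v <= cos w.
  pose p := (pi / 2 - v + w) / 2; pose r := (pi / 2 - v - w) / 2.
  have p1 : 0 <= p <= pi by rewrite /p /v /w; lra.
  have r1 : 0 <= r <= pi by rewrite /r /v /w; lra.
  have -> : sin v = cos (p + r).
    have -> : p + r = pi / 2 - v by rewrite /p /r; field.
    by rewrite cosB cos_pihalf sin_pihalf; ring.
  have -> : w = p - r by rewrite /p /r; field.
  have := mulr_ge0 (sin_ge0_pi p1) (sin_ge0_pi r1).
  by rewrite cosB cosD; lra.
have v0 : 0 <= v by case/andP: v01.
have -> : (y - x) ^+ 2 / 8 = (v / 2) ^+ 2 *+ 2 by rewrite /v; field.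
have : (v / 2) * (v / 2) <= cos w * sin v.
  by apply: ler_pM => //; [lra|lra|exact: le_trans cw].
by rewrite expr2; lra.
Qed.

End Bernstein.

Section exponential_span.
Context {R : realType} (phi : weight_family R).
Local Notation E := (Espace phi).
Implicit Types (f p : E) (c la mu : R[i]) (K k x y : R) (n N a : nat).

(* |exp(-i la x)| = exp(x Im la) *)
Inductive espan K : E -> Prop :=
| espan0 : espan K 0
| espan_cons c la p : complex.Im la <= K -> espan K p ->
    espan K (c *: expE phi la + p).

Lemma espan_exp K c la : complex.Im la <= K -> espan K (c *: expE phi la).
Proof. by move=> laK; rewrite -[_ *: _]addr0; apply: espan_cons => //; exact: espan0. Qed.

Lemma espanD K p q : espan K p -> espan K q -> espan K (p + q).
Proof.
move=> + hq; elim=> [|c la p' laK _ IH]; first by rewrite add0r.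
by rewrite -addrA; exact: espan_cons.
Qed.

Lemma espanZ K c p : espan K p -> espan K (c *: p).
Proof.
elim=> [|d la q laK _ IH]; first by rewrite scaler0; exact: espan0.
by rewrite scalerDr scalerA; exact: espan_cons.
Qed.

Lemma espan_vanish K p (F : Edual phi) :
  (forall la, F (expE phi la) = 0) -> espan K p -> F p = 0.
Proof.
move=> F0; have FL f g c : F (c *: f + g) = c * F f + F g.
  by have := Edual_lin F c 1 f g; rewrite scale1r mul1r.
elim=> [|c la q _ _ IH]; last by rewrite FL F0 IH mulr0 addr0.
by have := Edual_lin F 0 0 0 0; rewrite !scaler0 addr0 !mul0r addr0.
Qed.

Lemma expE_mul la mu x : expE phi la x * expE phi mu x = expE phi (la + mu) x.
Proof. by rewrite /= -cexpD; congr cexp; ring. Qed.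

Lemma espan_mulexp p mu : complex.Im mu <= 0 -> espan 0 p ->
  exists2 q, espan 0 q & forall x, q x = expE phi mu x * p x.
Proof.
move=> mu0; elim=> [|c la p' la0 _ [q' hq qE]].
  exists 0; [exact: espan0|by move=> x; rewrite -[(0 : E) x]/(0 : R[i]) mulr0].
exists (c *: expE phi (la + mu) + q').
  by apply: espan_cons => //; rewrite Im_add; lra.
move=> x; rewrite -[LHS]/(c * expE phi (la + mu) x + q' x).
rewrite -[(_ + _ : E) x]/(c * expE phi la x + p' x) -expE_mul qE; ring.
Qed.

(** The sine is a combination of exponentials of frequencies k and -k, which are real, so the bound
    0 on the imaginary parts is kept. *)
Lemma espan_mulsin p k : espan 0 p ->
  exists2 q, espan 0 q & forall x, q x = ((1 + sin (x * k)) / 2)%:C%C * p x.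
Proof.
move=> hp.
have [||q1 h1 q1E] := @espan_mulexp p (- k%:C%C) => //; first by rewrite Im_opp /= oppr0.
have [||q2 h2 q2E] := @espan_mulexp p k%:C%C => //.
exists ((1 / 2) *: p + ((- 'i%C / 4) *: q1 + ('i%C / 4) *: q2)).
  by apply: espanD; [|apply: espanD]; apply: espanZ.
move=> x; rewrite -[LHS]/(1 / 2 * p x + (- 'i%C / 4 * q1 x + 'i%C / 4 * q2 x)).
rewrite q1E q2E /=.
have -> : - 'i%C * - k%:C%C * x%:C%C = (0 +i* (x * k))%C :> R[i].
  by apply: complexP => /=; ring.
have -> : - 'i%C * k%:C%C * x%:C%C = (0 +i* - (x * k))%C :> R[i].
  by apply: complexP => /=; ring.
rewrite /cexp /= expR0 !mul1r cosN sinN.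
set C := cos _; set S := sin _.
have -> : (C +i* S)%C = C%:C%C + 'i%C * S%:C%C :> R[i].
  by apply: complexP => /=; ring.
have -> : (C +i* - S)%C = C%:C%C - 'i%C * S%:C%C :> R[i].
  by apply: complexP => /=; ring.
transitivity ((1 / 2 + - 'i%C ^+ 2 * S%:C%C / 2) * p x); first by field.
by rewrite sqr_i rmorphM rmorphD fmorphV rmorph_nat /= ; field.
Qed.

Lemma espan_bernstein n (u : nat -> R[i]) k :
  exists2 p, espan 0 p & forall x, p x = bernstein n u ((1 + sin (x * k)) / 2).
Proof.
elim: n u => [|n IH] u /=.
  exists (u 0%N *: expE phi 0); first by apply: espan_exp.
  by move=> x; rewrite -[LHS]/(u 0%N * expE phi 0 x) /= mulr0 mul0r cexp0 mulr1.
have [p1 h1 p1E] := IH u; have [p2 h2 p2E] := IH (fun i => u i.+1).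
have [q1 hq1 q1E] := espan_mulsin k h1; have [q2 hq2 q2E] := espan_mulsin k h2.
exists (p1 + ((-1) *: q1 + q2)).
  by apply: espanD => //; apply: espanD => //; exact: espanZ.
move=> x; rewrite -[LHS]/(p1 x + (-1 * q1 x + q2 x)) q1E q2E p1E p2E.
by rewrite rmorphB /=; ring.
Qed.

(* Bernstein polynomials in (1 + sin (x / P)) / 2. *)
Lemma trig_approx (h : R -> R[i]) (L M P A : R) : 0 < P -> 0 < A ->
  (forall x y, normc (h x - h y) <= L * `|x - y|) ->
  (forall x, normc (h x) <= M) ->
  exists p, [/\ espan 0 p, forall x, `|x| <= P -> normc (p x - h x) <= 2 * A &
    forall x, normc (p x) <= M].
Proof.
move=> P0 A0 hL hM; have pi0 := pi_gt0 R.
have L0 : 0 <= L.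
  by have := le_trans (normc_ge0 _) (hL 1 0); rewrite subr0 normr1 mulr1.
(* For e = L P d, where d is the distance between asin s and x / P, one has e <= A + e^4 / A^3.
   [sin_dist] gives d^4 <= 64 times the squared difference of the sines, and that square is 4 / n^2
   times (k - n t)^2; hence 256. *)
pose B := (L * P) ^+ 4 * 256 / A ^+ 3.
have LP0 : 0 <= L * P by rewrite mulr_ge0// ltW.
have A30 : 0 <= A ^+ 3 by rewrite exprn_ge0// ltW.
have B0 : 0 <= B.
  apply: divr_ge0; last exact: A30.
  apply: mulr_ge0; first exact: exprn_ge0.
 exact: ler0n.
pose n := (Num.truncn (B / A)).+1.
have n0 : 0 < n%:R :> R by rewrite ltr0n.
have nB : B / n%:R <= A.
  by rewrite ler_pdivrMr// mulrC -ler_pdivrMr//; apply/ltW/truncnS_gt.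
(* The node where (1 + sin(x / P)) / 2 equals k / n. *)
pose xi (k : nat) := P * asin (2 * k%:R / n%:R - 1).
have [p hp pE] := espan_bernstein n (fun k : nat => h (xi k)) P^-1.
pose t x := (1 + sin (x / P)) / 2.
have t01 x : 0 <= t x <= 1.
  by rewrite /t; have := sin_geN1 (x / P); have := sin_le1 (x / P); lra.
exists p; split => // [x xP|x]; last first.
  rewrite pE; have := @bernstein_dist _ n (fun k : nat => h (xi k)) (fun=> M) 0 _ (t01 x).
  have -> : bernsteinR n (fun=> M) (t x) = M.
    have := bernsteinR_quad n M 0 0 (t x); rewrite mul0r addr0 => {2}<-.
    by congr bernsteinR; apply/funext => k; rewrite mul0r addr0.
  by rewrite subr0; apply => k _; rewrite subr0.
rewrite pE -/(t x).
pose b (k : nat) := A + B / n%:R ^+ 2 * (k%:R - n%:R * t x) ^+ 2.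
apply: le_trans (@bernstein_dist _ n (fun k : nat => h (xi k)) b (h x) _ (t01 x) _) _.
  move=> k kn; rewrite /b; set s : R := 2 * k%:R / n%:R - 1.
  have s1 : -1 <= s <= 1.
    have k1 : k%:R / n%:R <= 1 :> R by rewrite ler_pdivrMr// mul1r ler_nat.
    have k2 : 0 <= k%:R / n%:R :> R by rewrite divr_ge0.
    by rewrite /s -mulrA; lra.
  have [/andP[a1 a2] aE] := asin_def s1.
  have tE : (k%:R - n%:R * t x) = n%:R / 2 * (sin (asin s) - sin (x / P)).
    by rewrite aE /s /t; field; rewrite gt_eqF.
  have xp : - (pi / 2) <= x / P <= pi / 2.
    have : `|x / P| <= 1 by rewrite normrM normfV (gtr0_norm P0) ler_pdivrMr// mul1r.
    by rewrite ler_norml; have := pi_ge2 R; lra.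
  have sd : (asin s - x / P) ^+ 2 / 8 <= `|sin (asin s) - sin (x / P)|.
    case/andP: xp => xp1 xp2; have [le|/ltW le] := leP (x / P) (asin s).
      by apply: le_trans (ler_norm _); exact: sin_dist.
    rewrite distrC -sqrrN opprB; apply: le_trans (ler_norm _); exact: sin_dist.
  apply: le_trans (hL _ _) _.
  have -> : xi k - x = P * (asin s - x / P) by rewrite /xi -/s; field; rewrite gt_eqF.
  rewrite normrM (gtr0_norm P0) tE exprMn.
  have -> : B / n%:R ^+ 2 * ((n%:R / 2) ^+ 2 * (sin (asin s) - sin (x / P)) ^+ 2) =
     (L * P) ^+ 4 * 64 / A ^+ 3 * (sin (asin s) - sin (x / P)) ^+ 2.
    by rewrite /B; field; rewrite !gt_eqF.
  set d := `|asin s - x / P|; have d0 : 0 <= d by exact: normr_ge0.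
  have sd2 : (d ^+ 2 / 8) ^+ 2 <= (sin (asin s) - sin (x / P)) ^+ 2.
    rewrite -[leRHS]real_normK ?num_real// lerXn2r// ?nnegrE.
      by rewrite divr_ge0// exprn_ge0.
    by rewrite /d real_normK ?num_real.
  have C0 : 0 <= (L * P) ^+ 4 * 64 / A ^+ 3.
    by rewrite divr_ge0// mulr_ge0// exprn_ge0.
  have := ler_wpM2l C0 sd2.
  have -> : (L * P) ^+ 4 * 64 / A ^+ 3 * (d ^+ 2 / 8) ^+ 2 = (L * (P * d)) ^+ 4 / A ^+ 3.
    by field; rewrite gt_eqF.
  set e := L * (P * d); have e0 : 0 <= e by rewrite mulr_ge0// mulr_ge0// ltW.
  suff : e <= A + e ^+ 4 / A ^+ 3 by lra.
  have [eA|Ae] := leP e A.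
    by apply: le_trans eA _; rewrite lerDl divr_ge0 ?exprn_ge0// ltW.
  apply: le_trans (_ : e ^+ 4 / A ^+ 3 <= _); last by rewrite lerDr ltW.
  rewrite ler_pdivlMr ?exprn_gt0// [e ^+ 4]exprS ler_wpM2l// lerXn2r// ?nnegrE ltW//.
(* Only the variance n t (1 - t) remains, so the quadratic term contributes at most B / n <= A. *)
rewrite /b bernsteinR_quad subrr expr0n add0r.
have -> : B / n%:R ^+ 2 * (n%:R * t x * (1 - t x)) = B / n%:R * (t x * (1 - t x)).
  by field; rewrite gt_eqF.
have : t x * (1 - t x) <= 1 by have := t01 x; nra.
have : 0 <= t x * (1 - t x) by have := t01 x; nra.
have : 0 <= B / n%:R by rewrite divr_ge0.
nra.
Qed.

End exponential_span.

Section density.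
Context {R : realType} (phi : weight_family R).
Local Notation E := (Espace phi).
Implicit Types (f p : E) (x y : R) (N n a : nat).

Definition clip (r x : R) := Num.min (Num.max x (- r)) r.

Lemma clip_le r x : 0 <= r -> `|clip r x| <= r.
Proof.
move=> r0; rewrite /clip ler_norml ge_min lexx orbT andbT.
by rewrite le_min le_max lexx orbT /=; lra.
Qed.

Lemma clip_id r x : `|x| <= r -> clip r x = x.
Proof.
by rewrite ler_norml => /andP[x1 x2]; rewrite /clip max_l// min_l.
Qed.

Lemma clip_lipschitz r x y : 0 <= r -> `|clip r x - clip r y| <= `|x - y|.
Proof.
move=> r0; have rr : - r <= r by lra.
wlog xy : x y / x <= y => [H|].
  have [/H//|/ltW/H h] := leP x y.
  by rewrite distrC [leRHS]distrC.
rewrite ler_norml -[`|x - y|]distrC (ger0_norm (_ : 0 <= y - x)) ?subr_ge0//.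
rewrite /clip /Num.min /Num.max.
by case: (ltP x (- r)) => hx /=; case: (ltP y (- r)) => hy /=;
  repeat (case: ifPn; rewrite -?leNgt => ?); lra.
Qed.

Lemma clip_far r x : 0 <= r -> r < `|x| ->
  `|clip r x| = r /\ (0 <= clip r x <= x \/ x <= clip r x <= 0).
Proof.
move=> r0; rewrite /clip /Num.min /Num.max; case: (ger0P x) => x0 rx.
  have -> : (x < - r) = false by lra.
  by rewrite ltNge (ltW rx) /= ger0_norm//; split => //; left; lra.
have -> : x < - r by lra.
case: ifPn; rewrite -?leNgt => hr; rewrite ?normrN ger0_norm//; split => //; right; lra.
Qed.

(** f is frozen outside [-r, r] into a bounded Lipschitz h, and p approximates h on [-P, P] while
    keeping its bound M everywhere. Between r and P both f and h are small against the weight;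
    beyond P the weight exceeds M. *)
Lemma exp_dense0 f N (d : R) : (0 < N)%N -> 0 < d ->
  exists2 p : E, espan 0 p & forall x, normc (f x - p x) <= d * expR (phi N x).
Proof.
move=> N0 d0.
have [c c0 Hc] := weight_monotone phi 0 N0.
have [q q0 Hq] := weight_lower phi N0.
have [K K0 HK] := weight_growth phi 1 N0.
have [C C0 HC] := Eqle f (ltn0Sn N).
have mono x y : 0 <= y <= x \/ x <= y <= 0 -> expR (phi N y) <= expR c * expR (phi N x).
  by move=> /Hc; rewrite -expRD ler_expR !mul0r !subr0 addrC.
have ec1 : 1 <= expR c by rewrite -expR0 ler_expR.
have fa a x : (a <= 1)%N -> normc (cderiv f a x) * (1 + `|x|) <= C * expR (phi N x).
  move=> a1; have x1 : 0 <= 1 + `|x| by rewrite addr_ge0.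
  apply: le_trans (ler_wpM2r x1 (HC a x (leq_trans a1 (ltn0Sn N)))) _.
  by rewrite -mulrA ler_wpM2l// mulrC expR_weight_gap.
have fx x : normc (f x) * (1 + `|x|) <= C * expR (phi N x).
  by rewrite -cderiv0E fa.
have fa1 a x : (a <= 1)%N -> normc (cderiv f a x) <= C * expR (phi N x).
  move=> a1; apply: le_trans (fa a x a1).
  by rewrite ler_peMr ?normc_ge0// lerDl.
(* Beyond r the index gap makes |f| smaller than the weight by the factor d / 4, with room for expR
   c, which later compares the weight at r or -r with the weight at x. *)
pose r := C * expR c / (d / 4).
have d4 : 0 < d / 4 by rewrite divr_gt0.
have r0 : 0 <= r by rewrite divr_ge0 ?mulr_ge0 ?expR_ge0// ltW.
have small x : r <= `|x| -> normc (f x) * expR c <= d / 4 * expR (phi N x).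
  move=> rx; have x1 : 0 < 1 + `|x| by rewrite ltr_pwDl.
  rewrite -(ler_pM2r x1) mulrAC; apply: le_trans (_ : C * expR (phi N x) * expR c <= _).
    by rewrite ler_wpM2r ?expR_ge0.
  rewrite mulrAC [leRHS]mulrAC ler_wpM2r ?expR_ge0//.
  rewrite [leRHS]mulrC -ler_pdivrMr//.
  by apply: le_trans rx _; rewrite lerDr.
pose M := C * (expR c * (expR (phi N r) + expR (phi N (- r)))).
have Mb a x : (a <= 1)%N -> `|x| <= r -> normc (cderiv f a x) <= M.
  move=> a1 xr; apply: le_trans (fa1 a x a1) _; rewrite ler_wpM2l//.
  have e1 := expR_ge0 (phi N r); have e2 := expR_ge0 (phi N (- r)).
  case: (ger0P x) xr => x0 xr.
    apply: le_trans (mono r x _) _; first by left; rewrite x0.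
    by rewrite ler_wpM2l ?expR_ge0// lerDl.
  apply: le_trans (mono (- r) x _) _; first by right; lra.
  by rewrite ler_wpM2l ?expR_ge0// lerDr.
have M0 : 0 <= M by rewrite !mulr_ge0 ?addr_ge0 ?expR_ge0.
(* For |x| > P one has exp(phi_N(x)) >= exp(|x| - K) >= |x| - K >= M / (d / 4). *)
pose P := r + K + 1 + M / (d / 4).
have Md0 : 0 <= M / (d / 4) by rewrite divr_ge0// ltW.
have P0 : 0 < P by rewrite /P; lra.
pose A := Num.min (d / 4) (d / 8 * q).
have A0 : 0 < A by rewrite lt_min d4 mulr_gt0// divr_gt0.
have A8 : 2 * A <= d / 4 * q.
  have : A <= d / 8 * q by rewrite ge_min lexx orbT.
  lra.
pose h x := f (clip r x).
have hL x y : normc (h x - h y) <= (2 * M) * `|x - y|.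
  wlog xy : x y / clip r y <= clip r x => [H|].
    have [/H//|/ltW/H {}H] := leP (clip r y) (clip r x).
    by rewrite normc_dist distrC.
  apply: le_trans (_ : 2 * M * (clip r x - clip r y) <= _).
    rewrite /h -(cderiv0E f (clip r x)) -(cderiv0E f (clip r y)); apply: (cder_norm (f := cderiv f 0) xy (fun z _ => Ecder f 0 z)).
    move=> z /andP[z1 z2]; apply: Mb => //.
    have := clip_le x r0; have := clip_le y r0; rewrite !ler_norml; lra.
  rewrite ler_wpM2l ?mulr_ge0//; apply: le_trans (ler_norm _) _.
  exact: clip_lipschitz.
have hM x : normc (h x) <= M by rewrite /h -(cderiv0E f (clip r x)); apply: Mb => //; exact: clip_le.
have [p [hp pP pM]] := trig_approx phi P0 A0 hL hM.
exists p => // x; have qx := Hq x; have e0 := expR_ge0 (phi N x).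
have A8x : 2 * A <= d / 4 * expR (phi N x).
  by apply: le_trans A8 _; rewrite ler_pM2l.
have [xr|rx] := leP `|x| r.
  have := pP x; rewrite /h clip_id// normc_dist => /(_ _)/le_trans; apply.
    by rewrite /P; lra.
  by apply: le_trans A8x _; rewrite ler_wpM2r//; lra.
have fs : normc (f x) <= d / 4 * expR (phi N x).
  apply: le_trans (small x (ltW rx)); rewrite ler_peMr ?normc_ge0//.
have [xP|Px] := leP `|x| P.
  have [cr cx] := clip_far r0 rx.
  have hs : normc (h x) <= d / 4 * expR (phi N x).
    have := small (clip r x); rewrite cr lexx => /(_ isT) sm.
    have ec0 : 0 < expR c by exact: expR_gt0.
    rewrite -(ler_pM2r ec0); apply: le_trans sm _.
    rewrite -[leRHS]mulrA; apply: ler_wpM2l; first exact: ltW.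
    by rewrite mulrC mono.
  have -> : f x - p x = f x - (h x + (p x - h x)) by ring.
  apply: le_trans (normcB _ _) _; apply: le_trans (lerD (lexx _) (normcD _ _)) _.
  have := pP x xP; have := mulr_ge0 (ltW d4) e0; lra.
apply: le_trans (normcB _ _) _.
suff : M <= d / 4 * expR (phi N x).
  by have := pM x; have := mulr_ge0 (ltW d4) e0; lra.
rewrite [leRHS]mulrC -ler_pdivrMr//.
apply: le_trans (_ : `|x| - K <= _); first by rewrite /P in Px; lra.
apply: le_trans (_ : expR (`|x| - K) <= _); first by have := expR_ge1Dx (`|x| - K); lra.
by rewrite ler_expR; have := HK x; lra.
Qed.

(** The number n of derivatives and the weight index N vary independently, because each step of the
    induction uses the previous one at index N + 1. It also introduces frequencies of imaginary part
    n + 1, whence the span. *)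
Definition dense_to n := forall f N (d : R), (0 < N)%N -> 0 < d ->
  exists2 p : E, espan n%:R p &
    forall a x, (a <= n)%N -> normc (cderiv (f - p) a x) <= d * expR (phi N x).

Lemma dense_to0 : dense_to 0.
Proof.
move=> f N d N0 d0; have [p hp pf] := exp_dense0 f N0 d0; exists p => //.
by move=> a x; rewrite leqn0 => /eqP ->; rewrite cderiv0E; exact: pf.
Qed.

(** D - k multiplies e^(-i la x) by - i la - k, whose real part Im la - k is negative. *)
Lemma espan_solve (K k : R) (D : E -> E) p1 :
  (forall s t f g, D (s *: f + t *: g) = s *: D f + t *: D g) ->
  (forall la, D (expE phi la) = (- 'i%C * la) *: expE phi la) ->
  K < k -> espan K p1 -> exists2 p : E, espan k p & D p - k%:C%C *: p = p1.
Proof.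
move=> Dlin DE Kk; have D0 : D 0 = 0.
  by have := Dlin 0 0 0 0; rewrite !scaler0 addr0 !scale0r addr0.
elim=> [|c la p laK _ [q hq qE]].
  by exists 0; [exact: espan0|rewrite D0 scaler0 subr0].
have nz : - 'i%C * la - k%:C%C != 0.
  rewrite eq_complex negb_and; apply/orP; left.
  have -> : complex.Re (- 'i%C * la - k%:C%C) = complex.Im la - k.
    by case: la {laK} => u v /=; ring.
  by rewrite subr_eq0 lt_eqF// (le_lt_trans laK).
pose c' := c / (- 'i%C * la - k%:C%C).
exists (c' *: expE phi la + 1 *: q).
  by rewrite scale1r; apply: espan_cons => //; exact: ltW (le_lt_trans laK Kk).
rewrite Dlin DE !scale1r scalerDr opprD addrACA qE; congr (_ + _).
by rewrite !scalerA -scalerBl /c'; congr (_ *: _); field.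
Qed.

(** The error v = f - p solves v' - k v = w with w small and v(0) = 0. Integrating (e^(-kx) v)' =
    e^(-kx) w from 0 bounds v, and v' = k v + w then bounds the derivatives one after another. *)
Lemma dense_toS n : dense_to n -> dense_to n.+1.
Proof.
move=> IH f N d N0 d0; have [D [DD Dlin _ DE]] := Ederiv_op phi.
pose k : R := n.+1%:R; have nk : n%:R < k by rewrite ltr_nat.
have k0 : 0 <= k by exact: ler0n.
have [C C0 HC] := weight_monotone phi k (ltn0Sn N).
pose X := 2 * expR C + 1; have eC := expR_ge0 C.
have X1 : 1 <= X by rewrite /X; lra.
have Xk0 : 0 < X * (k + 1) ^+ n.+1 by rewrite mulr_gt0 ?exprn_gt0//; lra.
pose e := d / (X * (k + 1) ^+ n.+1); have e0 : 0 < e by rewrite divr_gt0.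
have [p1 hp1 Hp1] := IH (D f - k%:C%C *: f) N.+1 e (ltn0Sn N) e0.
have [p2 hp2 p2E] := espan_solve Dlin DE nk hp1.
have i_k : - 'i%C * (0 +i* k)%C = k%:C%C :> R[i] by apply: complexP => /=; ring.
(* The homogeneous solution e^(kx) adjusts the value at 0. *)
pose p := p2 + (f 0 - p2 0) *: expE phi (0 +i* k)%C.
have hp : espan k p by apply: espanD => //; exact: espan_exp.
have pE : D p - k%:C%C *: p = p1.
  have := Dlin 1 (f 0 - p2 0) p2 (expE phi (0 +i* k)%C).
  rewrite !scale1r /p => ->; rewrite DE i_k scalerDr opprD addrACA p2E.
  by rewrite !scalerA [_ * k%:C%C]mulrC subrr addr0.
have DkE g a x : cderiv (D g - k%:C%C *: g) a x = cderiv g a.+1 x - k%:C%C * cderiv g a x.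
  by rewrite Ecderiv_sub Ecderiv_scale DD.
exists p => //; set v := f - p.
pose w := (D f - k%:C%C *: f) - p1.
have wE a x : cderiv w a x = cderiv v a.+1 x - k%:C%C * cderiv v a x.
  rewrite /w -pE Ecderiv_sub !DkE /v !(Ecderiv_sub f p).
  by move: (cderiv f _ x) (cderiv f _ x) (cderiv p _ x) (cderiv p _ x) => *; ring.
have v0 : v 0 = 0.
  rewrite /v -[LHS]/(f 0 - (p2 0 + (f 0 - p2 0) * expE phi (0 +i* k)%C 0)).
  by rewrite /= mulr0 cexp0 mulr1; ring.
have vx x : normc (v x) <= X * e * expR (phi N x).
  pose V y := cexp ((- k)%:C%C * y%:C%C) * cderiv v 0 y.
  pose V' y := cexp ((- k)%:C%C * y%:C%C) * cderiv w 0 y.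
  have dV y : cder V y (V' y).
    apply: cder_eq (cderM (cder_exp (cder_mulx _ y)) (Ecder v 0 y)) _.
    by rewrite /V' wE rmorphN; ring.
  have nE y : normc (cexp ((- k)%:C%C * y%:C%C) : R[i]) = expR (- (k * y)).
    by rewrite normc_cexp /=; congr expR; ring.
  (* By [weight_monotone] with slope k, the weight e^(-ky) exp(phi_{N+1}(y)) on the segment from 0
     to x is governed by its value at x. *)
  pose M := e * expR (phi N.+1 x - k * x + C).
  have V'b y : 0 <= y <= x \/ x <= y <= 0 -> normc (V' y) <= M.
    move=> yx; rewrite /V' normcM nE; apply: le_trans
      (ler_wpM2l (expR_ge0 _) (Hp1 0%N y (leq0n n))) _.
    rewrite mulrCA -expRD ler_pM2l// ler_expR addrC; exact: HC.
  have VM : normc (V x) <= 2 * M * `|x|.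
    have V0 : V 0 = 0 by rewrite /V cderiv0E v0 mulr0.
    case: (ger0P x) => x0.
      have := cder_norm x0 (fun y _ => dV y) (fun y yx => V'b y (or_introl yx)).
      by rewrite V0 !subr0.
    have := cder_norm (ltW x0) (fun y _ => dV y) (fun y yx => V'b y (or_intror yx)).
    by rewrite V0 !sub0r normc_opp.
  rewrite /V normcM nE cderiv0E in VM.
  have -> : normc (v x) = expR (k * x) * (expR (- (k * x)) * normc (v x)).
    by rewrite mulrA -expRD subrr expR0 mul1r.
  apply: le_trans (ler_wpM2l (expR_ge0 (k * x)) VM) _.
  have -> : expR (k * x) * (2 * M * `|x|) =
     2 * expR C * e * (`|x| * expR (phi N.+1 x)).
    rewrite /M; have -> : expR (phi N.+1 x) = expR (k * x) * expR (phi N.+1 x - k * x).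
      by rewrite -expRD; congr expR; ring.
    by rewrite [expR (_ + C)]expRD; ring.
  apply: ler_pM; [| | |].
  - by apply: mulr_ge0; [apply: mulr_ge0|exact: ltW].
  - by rewrite mulr_ge0 ?expR_ge0.
  - by rewrite ler_wpM2r ?(ltW e0)// /X lerDl.
  apply: le_trans (expR_weight_gap phi x N0); rewrite ler_wpM2r ?expR_ge0//.
  by rewrite lerDr.
have vax a x : (a <= n.+1)%N ->
    normc (cderiv v a x) <= X * (k + 1) ^+ a * e * expR (phi N x).
  elim: a => [|a IHa] an; first by rewrite expr0 mulr1 cderiv0E.
  have -> : cderiv v a.+1 x = cderiv w a x + k%:C%C * cderiv v a x by rewrite wE; ring.
  apply: le_trans (normcD _ _) _; rewrite normcM normc_real ger0_norm//.
  have h1 := ler_wpM2l k0 (IHa (ltnW an)).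
  have h2 : normc (cderiv w a x) <= e * expR (phi N x).
    apply: le_trans (Hp1 a x an) _; rewrite ler_pM2l// ler_expR.
    exact: weight_le.
  have ka : 1 <= (k + 1) ^+ a by apply: exprn_ege1; lra.
  have eE : 0 <= e * expR (phi N x) by rewrite mulr_ge0 ?expR_ge0// ltW.
  have : e * expR (phi N x) <= X * (k + 1) ^+ a * (e * expR (phi N x)).
    by rewrite ler_peMl// (le_trans X1)// ler_peMr//; lra.
  rewrite exprS; move: ((k + 1) ^+ a) h1 => z h1; lra.
move=> a x an; apply: le_trans (vax a x an) _; rewrite ler_wpM2r ?expR_ge0//.
rewrite /e mulrA ler_pdivrMr// mulrC ler_wpM2l ?(ltW d0)//.
rewrite ler_pM2l; last by lra.
by apply: ler_weXn2l => //; lra.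
Qed.

Lemma dense_toP n : dense_to n.
Proof. by elim: n => [|n IH]; [exact: dense_to0|exact: dense_toS]. Qed.

Lemma Fourier_Laplace_injective (F : Edual phi) :
  (forall la, F (expE phi la) = 0) -> forall f, F f = 0.
Proof.
move=> F0 f; have [n n0 [C C0 HF]] := Edual_bound F.
apply/eqP; rewrite -normc_eq0; apply/eqP/le_anti; rewrite normc_ge0 andbT.
apply/ler_addgt0Pr => e e0; rewrite add0r.
have C1 : 0 < C + 1 by rewrite ltr_wpDl.
have [p hp Hp] := @dense_toP n f n (e / (C + 1)) n0 (divr_gt0 e0 C1).
have -> : F f = F (f - p).
  have := Edual_lin F 1 (-1) f p.
  by rewrite scale1r scaleN1r (espan_vanish F0 hp) mulr0 addr0 mul1r.
apply: le_trans (HF _ _ Hp) _; rewrite mulrA ler_pdivrMr// mulrC.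
by rewrite ler_wpM2l ?(ltW e0)// lerDl.
Qed.

End density.

(** * Continuity *)

Section Hahn_Banach.
Context {R : realType} (V : lmodType R[i]).
Implicit Types (p q f : V -> R) (x y z : V) (r t : R).

Definition sublinear p := (forall x y, p (x + y) <= p x + p y) /\
  (forall r x, 0 < r -> p (r%:C%C *: x) <= r * p x).

Definition rlinear f := (forall x y, f (x + y) = f x + f y) /\
  (forall r x, f (r%:C%C *: x) = r * f x).

Lemma sublinear0 p : sublinear p -> p 0 = 0.
Proof.
move=> [pD pZ]; have := pD 0 0; have := pZ (1 / 2) 0; rewrite scaler0 addr0.
by move=> /(_ _)h1 h2; apply/eqP; rewrite eq_le; have := h1 ltac:(lra); lra.
Qed.

Lemma sublinearZ p r x : sublinear p -> 0 < r -> p (r%:C%C *: x) = r * p x.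
Proof.
move=> [pD pZ] r0; apply/eqP; rewrite eq_le pZ//=.
have r1 : 0 < r^-1 by rewrite invr_gt0.
have := pZ r^-1 (r%:C%C *: x) r1.
rewrite scalerA -rmorphM mulVf ?gt_eqF// scale1r.
by rewrite ler_pdivlMl.
Qed.

Lemma sublinear_ge p x : sublinear p -> - p (- x) <= p x.
Proof. by move=> sp; have := sp.1 x (- x); rewrite subrr sublinear0//; lra. Qed.

Lemma rlinearN f x : rlinear f -> f (- x) = - f x.
Proof.
move=> [_ fZ]; have := fZ (-1) x.
by rewrite rmorphN /= scaleN1r mulN1r.
Qed.

(** The members h t need not be sublinear; the family only has to be closed under sums and scalings.
    It serves for chains in Zorn's lemma, for the infimum over translates, and for an infimal
    convolution. *)
Let inf_sublinear (T : Type) (A : set T) (h : T -> V -> R) (b : V -> R) (t0 : T) :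
  A t0 -> (forall (t : T) x, A t -> b x <= h t x) ->
  (forall s t : T, A s -> A t -> exists2 u, A u &
    forall x y, h u (x + y) <= h s x + h t y) ->
  (forall r (t : T), 0 < r -> A t -> exists2 u, A u & forall x, h u (r%:C%C *: x) <= r * h t x) ->
  sublinear (fun x => inf [set h i x | i in A]) /\
  forall (t : T) x, A t -> inf [set h i x | i in A] <= h t x.
Proof.
move=> At0 hb hD hZ.
have lb x : has_lbound [set h i x | i in A] by exists (b x) => _ [t At <-]; exact: hb.
have ne x : [set h i x | i in A] !=set0 by exists (h t0 x), t0.
have le (t : T) x : A t -> inf [set h i x | i in A] <= h t x.
  by move=> At; apply: ge_inf => //; exists t.
split=> //; split=> [x y|r x r0].
  apply/ler_addgt0Pr => e e0; have e2 : 0 < e / 2 by rewrite divr_gt0.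
  have [_ [s As <-] hs] := inf_adherent e2 (conj (ne x) (lb x)).
  have [_ [t At <-] ht] := inf_adherent e2 (conj (ne y) (lb y)).
  have [u Au /(_ x y) hu] := hD s t As At.
  by apply: le_trans (le u _ Au) _; lra.
rewrite -ler_pdivrMl//; apply: lb_le_inf => // _ [t At <-].
have [u Au hu] := hZ r t r0 At.
by rewrite ler_pdivrMl//; apply: le_trans (le u _ Au) _.
Qed.

(* A minimal sublinear functional is linear: it is not changed by the infimum of
   x |-> q (x + t y) - t q y over t >= 0, so that q (- y) <= - q y. *)
Lemma sublinear_linear p : sublinear p ->
  exists2 f, rlinear f & forall x, f x <= p x.
Proof.
move=> sp; pose below (q : V -> R) := sublinear q /\ forall x, q x <= p x.
pose T := {q : V -> R | below q}.
(* The order is reversed: a maximal element for [Rel] is a minimal sublinear functional. *)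
pose Rel (s t : T) := `[< forall x, sval t x <= sval s x >].
have [||||[q [sq qp]] qmin] := @Zorn T Rel.
- by move=> t; apply/asboolP.
- by move=> r s t /asboolP rs /asboolP st; apply/asboolP => x; exact: le_trans (st x) (rs x).
- move=> [s hs] [t ht] /asboolP st /asboolP ts; apply: eq_exist.
  by apply/funext => x; apply: le_anti; rewrite st ts.
- move=> A tot; have [[t0 At0]|A0] := pselect (A !=set0); last first.
    exists (exist below p (conj sp (fun=> lexx _))) => s As.
    by exfalso; apply: A0; exists s.
  have [|||sq ql] := @inf_sublinear T A (fun i => sval i) (fun x => - p (- x)) t0 At0.
  + move=> [t [st tp]] x _ /=; apply: le_trans (sublinear_ge x st).
    by rewrite lerN2.
  + move=> s t As At; have [/asboolP st|/asboolP ts] := tot s t As At.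
      exists t => // x y; apply: le_trans ((svalP t).1.1 x y) _.
      by rewrite lerD2r.
    exists s => // x y; apply: le_trans ((svalP s).1.1 x y) _.
    by rewrite lerD2l.
  + by move=> r t r0 At; exists t => // x; exact: (svalP t).1.2.
  have qp x : inf [set sval i x | i in A] <= p x.
    by apply: le_trans (ql t0 x At0) _; exact: (svalP t0).2.
  exists (exist below _ (conj sq qp)) => s As; apply/asboolP => x /=; exact: ql.
have qN y : q (- y) <= - q y.
  have [|||sqy qyl] := @inf_sublinear R [set t | 0 <= t]
    (fun t x => q (x + t%:C%C *: y) - t * q y) (fun x => - q (- x)) 0 (lexx 0).
  - move=> t x /=; rewrite le_eqVlt => /predU1P[<-|t0].
      by rewrite scale0r addr0 mul0r subr0 sublinear_ge.
    have := sq.1 (x + t%:C%C *: y) (- x).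
    by rewrite addrAC subrr add0r sublinearZ//; lra.
  - move=> s t /= s0 t0; exists (s + t); first exact: addr_ge0.
    move=> x z; have := sq.1 (x + s%:C%C *: y) (z + t%:C%C *: y).
    by rewrite addrACA -scalerDl -rmorphD /=; lra.
  - move=> r t /= r0 t0; exists (r * t); first by rewrite mulr_ge0// ltW.
    move=> x; rewrite rmorphM /= -scalerA -scalerDr sublinearZ//.
    by rewrite mulrBr mulrA.
  have qyq x : inf [set q (x + t%:C%C *: y) - t * q y | t in [set t | 0 <= t]] <= q x.
    have := qyl 0 x (lexx 0); by rewrite scale0r addr0 mul0r subr0.
  have E := qmin (exist below _ (conj sqy (fun x => le_trans (qyq x) (qp x)))).
  have {}E := E (asboolT qyq).
  have /(congr1 (fun s : T => sval s (- y))) /= <- := E.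
  have := qyl 1 (- y) ler01.
  by rewrite scale1r addNr sublinear0// sub0r mul1r.
have qNE y : q (- y) = - q y.
  by apply/eqP; rewrite eq_le qN /= lerNl; have := sublinear_ge y sq; lra.
exists q => //; split=> [x y|r x].
  apply/eqP; rewrite eq_le sq.1 /=.
  by have := sq.1 (x + y) (- y); rewrite addrK qNE; lra.
have [r0|r0|->] := ltgtP r 0; last by rewrite mul0r scale0r sublinear0.
  rewrite -[r]opprK rmorphN /= scaleNr qNE sublinearZ ?oppr_gt0//; lra.
by rewrite sublinearZ.
Qed.

(** g is a linear functional below x -> inf_y (p(x - y) + q(-y) + f(y)). The choice y = 0 gives g <=
    p; at - x, the choice y = - x gives f - g <= q. *)
Lemma rlinear_split f p q : rlinear f -> sublinear p -> sublinear q ->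
  (forall x, f x <= p x + q x) ->
  exists2 g, rlinear g & (forall x, g x <= p x) /\ (forall x, f x - g x <= q x).
Proof.
move=> lf sp sq fpq.
have [|||sr rl] := @inf_sublinear V setT
    (fun y x => p (x - y) + (q (- y) + f y)) (fun x => - p (- x)) 0 I.
- move=> y x _; have := fpq (- y); rewrite rlinearN// => h.
  have := sp.1 (x - y) (- x); rewrite addrAC subrr add0r; lra.
- move=> s t _ _; exists (s + t) => // x y.
  rewrite lf.1 opprD addrACA; have := sp.1 (x - s) (y - t).
  by have := sq.1 (- s) (- t); lra.
- move=> r t r0 _; exists (r%:C%C *: t) => // x.
  rewrite -scalerBr -scalerN lf.2; have := sp.2 r (x - t) r0; have := sq.2 r (- t) r0.
  lra.
have [g lg gr] := sublinear_linear sr.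
have f0 : f 0 = 0 by have := lf.2 0 0; rewrite scale0r mul0r.
exists g => //; split=> x.
  apply: le_trans (gr x) _.
  by have /= := rl 0 x I; rewrite subr0 oppr0 (sublinear0 sq) f0 !addr0.
have := gr (- x); rewrite rlinearN// => h.
have /= := rl (- x) (- x) I; rewrite subrr (sublinear0 sp) opprK (rlinearN _ lf); lra.
Qed.

Lemma rlinear_decomposition n f (p : nat -> V -> R) : rlinear f ->
  (forall k, sublinear (p k)) -> (forall x, f x <= \sum_(k < n) p k x) ->
  exists g : nat -> V -> R, [/\ forall k, (k < n)%N -> rlinear (g k),
    forall k x, (k < n)%N -> g k x <= p k x & forall x, f x = \sum_(k < n) g k x].
Proof.
elim: n f => [|n IH] f lf sp fp.
  exists (fun=> f); split => // x; rewrite big_ord0.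
  have h1 := fp x; have h2 := fp (- x); rewrite !big_ord0 rlinearN// in h1 h2 *.
  by apply/eqP; rewrite eq_le; lra.
have ss : sublinear (fun x => \sum_(k < n) p k x).
  split=> [x y|r x r0].
    by rewrite -big_split /=; apply: ler_sum => k _; exact: (sp k).1.
  by rewrite mulr_sumr; apply: ler_sum => k _; exact: (sp k).2.
have [|g lg [gp gq]] := rlinear_split lf ss (sp n).
  by move=> x; have := fp x; rewrite big_ord_recr.
have [h [lh hp hE]] := IH g lg sp gp.
exists (fun k => if k == n then (fun x => f x - g x) else h k); split.
- move=> k; rewrite ltnS leq_eqVlt; case: eqP => [->|_] //= kn.
    split=> [x y|r x]; first by rewrite lf.1 lg.1; ring.
    by rewrite lf.2 lg.2; ring.
  exact: lh.
- move=> k x; rewrite ltnS leq_eqVlt; case: eqP => [->|_] //= kn.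
  exact: hp.
move=> x; rewrite big_ord_recr /= eqxx.
rewrite (eq_bigr (fun k : 'I_n => h k x)) -?hE; first by ring.
by move=> k _; rewrite ltn_eqF.
Qed.

(** A complex linear functional is determined by its real part. Invariance of p under -1 and i
    suffices, at the price of the factor 2. *)
Lemma complexify f p : rlinear f -> (forall x, f x <= p x) ->
  (forall x, p (- x) = p x) -> (forall x, p ('i%C *: x) = p x) ->
  let F x : R[i] := (f x)%:C%C - 'i%C * (f ('i%C *: x))%:C%C in
  (forall (s t : R[i]) x y, F (s *: x + t *: y) = s * F x + t * F y) /\
  forall x, normc (F x) <= 2 * p x.
Proof.
move=> lf fp pN pI F.
have fa x : `|f x| <= p x.
  rewrite ler_norml fp andbT lerNl; have := fp (- x).
  by rewrite rlinearN// pN.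
have FD x y : F (x + y) = F x + F y.
  by rewrite /F scalerDr !lf.1 !rmorphD /=; ring.
have FR r x : F (r%:C%C *: x) = r%:C%C * F x.
  have E : 'i%C *: (r%:C%C *: x) = r%:C%C *: ('i%C *: x) by rewrite !scalerA mulrC.
  by rewrite /F E !lf.2 !rmorphM /=; ring.
have FI x : F ('i%C *: x) = 'i%C * F x.
  rewrite /F scalerA -expr2 sqr_i scaleN1r rlinearN// rmorphN /= mulrBr mulrA -expr2 sqr_i.
  by ring.
have FZ s x : F (s *: x) = s * F x.
  have -> : s = (complex.Re s)%:C%C + 'i%C * (complex.Im s)%:C%C.
    by case: s => a b; apply: complexP => /=; ring.
  by rewrite scalerDl FD FR -scalerA FI FR; ring.
split=> [s t x y|x]; first by rewrite FD !FZ.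
rewrite mulr2n mulrDl mul1r /F.
apply: le_trans (normcB _ _) _; rewrite normcM normc_i mul1r !normc_real.
by apply: lerD => //; rewrite -(pI x).
Qed.

End Hahn_Banach.

Section ultralimits.
Context {R : realType} (G : set_system nat) (GU : UltraFilter G).
Implicit Types (u : nat -> R) (w : nat -> R[i]).

Let GP : ProperFilter G.
Proof. by case: GU. Qed.

(** The limit is the supremum of the x such that x <= u j for almost all j in the sense of [G].
    Limits along one ultrafilter replace the extraction of diagonal subsequences. *)
Let ultra_real u (M : R) : G [set j | `|u j| <= M] ->
  exists l, forall e, 0 < e -> G [set j | `|u j - l| < e].
Proof.
move=> GM; pose S := [set x | G [set j | x <= u j]].
have S0 : S !=set0.
  exists (- M); apply: filterS GM => j /=; rewrite ler_norml => /andP[]//.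
have hS : has_ubound S.
  exists M => x Sx; have [j [/= xj jM]] := filter_ex (filterI Sx GM).
  by apply: le_trans xj (le_trans (ler_norm _) jM).
exists (sup S) => e e0.
have [x Sx xs] := sup_adherent e0 (conj S0 hS).
have [Sy|NSy] := in_ultra_setVsetC [set j | sup S + e <= u j] GU.
  have := ub_le_sup hS Sy; lra.
apply: filterS (filterI Sx NSy) => j /= [xj /negP]; rewrite -ltNge => je.
by rewrite ltr_norml; lra.
Qed.

Lemma ultra_complex w (M : R) : G [set j | normc (w j) <= M] ->
  exists l : R[i], forall e, 0 < e -> G [set j | normc (w j - l) < e].
Proof.
move=> GM.
have [a Ha] : exists l, forall e, 0 < e -> G [set j | `|complex.Re (w j) - l| < e].
  apply: (@ultra_real _ M); apply: filterS GM => j /=; apply: le_trans.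
  exact: le_normc_Re.
have [b Hb] : exists l, forall e, 0 < e -> G [set j | `|complex.Im (w j) - l| < e].
  apply: (@ultra_real _ M); apply: filterS GM => j /=; apply: le_trans.
  exact: le_normc_Im.
exists (a +i* b)%C => e e0; have e2 : 0 < e / 2 by rewrite divr_gt0.
apply: filterS (filterI (Ha _ e2) (Hb _ e2)) => j /= [h1 h2].
by apply: le_lt_trans (normc_le_ReIm _) _; rewrite Re_add Im_add Re_opp Im_opp /=; lra.
Qed.

Lemma filter_bounded_forall (P : nat -> set nat) n :
  (forall i, (i < n)%N -> G (P i)) -> G [set j | forall i, (i < n)%N -> P i j].
Proof.
elim: n => [|n IH] HP; first by apply: filterS filterT => j _ i.
have h := IH (fun i im => HP i (leqW im)).
apply: filterS (filterI h (HP n (ltnSn n))) => j /= [h1 h2] i.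
by rewrite ltnS leq_eqVlt => /predU1P[->|/h1].
Qed.

End ultralimits.

Section Montel.
Context {R : realType} (phi : weight_family R).
Local Notation E := (Espace phi).
Implicit Types (x y e : R) (k j a m n : nat).

Lemma weight_locally_bounded m (r : R) : (0 < m)%N -> 0 <= r ->
  exists2 B, 0 <= B & forall x, `|x| <= r -> expR (phi m x) <= B.
Proof.
move=> m0 r0; have [c c0 Hc] := weight_monotone phi 0 m0.
exists (expR c * (expR (phi m r) + expR (phi m (- r)))).
  by rewrite mulr_ge0 ?addr_ge0 ?expR_ge0.
have e1 := expR_ge0 (phi m r); have e2 := expR_ge0 (phi m (- r)).
have mono y x : 0 <= x <= y \/ y <= x <= 0 -> expR (phi m x) <= expR c * expR (phi m y).
  by move=> /Hc; rewrite -expRD ler_expR !mul0r !subr0 addrC.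
move=> x; case: (ger0P x) => x0 xr.
  apply: le_trans (mono r x _) _; first by left; rewrite x0.
  by rewrite ler_wpM2l ?expR_ge0// lerDl.
apply: le_trans (mono (- r) x _) _; first by right; lra.
by rewrite ler_wpM2l ?expR_ge0// lerDr.
Qed.

(** All derivatives at all points converge along a single ultrafilter; the uniform Taylor bound
    shows that the limits are successive derivatives of a function of E. Approximation in q_m then
    uses the index gap at infinity and a finite grid on a compact interval. *)
Theorem Montel (c : nat -> R) (f_ : nat -> E) :
  (forall j k, (0 < k <= j)%N -> qle phi k (f_ j) (c k)) ->
  exists f : E, (forall k, (0 < k)%N -> qle phi k f (c k)) /\
    forall m e, (0 < m)%N -> 0 < e -> exists j, qle phi m (f_ j - f) e.
Proof.
move=> fc; have [G [GU GF]] := @ultraFilterLemma nat \oo _.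
have GP : ProperFilter G by case: GU.
have Gge k : G [set j | (k <= j)%N] by apply: GF; exists k.
have c0 k : (0 < k)%N -> 0 <= c k.
  by move=> k0; apply: qle_ge0 (fc k k _); rewrite k0 leqnn.
have fb j k a x : (0 < k <= j)%N -> (a <= k)%N ->
    normc (cderiv (f_ j) a x) <= c k * expR (phi k x).
  by move=> kj ak; exact: fc.
have /choice[L HL] : forall ax : nat * R, exists l : R[i], forall e, 0 < e ->
    G [set j | normc (cderiv (f_ j) ax.1 ax.2 - l) < e].
  move=> [a x]; apply: (@ultra_complex _ _ GU _ (c a.+1 * expR (phi a.+1 x))).
  apply: filterS (Gge a.+1) => j /= aj; apply: fb => //.
have Lb k a x : (0 < k)%N -> (a <= k)%N -> normc (L (a, x)) <= c k * expR (phi k x).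
  move=> k0 ak; apply/ler_addgt0Pr => e e0.
  have [j [/= jl kj]] := filter_ex (filterI (HL (a, x) e e0) (Gge k)).
  have -> : L (a, x) = cderiv (f_ j) a x - (cderiv (f_ j) a x - L (a, x)) by ring.
  apply: le_trans (normcB _ _) _; apply: lerD; last exact: ltW.
  by apply: fb => //; rewrite k0.
have dL a x : cder (fun y => L (a, y)) x (L (a.+1, x)).
  have [B B0 HB] := weight_locally_bounded (ltn0Sn a.+1) (addr_ge0 (normr_ge0 x) ler01).
  pose M := c a.+2 * B.
  have M0 : 0 <= M by rewrite mulr_ge0// c0.
  apply: (@cder_quadratic _ _ _ (4 * M)); first by rewrite mulr_ge0.
  move=> h h1; apply/ler_addgt0Pr => e e0.
  have h3 : 0 < 3 :> R by [].
  have e3 : 0 < e / 3 by rewrite divr_gt0.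
  have [j [[/= [j1 j2] j3] aj]] := filter_ex (filterI (filterI (filterI
    (HL (a, x + h) _ e3) (HL (a, x) _ e3)) (HL (a.+1, x) _ e3)) (Gge a.+2)).
  have := @cder_taylor R _ _ _ x (x + h) M (fun y => Ecder (f_ j) a y)
    (fun y => Ecder (f_ j) a.+1 y).
  have -> : x + h - x = h by ring.
  move=> T; have {}T := T _; apply: le_trans (_ : 4 * M * `|h| ^+ 2 + (e / 3 + e / 3 + e / 3) <= _); last by lra.
  have -> : L (a, x + h) - L (a, x) - h%:C%C * L (a.+1, x) =
    (cderiv (f_ j) a (x + h) - cderiv (f_ j) a x - h%:C%C * cderiv (f_ j) a.+1 x) -
    ((cderiv (f_ j) a (x + h) - L (a, x + h)) - (cderiv (f_ j) a x - L (a, x)) -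
      h%:C%C * (cderiv (f_ j) a.+1 x - L (a.+1, x))) by ring.
  apply: le_trans (normcB _ _) _; apply: lerD.
    apply: T => y yh; apply: le_trans (fb j a.+2 a.+2 y aj (leqnn _)) _.
    rewrite ler_wpM2l ?c0//; apply: HB.
    rewrite -[y](subrKC x); apply: le_trans (ler_normD _ _) _.
    by rewrite lerD2l (le_trans yh).
  apply: le_trans (normcB _ _) _; apply: lerD.
    by apply: le_trans (normcB _ _) _; apply: lerD; exact: ltW.
  rewrite normcM normc_real; apply: le_trans (_ : 1 * (e / 3) <= _); last by rewrite mul1r.
  by apply: ler_pM; rewrite ?normc_ge0// ltW.
have [||f _ fE] := @Ebuild R phi (fun a x => L (a, x)).
- exact: dL.
- by move=> m m0; exists (c m) => a x am; exact: Lb.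
exists f; split=> [k k0 a x ak|m e m0 e0]; first by rewrite fE Lb.
(* Beyond r the gap between phi_m and phi_{m+1} alone makes the difference small. *)
pose r := 2 * c m.+1 / e.
have r0 : 0 <= r by rewrite divr_ge0 ?mulr_ge0 ?c0// ltW.
have [B B0 HB] := weight_locally_bounded (ltn0Sn m) r0.
have [q q0 Hq] := weight_lower phi m0.
pose K := 2 * (2 * c m.+1 * B) + 1.
have K0 : 0 < K by rewrite ltr_wpDl// !mulr_ge0// c0.
(* Mesh of the grid: moving from a grid point to x changes a derivative by at most K eta = e q / 2,
   and at the grid points the error is below e q / 2. Here q is a lower bound of the weight. *)
pose eta := e * q / 2 / K.
have eta0 : 0 < eta by rewrite !divr_gt0// mulr_gt0.
have eq2 : 0 < e * q / 2 by rewrite divr_gt0// mulr_gt0.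
pose n := (Num.truncn (2 * r / eta)).+1.
pose pt i := - r + i%:R * eta.
have HG i : G [set j | forall a, (a < m.+1)%N ->
    normc (cderiv (f_ j) a (pt i) - L (a, pt i)) < e * q / 2].
  by apply: (filter_bounded_forall GU) => a _; exact: HL.
have [j [/= jG mj]] := filter_ex (filterI
  (filter_bounded_forall GU (fun i (_ : (i < n)%N) => HG i)) (Gge m.+1)).
have db a x : (a <= m.+1)%N ->
    normc (cderiv (f_ j - f) a x) <= 2 * c m.+1 * expR (phi m.+1 x).
  move=> am; rewrite Ecderiv_sub fE; apply: le_trans (normcB _ _) _.
  have h1 := fb j m.+1 a x mj am; have h2 := Lb m.+1 a x (ltn0Sn m) am.
  lra.
exists j => a x am; have ex0 := expR_ge0 (phi m x).
have [xr|rx] := leP `|x| r; last first.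
  apply: le_trans (db a x (leqW am)) _.
  have x1 : 0 < 1 + `|x| by rewrite ltr_pwDl.
  have : 2 * c m.+1 <= e * (1 + `|x|).
    rewrite [leRHS]mulrC -ler_pdivrMr//; apply: le_trans (ltW rx) _.
    by rewrite lerDr.
  move=> /(ler_wpM2r (expR_ge0 (phi m.+1 x)))/le_trans; apply.
  by rewrite -mulrA ler_wpM2l ?(ltW e0)// expR_weight_gap.
have [x1 x2] : - r <= x /\ x <= r by move: xr; rewrite ler_norml => /andP.
pose i := Num.truncn ((x + r) / eta).
have xr0 : 0 <= (x + r) / eta by rewrite divr_ge0 ?(ltW eta0)//; lra.
have /andP[i1 i2] := truncn_itv xr0; rewrite -/i in i1 i2.
rewrite ler_pdivlMr// in i1; rewrite ltr_pdivrMr// -natr1 mulrDl mul1r in i2.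
have iN : (i < n)%N.
  rewrite /n ltnS; apply: le_truncn; rewrite ler_pM2r ?invr_gt0//; lra.
have hpt := jG i iN a am; rewrite -fE -Ecderiv_sub in hpt.
have lip := @cder_norm R (cderiv (f_ j - f) a) (cderiv (f_ j - f) a.+1) (pt i) x
  (2 * c m.+1 * B).
have ptx : pt i <= x by rewrite /pt; lra.
have {}lip := lip ptx (fun y _ => Ecder (f_ j - f) a y).
have {}lip : normc (cderiv (f_ j - f) a x - cderiv (f_ j - f) a (pt i)) <= e * q / 2.
  apply: le_trans (lip _) _.
    move=> y /andP[y1 y2]; apply: le_trans (db a.+1 y am) _.
    rewrite ler_wpM2l ?mulr_ge0 ?c0//; apply: HB; rewrite ler_norml.
    have : - r <= pt i by rewrite /pt lerDl mulr_ge0// ltW.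
    lra.
  apply: le_trans (_ : K * eta <= _); last by rewrite /eta mulrC divfK ?gt_eqF.
  apply: ler_pM.
  - by rewrite !mulr_ge0// c0.
  - by rewrite subr_ge0.
  - by rewrite /K lerDl.
  by rewrite /pt; lra.
have -> : cderiv (f_ j - f) a x = (cderiv (f_ j - f) a x - cderiv (f_ j - f) a (pt i)) +
  cderiv (f_ j - f) a (pt i) by ring.
apply: le_trans (normcD _ _) _; apply: le_trans (_ : e * q <= _).
  by have := ltW hpt; lra.
by rewrite ler_wpM2l ?(ltW e0).
Qed.

End Montel.

(** * Functionals bounded on a box as finite sums *)

Section dual_decomposition.
Context {R : realType} (phi : weight_family R).
Local Notation E := (Espace phi).
Implicit Types (f g : E) (r t : R) (s : R[i]) (k n N : nat).

(** q_n as a real number, the form required by the Hahn-Banach argument. *)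
Definition Eseminorm n f := inf [set r | 0 <= r /\ qle phi n f r].

Lemma Eseminorm_lbound n f : has_lbound [set r | 0 <= r /\ qle phi n f r].
Proof. by exists 0 => r []. Qed.

Lemma Eseminorm_le n f r : qle phi n f r -> Eseminorm n f <= r.
Proof.
move=> fr; apply: ge_inf; first exact: Eseminorm_lbound.
by split => //; exact: qle_ge0 fr.
Qed.

Lemma Eseminorm_ge0 n f : (0 < n)%N -> 0 <= Eseminorm n f.
Proof.
move=> n0; have [r r0 fr] := Eqle f n0.
by apply: lb_le_inf; [exists r|move=> x []].
Qed.

Lemma qle_Eseminorm n f : (0 < n)%N -> qle phi n f (Eseminorm n f).
Proof.
move=> n0 a x an; have e0 := expR_gt0 (phi n x).
rewrite -ler_pdivrMr//; apply: lb_le_inf.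
  by have [r r0 fr] := Eqle f n0; exists r.
by move=> r [_ fr]; rewrite ler_pdivrMr//; exact: fr.
Qed.

Lemma Eseminorm_scale n s f : (0 < n)%N -> Eseminorm n (s *: f) <= normc s * Eseminorm n f.
Proof. by move=> n0; apply: Eseminorm_le; apply: qle_scale; exact: qle_Eseminorm. Qed.

Lemma Eseminorm_sublinear n r : (0 < n)%N -> 0 <= r ->
  sublinear (fun f : E => r * Eseminorm n f).
Proof.
move=> n0 r0; split=> [f g|t f t0].
  rewrite -mulrDr ler_wpM2l//; apply: Eseminorm_le.
  have := qle_lin 1 1 (qle_Eseminorm f n0) (qle_Eseminorm g n0).
  by rewrite !scale1r normc1 !mul1r.
rewrite mulrCA ler_wpM2l//; have := Eseminorm_scale t%:C%C f n0.
by rewrite normc_real gtr0_norm.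
Qed.

Lemma Eseminorm_unit n s f : (0 < n)%N -> normc s = 1 ->
  Eseminorm n (s *: f) = Eseminorm n f.
Proof.
move=> n0 s1; have sn0 : s != 0 by rewrite -normc_gt0 s1.
apply: le_anti; apply/andP; split.
  by have := Eseminorm_scale s f n0; rewrite s1 mul1r.
have := Eseminorm_scale s^-1 (s *: f) n0.
by rewrite scalerA mulVf// scale1r normcV s1 invr1 mul1r.
Qed.

Lemma bounded_functional_finite (c : nat -> R) (F : Edual phi) :
  (forall f, (forall k, (0 < k)%N -> qle phi k f (c k)) -> normc (F f) <= 1) ->
  exists N, forall f, (forall k, (0 < k <= N)%N -> qle phi k f (c k)) -> normc (F f) <= 2.
Proof.
move=> F1; have [n n0 [C C0 HF]] := Edual_bound F.
have [//|H] := pselect (exists N, forall f,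
  (forall k, (0 < k <= N)%N -> qle phi k f (c k)) -> normc (F f) <= 2).
have /choice[f_ Hf] : forall N, exists f,
    (forall k, (0 < k <= N)%N -> qle phi k f (c k)) /\ 2 < normc (F f).
  move=> N; apply: contrapT => H'; apply: H; exists N => f fc.
  by rewrite leNgt; apply/negP => F2; apply: H'; exists f.
have [|f [fc fa]] := @Montel R phi c f_; first by move=> j k; exact: (Hf j).1.
have C1 : 0 < C + 1 by rewrite ltr_wpDl.
(* This radius gives |F (f_j - f)| <= 1; with |F f| <= 1 it contradicts |F f_j| > 2. *)
have [|j fj] := fa n (C + 1)^-1 n0; first by rewrite invr_gt0.
have := (Hf j).2; have := F1 f fc; have := HF _ _ fj.
have FB : F (f_ j - f) = F (f_ j) - F f.
  by have := Edual_lin F 1 (-1) (f_ j) f; rewrite scale1r scaleN1r mul1r mulN1r.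
have h : C * (C + 1)^-1 <= 1 by rewrite ler_pdivrMr// mul1r lerDl.
have : normc (F (f_ j)) <= normc (F (f_ j) - F f) + normc (F f).
  by rewrite -{1}(subrK (F f) (F (f_ j))) normcD.
rewrite FB; lra.
Qed.

Lemma Edual_decomposition (c : nat -> R) (F : Edual phi) : (forall k, 0 < c k) ->
  (forall f, (forall k, (0 < k)%N -> qle phi k f (c k)) -> normc (F f) <= 1) ->
  exists N (G : nat -> Edual phi),
    (forall k f t, (k < N)%N -> qle phi k.+1 f t -> normc (G k f) <= 4 / c k.+1 * t) /\
    forall f, F f = \sum_(k < N) G k f.
Proof.
move=> c0 F1; have [N F2] := bounded_functional_finite F1.
(* Shifted by one, as only indices at least 1 carry hypotheses. The constant 4 of the statement is
   this 2, due to [bounded_functional_finite], times the 2 of [complexify]. *)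
pose p k (f : E) := 2 / c k.+1 * Eseminorm k.+1 f.
have pc k : 0 <= 2 / c k.+1 by rewrite divr_ge0// ltW.
have sp k : sublinear (p k) by exact: Eseminorm_sublinear.
have FS s t f g : F (s *: f + t%:C%C *: g) = s * F f + t%:C%C * F g by exact: Edual_lin.
pose re (f : E) := complex.Re (F f).
have FD f g : F (f + g) = F f + F g.
  by have := Edual_lin F 1 1 f g; rewrite !scale1r !mul1r.
have FZ s f : F (s *: f) = s * F f.
  by have := Edual_lin F s 0 f 0; rewrite scaler0 addr0 mul0r addr0.
have lre : rlinear re.
  split=> [f g|r f]; first by rewrite /re FD Re_add.
  by rewrite /re FZ Re_mul /= mul0r subr0.
have rep f : re f <= \sum_(k < N) p k f.
  pose S := \sum_(k < N) Eseminorm k.+1 f / c k.+1.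
  have term k : 0 <= Eseminorm k.+1 f / c k.+1.
    by rewrite divr_ge0 ?Eseminorm_ge0// ltW.
  have S0 : 0 <= S by apply: sumr_ge0 => k _; exact: term.
  have -> : \sum_(k < N) p k f = 2 * S.
    by rewrite /S mulr_sumr; apply: eq_bigr => k _; rewrite /p; ring.
  apply: le_trans (ler_norm _) _; apply: le_trans (le_normc_Re _) _.
  (* f / d lies in the finite box, because each q_k(f) / c_k is a term of the sum S <= d; the
     summand e / 2 keeps d positive. *)
  apply/ler_addgt0Pr => e e0; pose d := S + e / 2.
  have d0 : 0 < d by rewrite ltr_wpDl// divr_gt0.
  have -> : 2 * S + e = d * 2 by rewrite /d; lra.
  rewrite mulrC -ler_pdivrMr// mulrC.
  have := F2 ((d^-1)%:C%C *: f); rewrite FZ normcM normc_real normfV gtr0_norm//.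
  apply=> k /andP[k0 kN].
  apply: (qle_mono k0 (leqnn k)) (qle_scale (d^-1)%:C%C (qle_Eseminorm f k0)).
  rewrite normc_real normfV gtr0_norm// ler_pdivrMl// -ler_pdivrMr//.
  apply: le_trans (_ : S <= _); last by rewrite lerDl divr_ge0// ltW.
  case: k k0 kN => // k _ kN; rewrite /S (bigD1 (Ordinal kN))//= lerDl.
  by apply: sumr_ge0 => i _; exact: term.
have [g [lg gp gE]] := rlinear_decomposition lre sp rep.
have pN k f : p k (- f) = p k f.
  by rewrite /p -scaleN1r Eseminorm_unit// normc_opp normc1.
have pI k f : p k ('i%C *: f) = p k f by rewrite /p Eseminorm_unit// normc_i.
pose Gf k (f : E) : R[i] := (g k f)%:C%C - 'i%C * (g k ('i%C *: f))%:C%C.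
have Gk k : (k < N)%N -> (forall (s t : R[i]) x y, Gf k (s *: x + t *: y) = s * Gf k x + t * Gf k y) /\
    forall x, normc (Gf k x) <= 2 * p k x.
  by move=> kN; apply: (complexify (lg k kN)) => // x; exact: gp.
have Gb k f t : (k < N)%N -> qle phi k.+1 f t -> normc (Gf k f) <= 4 / c k.+1 * t.
  move=> kN ft; apply: le_trans ((Gk k kN).2 f) _.
  have -> : 4 / c k.+1 * t = 2 * (2 / c k.+1 * t) by field; rewrite gt_eqF.
  by rewrite ler_pM2l// ler_wpM2l// Eseminorm_le.
have /choice[G HG] : forall k, exists G : Edual phi, (k < N)%N -> forall f, G f = Gf k f.
  move=> k; have [kN|] := boolP (k < N)%N; last by exists F.
  have [G GE] := Edual_build (isT : (0 < k.+1)%N) (Gk k kN).1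
    (fun f r => Gb k f r kN).
  by exists G.
exists N, G; split=> [k f t kN ft|f]; first by rewrite HG//; exact: Gb.
rewrite (eq_bigr (fun k : 'I_N => Gf k f)); last by move=> k _; rewrite HG.
rewrite sumrB -mulr_sumr -!rmorph_sum /= -!gE /re FZ.
by case: (F f) => a b; apply: complexP => /=; ring.
Qed.

End dual_decomposition.

(** * The topological isomorphism *)

Section isomorphism.
Context {R : realType} (phi : weight_family R).
Local Notation E := (Espace phi).
Local Notation Q := (Qspace phi).
Implicit Types (F G : Edual phi) (g h : Q) (r t e : R) (s z : R[i]) (m n k N : nat).

Lemma QspaceP g : (forall z, holo g z) /\ exists2 m, (0 < m)%N &
  exists r, forall z, normc (g z) <=
    r * ((1 + normc z) ^+ m * expR (legendre (phi m) (complex.Im z))).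
Proof.
have [eg [m m0 /Qnorm_ltP[r _ Hr]]] : entire g /\
    exists2 m, (0 < m)%N & (Qnorm m (phi m) g < +oo)%E.
  by case: g => g /=; rewrite inE.
by split=> [z|]; [apply/holoP; exact: eg|exists m => //; exists r].
Qed.

Lemma Qspace_ext g h : (forall z, g z = h z) -> g = h.
Proof. by move=> gh; apply: val_inj; apply/funext. Qed.

Definition transform F : Q := MkQ (Fhat_Qpred F).

Lemma transformE F z : transform F z = F (expE phi z).
Proof. by []. Qed.

Lemma transform_linear : linear transform.
Proof. by move=> s F G; apply: Qspace_ext. Qed.

Lemma transform_inj F G : transform F = transform G -> F = G.
Proof.
move=> FG; apply/eqP; rewrite -subr_eq0; apply/eqP; apply: Edual_ext => f.
apply: Fourier_Laplace_injective => z.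
rewrite -[LHS]/(transform F z - transform G z).
by rewrite FG subrr.
Qed.

Lemma transform_surj g : exists F, transform F = g.
Proof.
have [hg [m m0 [r Hr]]] := QspaceP g.
have [C [n [_ _ H]]] := transform_onto phi m0.
have [F FE _] := H g r hg Hr.
by exists F; apply: Qspace_ext => z; rewrite transformE FE.
Qed.

(** The coefficients 1/2, 1/4, ... have sum at most 1; the first half is split off and the remaining
    sum is again of this form, halved. *)
Lemma absconvex_sum (U : set Q) (x : nat -> Q) N : absolutely_convex U -> U 0 ->
  (forall k, (k < N)%N -> U (x k)) ->
  U (\sum_(k < N) ((2 ^- k.+1)%:C%C : R[i]) *: x k).
Proof.
move=> cU U0; elim: N x => [|N IH] x Ux; first by rewrite big_ord0.
rewrite big_ord_recl expr1.
have -> : \sum_(i < N) ((2 ^- (lift ord0 i).+1)%:C%C : R[i]) *: x (lift ord0 i) =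
    (2^-1)%:C%C *: \sum_(i < N) ((2 ^- i.+1)%:C%C : R[i]) *: x i.+1.
  rewrite scaler_sumr; apply: eq_bigr => i _; rewrite scalerA -rmorphM /=.
  by congr ((_)%:C%C *: x _); rewrite exprS invfM.
apply: cU; last 2 first.
- exact: Ux.
- by apply: (IH (fun k => x k.+1)) => k kN; exact: Ux.
rewrite !normcE !normc_real -rmorphD /= -[leRHS]/(1%:C)%C lecR.
by rewrite ger0_norm ?invr_ge0//; lra.
Qed.

Lemma Qfun_sum N (a : nat -> R[i]) (x : nat -> Q) z :
  (\sum_(k < N) a k *: x k : Q) z = \sum_(k < N) a k * x k z.
Proof.
elim: N => [|N IH]; first by rewrite !big_ord0.
by rewrite !big_ord_recr /= -IH.
Qed.

(** Uniform closeness on such a box is therefore a neighbourhood condition in the strong dual. *)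
Lemma bounded_box (c : nat -> R) : (forall k, 0 < c k) ->
  vn_bounded [set f : E | forall k, (0 < k)%N -> qle phi k f (c k)].
Proof.
move=> c0 U /nbhs_Espace[n n0 [e e0 HU]].
exists (c n / e)%:C%C; first by rewrite ltcR divr_gt0.
move=> t; rewrite normcE lecR => tc f fc.
have ce : 0 < c n / e by rewrite divr_gt0.
have t0 : 0 < normc t by exact: lt_le_trans tc.
have tn0 : t != 0 by rewrite -normc_gt0.
exists (t^-1 *: f); last by rewrite scalerA mulfV// scale1r.
apply: HU; rewrite subr0.
apply: (qle_mono n0 (leqnn n)) (qle_scale t^-1 (fc n n0)).
rewrite normcV ler_pdivrMl//; rewrite ler_pdivrMr// in tc.
Qed.

Lemma transform_continuous : continuous (transform : Edual phi -> Q).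
Proof.
move=> F U [V [cV HV] VU].
have /choice[eps Heps] : forall m, exists e : R, 0 < e /\ ((0 < m)%N ->
    forall g : Q, (Qnorm m (phi m) g < e%:E)%E -> V g).
  move=> m; have [m0|] := boolP (0 < m)%N; last by exists 1; split.
  by have [e e0 He] := HV m m0; exists e.
(* Chosen so that 2^(k+1) times 4 / c_{k+1} is eps_{k+1} / 2: the summands, rescaled for
   [absconvex_sum], then fall into the given neighbourhood. *)
pose c k := 8 * 2 ^+ k / eps k.
have c0 k : 0 < c k by rewrite divr_gt0 ?mulr_gt0 ?exprn_gt0//; have [] := Heps k.
have V0 : V 0.
  have [e0 He] := Heps 1%N; apply: He => //; apply/Qnorm_ltP; exists 0.
    by rewrite lte_fin.
  by move=> z; rewrite mul0r -[(0 : Q) z]/(0 : R[i]) normc0.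
have small G : (forall f : E, (forall k, (0 < k)%N -> qle phi k f (c k)) ->
    normc (G f) <= 1) -> V (transform G).
  move=> G1; have [N [Gk [Gb GE]]] := Edual_decomposition c0 G1.
  pose x k := (2 ^+ k.+1)%:C%C *: transform (Gk k).
  have -> : transform G = \sum_(k < N) (2 ^- k.+1)%:C%C *: x k.
    apply: Qspace_ext => z; rewrite (Qfun_sum N (fun k => (2 ^- k.+1)%:C%C) x).
    rewrite transformE GE; apply: eq_bigr => k _.
    rewrite -[x k z]/((2 ^+ k.+1)%:C%C * Gk k (expE phi z)) mulrA -rmorphM /=.
    by rewrite mulVf ?expf_neq0// mul1r.
  apply: absconvex_sum => // k kN; have [e0 He] := Heps k.+1; apply: He => //.
  apply/Qnorm_ltP; exists (eps k.+1 / 2).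
    by rewrite lte_fin ltr_pdivrMr// ltr_pMr// ltr1n.
  move=> z; rewrite -[x k z]/((2 ^+ k.+1)%:C%C * Gk k (expE phi z)) normcM normc_real.
  rewrite ger0_norm ?exprn_ge0//.
  have := Gb k _ _ kN (expE_qle phi z (ltn0Sn k)) => /(ler_wpM2l (exprn_ge0 k.+1 (ler0n R 2))).
  move=> /le_trans; apply; rewrite !mulrA -[leRHS]mulrA -[leLHS]mulrA ler_wpM2r.
  - by [].
  - by rewrite mulr_ge0 ?expR_ge0// exprn_ge0// addr_ge0// normc_ge0.
  by rewrite /c le_eqVlt; apply/orP; left; apply/eqP; field; rewrite !gt_eqF ?exprn_gt0.
have c1 : nbhs (dual_fun F : {family @vn_bounded _ (Espace phi), Espace phi -> R[i]^o})
    [set h | forall f, [set f : E | forall k, (0 < k)%N -> qle phi k f (c k)] f ->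
      ball (F f) 1 (h f)].
  apply: (@fam_nbhs _ _ (@vn_bounded _ (Espace phi)) _ [set xy | ball xy.1 1 xy.2]).
    exact: entourage_ball (PosNum (ltr01 : 0 < (1 : R[i]))).
  exact: bounded_box.
have := @initial_continuous _ _ (@dual_fun R phi : Edual phi ->
  {family @vn_bounded _ (Espace phi), Espace phi -> R[i]^o}) F _ c1.
move=> H.
have {}H : nbhs F [set G : Edual phi | forall f : E,
    (forall k, (0 < k)%N -> qle phi k f (c k)) -> ball (dual_fun F f) 1 (dual_fun G f)].
  exact: H.
apply: filterS H => G GF; apply: VU.
have -> : transform G - transform F = transform (G - F) by apply: Qspace_ext.
apply: small => f fc; have := GF f fc; rewrite -ball_normE /= normcE -[ltRHS]/(1%:C)%C ltcR.
by move=> /ltW; rewrite normc_dist.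
Qed.

Lemma vn_bounded_qle (S : set E) n : (0 < n)%N -> vn_bounded S ->
  exists2 t, 0 < t & forall f, S f -> qle phi n f t.
Proof.
move=> n0 bS; have [|u u0 Su] := bS [set f | qle phi n f 1].
  by apply/nbhs_Espace; exists n => //; exists 1 => // f; rewrite subr0.
exists (normc u); first by rewrite normc_gt0 gt_eqF.
move=> f Sf; have [|g g1 <-] := Su u _ f Sf; first by rewrite ger0_norm// ltW.
by have := qle_scale u g1; rewrite mulr1.
Qed.

(** For bounded S the set of h with |B h| <= e on S is absolutely convex, so it is enough to meet
    each step Q(phi~_m) in a neighbourhood of 0; this is the bound of [transform_onto], whose C and
    n depend on m only. *)
Lemma inverse_continuous (B : Q -> Edual phi) :
  cancel transform B -> cancel B transform -> continuous B.
Proof.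
move=> AB BA.
have Blin s1 s2 f g h : B (s1 *: g + s2 *: h) f = s1 * B g f + s2 * B h f.
  have -> : s1 *: g + s2 *: h = transform (s1 *: B g + s2 *: B h).
    by rewrite -{1}(BA g) -{1}(BA h); exact: Qspace_ext.
  by rewrite AB.
apply: (@continuous_comp_initial _ _ _
  (@dual_fun R phi : Edual phi -> {family @vn_bounded _ (Espace phi), Espace phi -> R[i]^o})).
move=> g.
have Fg : Filter ((fun x => (@dual_fun R phi \o B) x) @ nbhs g) by exact: fmap_filter.
apply/(@fam_cvgP _ _ _ _ _ Fg) => S bS P /uniform_nbhs[D [entD DP]].
have [e e0 eD] : exists2 e : R, 0 < e & forall x y, normc (x - y) <= e -> D (x, y).
  move: entD; rewrite -entourage_from_ballE => -[d /= d0 dD].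
  have [d1 dE] : 0 < complex.Re d /\ d = (complex.Re d)%:C%C.
    by case: (d) d0 => a b; rewrite ltcE /= => /andP[/eqP -> a0].
  exists (complex.Re d / 2) => [|x y xy]; first by rewrite divr_gt0.
  apply: (dD (x, y)); rewrite /= -ball_normE /= normcE dE ltcR.
  by apply: le_lt_trans xy _; rewrite ltr_pdivrMr// ltr_pMr// ltr1n.
exists [set h : Q | forall f, S f -> normc (B h f) <= e].
  split=> [s t x y st Bx By f Sf|m m0].
    rewrite Blin; apply: le_trans (normc_comb _ _ _ _) _.
    have {}st : normc s + normc t <= 1.
      by move: st; rewrite !normcE -rmorphD /= -[leRHS]/(1%:C)%C lecR.
    apply: le_trans (_ : normc s * e + normc t * e <= _).
      by apply: lerD; rewrite ler_wpM2l ?normc_ge0 ?Bx ?By.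
    by rewrite -mulrDl ler_piMl// ltW.
  have [C [n [C0 n0 H]]] := transform_onto phi m0.
  have [t t0 St] := vn_bounded_qle n0 bS.
  exists (e / (C * t + 1)); first by rewrite divr_gt0// ltr_wpDl// mulr_ge0// ltW.
  move=> h /Qnorm_ltP[r re hr] f Sf.
  have [hh _] := QspaceP h.
  have [F FE FC] := H h r hh hr.
  (* Injectivity identifies the constructed functional, the only one with a known bound, with the
     given inverse. *)
  have -> : B h = F.
    by apply: transform_inj; rewrite BA; apply: Qspace_ext => z; rewrite transformE FE.
  apply: le_trans (FC _ _ (St f Sf)) _.
  have Ct : 0 <= C * t by rewrite mulr_ge0// ltW.
  have r0 : 0 <= r.
    by have := le_trans (normc_ge0 _) (hr 0); rewrite pmulr_lge0// Qweight_gt0.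
  move: re; rewrite lte_fin ltr_pdivlMr ?ltr_wpDl// => re.
  by apply: le_trans (ltW re); rewrite mulrDr mulr1 mulrAC mulrC lerDl.
move=> h Bh; apply: DP => f Sf; apply: eD.
have -> : (@dual_fun R phi \o B) g f - (@dual_fun R phi \o B) h f = - B (h - g) f.
  have := Blin 1 (-1) f h g; rewrite scale1r scaleN1r => ->; rewrite /=; ring.
by rewrite normc_opp; exact: Bh.
Qed.

End isomorphism.

Theorem theorem2 (R : realType) (phi : nat -> R -> R)
  (phi_convex : forall m, (0 < m)%N ->
    convex_function [set: convex_lmodType R^o] (phi m))
  (phi_cvgNy : forall m, (0 < m)%N ->
    phi m x / `|x| @[x --> -oo] --> +oo)
  (phi_cvgy : forall m, (0 < m)%N ->
    phi m x / `|x| @[x --> +oo] --> +oo)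
  (phi_gap : forall m, (0 < m)%N -> forall x : R,
    ln (1 + `|x|) <= phi m x - phi m.+1 x) :
  let Phi := WeightFamily phi_convex phi_cvgNy phi_cvgy phi_gap in
  exists A : {linear Edual Phi -> Qspace Phi},
    (forall (F : Edual Phi) (lambda : R[i]), A F lambda = F (expE Phi lambda))
    /\ topological_isomorphism A.
Proof.
move=> Phi.
have [B AB] := choice (@transform_surj R Phi).
have BA : cancel (@transform R Phi) B by move=> F; apply: transform_inj; rewrite AB.
pose linA := GRing.isLinear.Build _ _ _ _ _ (@transform_linear R Phi).
pose A : {linear Edual Phi -> Qspace Phi} := HB.pack (@transform R Phi) linA.
exists A; split=> //; exists B; split=> //.
  exact: transform_continuous.
exact: inverse_continuous.
Qed.
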